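(* Let $n\ge 1$. (a) Let $A$ be a strongly $(n,d)$-representation-directed algebra and assume that there exists a simple projective $A$-module $P$ with injective dimension $d$. Let $\Lambda$ be the gluing of $\Lambda_{n+1,2}$ and $A$ in which the simple injective $\Lambda_{n+1,2}$-module $I(1)$ is glued with the simple projective $A$-module $P$, that is $\Lambda=\Lambda_{n+1,2}\,{}^{P}\!\triangleright^{I(1)}A$. Then $\Lambda$ is strongly $(n,d+n)$-representation-directed and there exists a simple projective $\Lambda$-module $P'$ with injective dimension $d+n$. (b) Let $B$ be a strongly $(n,d)$-representation-directed algebra and assume that there exists a simple injective $B$-module $I$ with projective dimension $d$. Let $\Lambda=B\,{}^{P(n+1)}\!\triangleright^{I}\Lambda_{n+1,2}$ be the gluing in which the simple injective $B$-module $I$ is glued with the simple projective $\Lambda_{n+1,2}$-module $P(n+1)$. Then $\Lambda$ is strongly $(n,d+n)$-representation-directed and there exists a simple injective $\Lambda$-module $I'$ with projective dimension $d+n$.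
   Context: $K$ is an algebraically closed field; algebras are basic finite-dimensional unital associative $K$-algebras; modules are finite-dimensional right modules; paths are composed left to right, $P(k)=e_k\Lambda$ and $I(k)=D(\Lambda e_k)$ with $D=\operatorname{Hom}_K(-,K)$ are the indecomposable projective and injective modules at vertex $k$. An algebra is representation-directed if there is no sequence of nonzero nonisomorphisms $M_0\to M_1\to\cdots\to M_t$ ($t\ge1$) between indecomposable modules with $M_0\cong M_t$. A full subcategory $\mathcal{C}\subseteq\operatorname{mod}\Lambda$ closed under isomorphisms, direct sums and summands is $n$-cluster tilting if $\mathcal{C}=\{X\mid\operatorname{Ext}^i_\Lambda(\mathcal{C},X)=0,\ 0<i<n\}=\{X\mid\operatorname{Ext}^i_\Lambda(X,\mathcal{C})=0,\ 0<i<n\}$. An algebra is strongly $(n,d)$-representation-directed if it is representation-directed, has global dimension $d$, and admits an $n$-cluster tilting subcategory. $\Lambda_{m,h}=KA_m/\operatorname{rad}(KA_m)^h$, where $A_m$ is the quiver $1\to2\to\cdots\to m$. Gluing along simples: for algebras $A,B$, a simple projective $A$-module $P\cong eA$ and a simple injective $B$-module $I\cong D(B\epsilon)$ ($e,\epsilon$ primitive idempotents), let $f_P:A\to K$ be the unique $K$-algebra homomorphism with $f_P(e)=1$, $f_P(1-e)=0$, and $g_I:B\to K$ the unique one with $g_I(\epsilon)=1$, $g_I(1-\epsilon)=0$. The gluing is $B\,{}^{P}\!\triangleright^{I}A:=\{(a,b)\in A\times B\mid f_P(a)=g_I(b)\}$. *)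

(* Defs.v *)
From HB Require Import structures.
From mathcomp Require Import all_boot all_order all_algebra all_field.

Set Implicit Arguments.
Unset Strict Implicit.
Unset Printing Implicit Defensive.

Import GRing.Theory.
Local Open Scope ring_scope.

Section Modules.
Variables (K : fieldType) (A : falgType K).

(* Finite-dimensional right A-modules: rm_act x a is x . a *)
Record rmodule := RModule {
  rm_sort :> vectType K;
  rm_act : rm_sort -> A -> rm_sort;
  rm_act_linearl : forall a, linear (rm_act^~ a);
  rm_act_linearr : forall x, linear (rm_act x);
  rm_act1 : forall x, rm_act x 1 = x;
  rm_actM : forall x a b, rm_act x (a * b) = rm_act (rm_act x a) b }.

Definition rhom (M N : rmodule) (f : 'Hom(M, N)) : Prop :=
  forall x a, f (rm_act x a) = rm_act (f x) a.

Definition is_riso (M N : rmodule) (f : 'Hom(M, N)) : Prop :=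
  rhom f /\ bijective f.

Definition riso (M N : rmodule) : Prop :=
  exists f : 'Hom(M, N), is_riso f.

Definition zero_rmodule (M : rmodule) : Prop := (fullv : {vspace M}) = 0%VS.

Definition submodule (M : rmodule) (U : {vspace M}) : Prop :=
  forall x a, x \in U -> rm_act x a \in U.

Definition simple_rmodule (M : rmodule) : Prop :=
  ~ zero_rmodule M /\
  forall U : {vspace M}, submodule U -> U = 0%VS \/ U = fullv.

Definition indecomposable (M : rmodule) : Prop :=
  ~ zero_rmodule M /\
  forall U V : {vspace M}, submodule U -> submodule V ->
    (U + V)%VS = fullv -> (U :&: V)%VS = 0%VS -> U = 0%VS \/ V = 0%VS.

Definition projective_rmodule (P : rmodule) : Prop :=
  forall (X Y : rmodule) (p : 'Hom(X, Y)) (h : 'Hom(P, Y)),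
    rhom p -> limg p = fullv -> rhom h ->
    exists2 k : 'Hom(P, X), rhom k & (p \o k)%VF = h.

Definition injective_rmodule (I : rmodule) : Prop :=
  forall (X Y : rmodule) (i : 'Hom(X, Y)) (h : 'Hom(X, I)),
    rhom i -> lker i = 0%VS -> rhom h ->
    exists2 k : 'Hom(Y, I), rhom k & (k \o i)%VF = h.

Section DirectSum.
Variables M N : rmodule.

Definition dsum_act (x : M * N) (a : A) : M * N :=
  (rm_act x.1 a, rm_act x.2 a).

Fact dsum_act_linearl a : linear (dsum_act^~ a).
Proof.
by move=> k x y; congr pair; rewrite /= ?(rm_act_linearl a).
Qed.

Fact dsum_act_linearr x : linear (dsum_act x).
Proof. by move=> k a b; congr pair; rewrite /= rm_act_linearr. Qed.

Fact dsum_act1 x : dsum_act x 1 = x.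
Proof. by case: x => x y; rewrite /dsum_act /= !rm_act1. Qed.

Fact dsum_actM x a b : dsum_act x (a * b) = dsum_act (dsum_act x a) b.
Proof. by rewrite /dsum_act /= !rm_actM. Qed.

Definition dsum : rmodule :=
  RModule dsum_act_linearl dsum_act_linearr dsum_act1 dsum_actM.
End DirectSum.

Section RightIdeal.
Variable e : A.
Let U : {vspace A} := limg (amull e).

Definition eA_act (x : subvs_of U) (a : A) : subvs_of U :=
  vsproj U (vsval x * a).

Fact vsval_eA_act x a : vsval (eA_act x a) = vsval x * a.
Proof.
rewrite /eA_act vsprojK //; case/memv_imgP: (subvsP x) => y _ ->.
rewrite lfunE /= -mulrA; apply/memv_imgP; exists (y * a); rewrite ?memvf //.
by rewrite lfunE.
Qed.

Fact eA_act_linearl a : linear (eA_act^~ a).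
Proof.
move=> k x y; apply: val_inj; rewrite linearP /= !vsval_eA_act.
by rewrite linearP /= mulrDl scalerAl.
Qed.

Fact eA_act_linearr x : linear (eA_act x).
Proof.
move=> k a b; apply: val_inj; rewrite linearP /= !vsval_eA_act.
by rewrite mulrDr scalerAr.
Qed.

Fact eA_act1 x : eA_act x 1 = x.
Proof. by apply: val_inj; rewrite /= vsval_eA_act mulr1. Qed.

Fact eA_actM x a b : eA_act x (a * b) = eA_act (eA_act x a) b.
Proof. by apply: val_inj; rewrite /= !vsval_eA_act mulrA. Qed.

(* The right module e A *)
Definition proj_at : rmodule :=
  RModule eA_act_linearl eA_act_linearr eA_act1 eA_actM.
End RightIdeal.

Section DualLeftIdeal.
Variable e : A.
Let U : {vspace A} := limg (amulr e).

Definition Ae_lmul (a : A) : 'End(subvs_of U) :=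
  linfun (vsproj U \o amull a \o vsval).

Fact vsval_Ae_lmul a x : vsval (Ae_lmul a x) = a * vsval x.
Proof.
rewrite lfunE /= vsprojK; first by rewrite lfunE.
rewrite lfunE /=; case/memv_imgP: (subvsP x) => y _ ->.
rewrite lfunE /= mulrA; apply/memv_imgP; exists (a * y); rewrite ?memvf //.
by rewrite lfunE.
Qed.

Definition DAe_act (phi : 'Hom(subvs_of U, K^o)) (a : A) :
  'Hom(subvs_of U, K^o) := (phi \o Ae_lmul a)%VF.

Fact DAe_act_linearl a : linear (DAe_act^~ a).
Proof. by move=> k f g; rewrite /DAe_act comp_lfunDl comp_lfunZl. Qed.

Fact DAe_act_linearr f : linear (DAe_act f).
Proof.
move=> k a b; apply/lfunP=> x.
rewrite add_lfunE scale_lfunE !comp_lfunE -linearP; congr (f _).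
by apply: val_inj; rewrite linearP /= !vsval_Ae_lmul mulrDl scalerAl.
Qed.

Fact DAe_act1 f : DAe_act f 1 = f.
Proof.
apply/lfunP=> x; rewrite comp_lfunE; congr (f _); apply: val_inj.
by rewrite /= vsval_Ae_lmul mul1r.
Qed.

Fact DAe_actM f a b : DAe_act f (a * b) = DAe_act (DAe_act f a) b.
Proof.
apply/lfunP=> x; rewrite !comp_lfunE; congr (f _); apply: val_inj.
by rewrite /= !vsval_Ae_lmul mulrA.
Qed.

(* The right module D(A e) *)
Definition inj_at : rmodule :=
  RModule DAe_act_linearl DAe_act_linearr DAe_act1 DAe_actM.
End DualLeftIdeal.

(* ... -> P_1 -> P_0 -> X -> 0 *)
Record proj_resolution (X : rmodule) := ProjResolution {
  pr_obj :> nat -> rmodule;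
  pr_d : forall i, 'Hom(pr_obj i.+1, pr_obj i);
  pr_aug : 'Hom(pr_obj 0%N, X);
  pr_projective : forall i, projective_rmodule (pr_obj i);
  pr_d_rhom : forall i, rhom (pr_d i);
  pr_aug_rhom : rhom pr_aug;
  pr_aug_epi : limg pr_aug = fullv;
  pr_exact0 : lker pr_aug = limg (pr_d 0%N);
  pr_exact : forall i, lker (pr_d i) = limg (pr_d i.+1) }.

(* 0 -> X -> I_0 -> I_1 -> ... *)
Record inj_resolution (X : rmodule) := InjResolution {
  ir_obj :> nat -> rmodule;
  ir_d : forall i, 'Hom(ir_obj i, ir_obj i.+1);
  ir_aug : 'Hom(X, ir_obj 0%N);
  ir_injective : forall i, injective_rmodule (ir_obj i);
  ir_d_rhom : forall i, rhom (ir_d i);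
  ir_aug_rhom : rhom ir_aug;
  ir_aug_mono : lker ir_aug = 0%VS;
  ir_exact0 : lker (ir_d 0%N) = limg ir_aug;
  ir_exact : forall i, lker (ir_d i.+1) = limg (ir_d i) }.

Definition cocycle X (P : proj_resolution X) (Y : rmodule) (i : nat)
    (f : 'Hom(P i, Y)) : Prop :=
  rhom f /\ (f \o pr_d P i)%VF = 0.

Definition coboundary X (P : proj_resolution X) (Y : rmodule) (i : nat) :
    'Hom(P i, Y) -> Prop :=
  match i with
  | 0%N => fun f => f = 0
  | j.+1 => fun f => exists2 g : 'Hom(P j, Y), rhom g & f = (g \o pr_d P j)%VF
  end.

(* Ext^i(X, Y) = 0, i.e. H^i(Hom(P, Y)) = 0 for P a projective resolution of
   X; this does not depend on P, and a resolution always exists. *)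
Definition Ext_zero (i : nat) (X Y : rmodule) : Prop :=
  forall (P : proj_resolution X) (f : 'Hom(P i, Y)),
    cocycle f -> coboundary f.

Definition pd_le (X : rmodule) (d : nat) : Prop :=
  exists P : proj_resolution X, forall i, (d < i)%N -> zero_rmodule (P i).

Definition id_le (X : rmodule) (d : nat) : Prop :=
  exists I : inj_resolution X, forall i, (d < i)%N -> zero_rmodule (I i).

Definition least (p : nat -> Prop) (d : nat) : Prop :=
  p d /\ forall d', p d' -> (d <= d')%N.

Definition projdim (X : rmodule) (d : nat) : Prop := least (pd_le X) d.
Definition injdim (X : rmodule) (d : nat) : Prop := least (id_le X) d.

Definition gldim (d : nat) : Prop :=
  least (fun d' => forall X : rmodule, pd_le X d') d.

Definition primitive_idempotent (e : A) : Prop :=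
  [/\ e != 0, e * e = e &
      forall e1 e2 : A, e1 * e1 = e1 -> e2 * e2 = e2 ->
        e1 * e2 = 0 -> e2 * e1 = 0 -> e = e1 + e2 -> e1 = 0 \/ e2 = 0].

Definition basic : Prop :=
  exists (r : nat) (e : 'I_r -> A),
    [/\ forall i, primitive_idempotent (e i),
        forall i j, i != j -> e i * e j = 0,
        \sum_i e i = 1 &
        forall i j, i != j -> ~ riso (proj_at (e i)) (proj_at (e j))].

Definition representation_directed : Prop :=
  ~ exists (t : nat) (M : nat -> rmodule),
      [/\ (0 < t)%N,
          forall i, (i <= t)%N -> indecomposable (M i),
          forall i, (i < t)%N -> exists f : 'Hom(M i, M i.+1),
            [/\ rhom f, f != 0 & ~ is_riso f] &
          riso (M 0%N) (M t)].

Definition cluster_tilting (n : nat) (C : rmodule -> Prop) : Prop :=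
  [/\ forall X Y, riso X Y -> C X -> C Y,
      forall X Y, C (dsum X Y) <-> C X /\ C Y,
      forall X, C X <->
        forall Y, C Y -> forall i, (0 < i < n)%N -> Ext_zero i Y X &
      forall X, C X <->
        forall Y, C Y -> forall i, (0 < i < n)%N -> Ext_zero i X Y].

(* All algebras under consideration are basic, hence the first clause. *)
Definition strongly_representation_directed (n d : nat) : Prop :=
  [/\ basic, representation_directed, gldim d &
      exists C : rmodule -> Prop, cluster_tilting n C].

Definition right_ideal (U : {vspace A}) : Prop :=
  forall x a, x \in U -> x * a \in U.

Definition maximal_right_ideal (U : {vspace A}) : Prop :=
  [/\ right_ideal U, U <> fullv &
      forall V, right_ideal V -> (U <= V)%VS -> V = U \/ V = fullv].

Definition is_radical (J : {vspace A}) : Prop :=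
  forall x, x \in J <-> forall U, maximal_right_ideal U -> x \in U.

End Modules.

(* Paths of the linear quiver 0 -> 1 -> ... -> m.-1: there is exactly one path
   from i to j when i <= j, and none otherwise. *)
Definition lpath (m : nat) := {p : 'I_m * 'I_m | (p.1 <= p.2)%N}.
Definition lsrc m (p : lpath m) : 'I_m := (val p).1.
Definition ltgt m (p : lpath m) : 'I_m := (val p).2.

(* p is the path q followed by r *)
Definition lconcat m (q r p : lpath m) : bool :=
  [&& ltgt q == lsrc r, lsrc p == lsrc q & ltgt p == ltgt r].

(* The path algebra, an element being the family of coefficients of the paths *)
Definition KA (K : fieldType) (m : nat) : Type := {ffun lpath m -> K^o}.

HB.instance Definition _ (K : fieldType) m := Vector.on (KA K m).

Section PathAlgebra.
Variables (K : fieldType) (m : nat).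
Local Notation KAm := (KA K m.+1).

Definition KA_one : KAm := [ffun p => (lsrc p == ltgt p)%:R].

Definition KA_mul (x y : KAm) : KAm :=
  [ffun p => \sum_q \sum_(r | lconcat q r p) x q * y r].

Let mx (x : KAm) : 'M[K]_m.+1 :=
  \matrix_(i, j) (if insub (i, j) is Some p then x (p : lpath m.+1) else 0).

Let mx_path x p : mx x (lsrc p) (ltgt p) = x p.
Proof. by rewrite mxE -surjective_pairing valK. Qed.

Let mx_inj : injective mx.
Proof. by move=> x y exy; apply/ffunP=> p; rewrite -!mx_path exy. Qed.

Let mxD x y : mx (x + y) = mx x + mx y.
Proof.
by apply/matrixP=> i j; rewrite !mxE; case: insub => [p|]; rewrite ?ffunE ?addr0.
Qed.

Let mxZ k x : mx (k *: x) = k *: mx x.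
Proof.
by apply/matrixP=> i j; rewrite !mxE; case: insub => [p|]; rewrite ?ffunE ?mulr0.
Qed.

Let mx1 : mx KA_one = 1%:M.
Proof.
apply/matrixP=> i j; rewrite !mxE; case: insubP => [p _ Dp|/= lt_ji].
  by rewrite ffunE /lsrc /ltgt Dp.
by case: eqP lt_ji => // ->; rewrite leqnn.
Qed.

Let mx_eq0 x (i j : 'I_m.+1) : ~~ (i <= j)%N -> mx x i j = 0.
Proof. by move=> lt_ji; rewrite mxE insubN. Qed.

Let mxM x y : mx (KA_mul x y) = mx x *m mx y.
Proof.
apply/matrixP=> i j; have [le_ij | lt_ji] := boolP (i <= j)%N; last first.
  rewrite mx_eq0 // mxE big1 // => k _.
  have [le_ik | lt_ki] := boolP (i <= k)%N; last by rewrite mx_eq0 ?mul0r.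
  rewrite [mx y _ _]mx_eq0 ?mulr0 //; apply: contra lt_ji; exact: leq_trans.
pose p : lpath m.+1 := Sub (i, j) le_ij.
rewrite -[LHS]/(mx _ (lsrc p) (ltgt p)) mx_path ffunE mxE.
have sum_out (k : 'I_m.+1) : mx x i k * mx y k j =
    \sum_(q : lpath m.+1 | ltgt q == k)
      \sum_(r | lconcat q r p) x q * y r.
  have [le_ik | lt_ki] := boolP (i <= k)%N; last first.
    rewrite mx_eq0 // mul0r big1 // => q /eqP Dk; rewrite big_pred0 // => r.
    apply: contraNF lt_ki => /and3P[_ /eqP /= Di _].
    by rewrite -Dk -[i]/(lsrc p) Di; case: (q).
  pose q : lpath m.+1 := Sub (i, k) le_ik.
  rewrite (bigD1 q) //= [X in _ + X]big1 ?addr0; last first.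
    move=> q' /andP[/eqP Dk neq_q]; rewrite big_pred0 // => r.
    apply: contraNF neq_q => /and3P[_ /eqP Di _].
    apply/eqP/val_inj; rewrite /= [LHS]surjective_pairing.
    by rewrite -[(val q').1]/(lsrc q') -Di -[(val q').2]/(ltgt q') Dk.
  rewrite -(mx_path x q) -[lsrc q]/i -[ltgt q]/k.
  have [le_kj | lt_jk] := boolP (k <= j)%N; last first.
    rewrite [mx y _ _]mx_eq0 // mulr0 big_pred0 // => r.
    apply: contraNF lt_jk => /and3P[/eqP Dk _ /eqP Dj].
    by rewrite -[k]/(ltgt q) -[j]/(ltgt p) Dk Dj; case: (r).
  pose r : lpath m.+1 := Sub (k, j) le_kj.
  rewrite (bigD1 r) /=; last by rewrite /lconcat !eqxx.
  rewrite -(mx_path y r) big1 ?addr0 // => r' /andP[/and3P[/eqP Dk _ /eqP Dj]].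
  case/eqP; apply: val_inj; rewrite /= [LHS]surjective_pairing.
  by rewrite -[(val r').1]/(lsrc r') -Dk -[(val r').2]/(ltgt r') -Dj.
rewrite (eq_bigr _ (fun k _ => sum_out k)).
by rewrite (partition_big (@ltgt m.+1) xpredT).
Qed.

Fact KA_mulA : associative KA_mul.
Proof. by move=> x y z; apply: mx_inj; rewrite !mxM mulmxA. Qed.
Fact KA_mul1 : left_id KA_one KA_mul.
Proof. by move=> x; apply: mx_inj; rewrite !mxM mx1 mul1mx. Qed.
Fact KA_mulr1 : right_id KA_one KA_mul.
Proof. by move=> x; apply: mx_inj; rewrite !mxM mx1 mulmx1. Qed.
Fact KA_mulDl : left_distributive KA_mul +%R.
Proof. by move=> x y z; apply: mx_inj; rewrite !(mxM, mxD) mulmxDl. Qed.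
Fact KA_mulDr : right_distributive KA_mul +%R.
Proof. by move=> x y z; apply: mx_inj; rewrite !(mxM, mxD) mulmxDr. Qed.
Fact KA_one_neq0 : KA_one != 0.
Proof.
apply/eqP=> /(congr1 mx); rewrite mx1 => /matrixP/(_ ord0 ord0)/eqP.
by rewrite [X in _ == X]mxE; case: insub => [p|]; rewrite ?ffunE mxE oner_eq0.
Qed.
Fact KA_scaleAl k (x y : KAm) : k *: KA_mul x y = KA_mul (k *: x) y.
Proof. by apply: mx_inj; rewrite !(mxM, mxZ) scalemxAl. Qed.
Fact KA_scaleAr k (x y : KAm) : k *: KA_mul x y = KA_mul x (k *: y).
Proof. by apply: mx_inj; rewrite !(mxM, mxZ) scalemxAr. Qed.

HB.instance Definition _ := GRing.Zmodule_isNzRing.Build KAm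
  KA_mulA KA_mul1 KA_mulr1 KA_mulDl KA_mulDr KA_one_neq0.
HB.instance Definition _ := GRing.Lmodule_isLalgebra.Build K KAm KA_scaleAl.
HB.instance Definition _ := GRing.Lalgebra_isAlgebra.Build K KAm KA_scaleAr.
HB.instance Definition _ := Algebra_isFalgebra.Build K KAm.

Definition KA_vertex (i : 'I_m.+1) : KAm :=
  [ffun p => ((lsrc p == i) && (ltgt p == i))%:R].

(* pi presents L as K A_{m+1} / rad (K A_{m+1}) ^ h *)
Definition is_Lambda (h : nat) (L : falgType K) (pi : 'AHom(KAm, L)) : Prop :=
  limg pi = fullv /\
  exists2 J : {vspace KAm}, is_radical J & lker pi = (J ^+ h)%VS.

End PathAlgebra.

HB.instance Definition _ (K : fieldType) (A B : falgType K) :=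
  GRing.UnitAlgebra.on (A * B)%type.

Section Gluing.
Variables (K : fieldType) (A B : falgType K).

Definition is_character_at (e : A) (f : 'AHom(A, K^o)) : Prop :=
  f e = 1 /\ f (1 - e) = 0.

Variables (f : 'AHom(A, K^o)) (g : 'AHom(B, K^o)).

Definition glue_left : 'AHom((A * B)%type, K^o) := linfun_ahom (f \o fst).
Definition glue_right : 'AHom((A * B)%type, K^o) := linfun_ahom (g \o snd).

Definition glue_aspace : {aspace (A * B)%type} :=
  ker_sub_ahom_aspace glue_left glue_right.

Definition glue : falgType K := subvs_of glue_aspace.

Fact mem_glue a b : ((a, b) \in glue_aspace) = (f a == g b).
Proof.
by rewrite memv_ker !lfunE /= !lfunE /= !lfunE /= subr_eq0.
Qed.

End Gluing.

(* Main.v *)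
Require Import Defs.
From HB Require Import structures.
From mathcomp Require Import all_boot all_order all_algebra all_field zify ring.
From Stdlib Require Import Classical ClassicalEpsilon.

Set Implicit Arguments.
Unset Strict Implicit.
Unset Printing Implicit Defensive.

Import GRing.Theory.
Local Open Scope ring_scope.

(** Gluing attaches to [A] the linear quiver 1 -> 2 -> ... -> n+1 with radical
    square zero, its source 1 being identified with the sink of [A] that carries
    the simple projective [P]. An indecomposable module over the gluing is either
    an [A]-module or one of the new modules: the simples S_j and the modules P_j
    of length two, for the vertices and arrows of the linear quiver. Indeed, a
    vector moved by an arrow of the linear quiver generates a copy of P_j, and
    P_j is injective, hence splits off; if no such vector exists, the new vertices
    act as central idempotents ([classify]).

    The P_j are projective and injective over the gluing, and the sequences
    0 -> S_(j+1) -> P_j -> S_j -> 0 link the simple at the far end of the quiver to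
    S_1 = P. Moreover injective [A]-modules stay injective over the gluing
    ([restr_inj]), so that Ext between [A]-modules is unchanged ([vext_fobj]).
    Therefore every Ext group over the gluing is found by dimension shifting along
    these sequences: Ext^k(X, S_(j+1)) = Ext^(k-j)(X, P) for k > j, and the
    global dimension of the gluing and the injective dimension of S_(n+1) are both
    d + n ([chain_gldim], [chain_injdim]). The modules [X] with Ext^i(C, X) = 0 for
    0 < i < n, where C is the given [n]-cluster tilting subcategory of [A]-modules,
    form an [n]-cluster tilting subcategory: apart from C it contains exactly the
    P_j and S_(n+1), because the other new simples have a nonzero extension with
    S_1 or S_(n+1) in a forbidden degree ([chain_ct]). Finally there is no nonzero
    map from an [A]-module to a new indecomposable, and between new
    indecomposables nonzero noninvertible maps go from left to right in the order
    S_(n+1), P_n, S_n, ..., P_1; so no cycle arises ([chain_directed]).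

    These arguments use only short exact sequences, projectives, injectives and
    the decomposition into indecomposables. They are carried out in an additive
    category with a self-dual list of axioms ([chain_theorem]), so that the second
    part of the theorem follows from the same statement applied to the opposite
    of the module categories ([attach_out], [attach_in]). *)

(** * Additive categories and vanishing of Ext *)

(** The axioms are self-dual, which is what makes the second half of the main
    theorem the first half read in opposite categories. *)
Record precat := PreCat {
  obj :> Type;
  mor : obj -> obj -> zmodType;
  idm : forall X, mor X X;
  comp : forall X Y Z, mor Y Z -> mor X Y -> mor X Z;
  compA : forall X Y Z W (h : mor Z W) (g : mor Y Z) (f : mor X Y),
    comp h (comp g f) = comp (comp h g) f;
  comp1m : forall X Y (f : mor X Y), comp (idm Y) f = f;
  compm1 : forall X Y (f : mor X Y), comp f (idm X) = f;
  compDl : forall X Y Z (g h : mor Y Z) (f : mor X Y),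
    comp (g + h) f = comp g f + comp h f;
  compDr : forall X Y Z (h : mor Y Z) (f g : mor X Y),
    comp h (f + g) = comp h f + comp h g;
  biprod : obj -> obj -> obj;
  in1 : forall X Y, mor X (biprod X Y);
  in2 : forall X Y, mor Y (biprod X Y);
  pr1 : forall X Y, mor (biprod X Y) X;
  pr2 : forall X Y, mor (biprod X Y) Y;
  pr1in1 : forall X Y, comp (pr1 X Y) (in1 X Y) = idm X;
  pr2in2 : forall X Y, comp (pr2 X Y) (in2 X Y) = idm Y;
  pr1in2 : forall X Y, comp (pr1 X Y) (in2 X Y) = 0;
  pr2in1 : forall X Y, comp (pr2 X Y) (in1 X Y) = 0;
  biprod_split : forall X Y,
    comp (in1 X Y) (pr1 X Y) + comp (in2 X Y) (pr2 X Y) = idm (biprod X Y) }.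

Arguments idm {p}.
Arguments comp {p X Y Z}.
Notation "g ∘ f" := (comp g f) (at level 40, left associativity).

Definition op_precat (C : precat) : precat.
Proof.
refine (@PreCat (obj C) (fun X Y => mor Y X) (@idm C)
  (fun X Y Z g f => comp f g) _ _ _ _ _ (@biprod C)
  (@pr1 C) (@pr2 C) (@in1 C) (@in2 C) _ _ _ _ _).
- by move=> X Y Z W h g f; rewrite compA.
- by move=> X Y f; rewrite compm1.
- by move=> X Y f; rewrite comp1m.
- by move=> X Y Z g h f; rewrite compDr.
- by move=> X Y Z h f g; rewrite compDl.
- exact: pr1in1.
- exact: pr2in2.
- exact: pr2in1.
- exact: pr1in2.
- exact: biprod_split.
Defined.

Section Basic.
Variable C : precat.
Implicit Types X Y Z W : C.

Lemma comp0m X Y Z (f : mor X Y) : (0 : mor Y Z) ∘ f = 0.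
Proof. by apply: (addrI (0 ∘ f)); rewrite -compDl !addr0. Qed.

Lemma compm0 X Y Z (f : mor Y Z) : f ∘ (0 : mor X Y) = 0.
Proof. by apply: (addrI (f ∘ 0)); rewrite -compDr !addr0. Qed.

Lemma compNl X Y Z (g : mor Y Z) (f : mor X Y) : (- g) ∘ f = - (g ∘ f).
Proof. by apply: (addrI (g ∘ f)); rewrite -compDl !subrr comp0m. Qed.

Lemma compNr X Y Z (g : mor Y Z) (f : mor X Y) : g ∘ (- f) = - (g ∘ f).
Proof. by apply: (addrI (g ∘ f)); rewrite -compDr !subrr compm0. Qed.

(** Kernels and cokernels enter only through [ses] below, so that every notion
    has its dual obtained by reversing arrows. *)
Definition mono X Y (f : mor X Y) := forall W (h : mor W X), f ∘ h = 0 -> h = 0.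
Definition epi X Y (f : mor X Y) := forall W (h : mor Y W), h ∘ f = 0 -> h = 0.

Definition isom X Y (f : mor X Y) :=
  exists g : mor Y X, g ∘ f = idm X /\ f ∘ g = idm Y.
Definition iso X Y := exists f : mor X Y, isom f.

Definition proj P := forall X Y (p : mor X Y) (h : mor P Y),
  epi p -> exists k, p ∘ k = h.
Definition inj I := forall X Y (i : mor Y X) (h : mor Y I),
  mono i -> exists k, k ∘ i = h.

Definition ses X Y Z (i : mor X Y) (p : mor Y Z) :=
  [/\ mono i /\ epi p, p ∘ i = 0,
      forall W (h : mor W Y), p ∘ h = 0 -> exists k, i ∘ k = h &
      forall W (h : mor Y W), h ∘ i = 0 -> exists k, k ∘ p = h].

Lemma epi_can X Y Z (p : mor X Y) (g h : mor Y Z) : epi p -> g ∘ p = h ∘ p -> g = h.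
Proof.
move=> pE e; apply/subr0_eq/pE.
by rewrite compDl compNl e subrr.
Qed.

Lemma mono_can X Y Z (i : mor Y Z) (g h : mor X Y) : mono i -> i ∘ g = i ∘ h -> g = h.
Proof.
move=> iM e; apply/subr0_eq/iM.
by rewrite compDr compNr e subrr.
Qed.

(** Splitting lemma. *)
Lemma ses_section X Y Z (i : mor X Y) (p : mor Y Z) (r : mor Y X) :
  ses i p -> r ∘ i = idm X -> exists s, p ∘ s = idm Z.
Proof.
move=> [[iM pE] pi0 _ cokp] ri.
have [s sp] : exists s, s ∘ p = idm Y - i ∘ r.
  by apply: cokp; rewrite compDl compNl comp1m -compA ri compm1 subrr.
exists s; apply: (epi_can pE).
by rewrite -compA sp compDr compNr compm1 compA pi0 comp0m subr0 comp1m.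
Qed.

(** In a category with split idempotents these are the objects without proper
    direct summands. *)
Definition indec X := idm X <> 0 /\
  forall g : mor X X, g ∘ g = g -> g = 0 \/ g = idm X.

(** [vext k X Y] is the vanishing of Ext^(k+1)(X, Y), by dimension shifting
    along projective presentations. *)
Fixpoint vext (k : nat) X Y : Prop :=
  forall K P (i : mor K P) (p : mor P X), ses i p -> proj P ->
  if k is k'.+1 then vext k' K Y
  else forall h : mor K Y, exists h' : mor P Y, h' ∘ i = h.

Definition directed := ~ exists (t : nat) (M : nat -> C),
  [/\ (0 < t)%N, forall i, (i <= t)%N -> indec (M i),
      forall i, (i < t)%N ->
        exists f : mor (M i) (M i.+1), f <> 0 /\ ~ isom f &
      iso (M 0%N) (M t)].

(** The [n]-cluster tilting subcategories; [k.+1] runs over the degrees strictly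
    between 0 and [n]. *)
Definition ct (n : nat) (c : C -> Prop) := 
  [/\ forall X Y, iso X Y -> c X -> c Y,
      forall X Y, c (biprod X Y) <-> c X /\ c Y,
      forall X, c X <-> forall Y, c Y -> forall k, (k.+1 < n)%N -> vext k Y X &
      forall X, c X <-> forall Y, c Y -> forall k, (k.+1 < n)%N -> vext k X Y].

Lemma iso_sym X Y : iso X Y -> iso Y X.
Proof. by case=> f [g [gf fg]]; exists g, f. Qed.

Lemma iso_trans X Y Z : iso X Y -> iso Y Z -> iso X Z.
Proof.
move=> [f [f' [f'f ff']]] [g [g' [g'g gg']]]; exists (g ∘ f), (f' ∘ g'); split.
  by rewrite compA -(compA f') g'g compm1.
by rewrite compA -(compA g) ff' compm1.
Qed.

Lemma proj_retract X P (s : mor X P) (r : mor P X) :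
  r ∘ s = idm X -> proj P -> proj X.
Proof.
move=> rs Pp U V p h pE; have [k pk] := Pp _ _ p (h ∘ r) pE.
by exists (k ∘ s); rewrite compA pk -compA rs compm1.
Qed.

(** A presentation of [X] by a projective and a copresentation of [Y] by an
    injective compute Ext^1(X, Y) alike: the obstruction to extending a map
    from the syzygy is the obstruction to lifting a map to the cosyzygy. *)
Lemma ext1_balanced X Y K P (i : mor K P) (p : mor P X) I D
    (j : mor Y I) (q : mor I D) :
  ses i p -> proj P -> ses j q -> inj I ->
  (forall h : mor K Y, exists h', h' ∘ i = h) <->
  (forall h : mor X D, exists h', q ∘ h' = h).
Proof.
move=> [[iM pE] pi0 kerp cokp] Pp [[jM qE] qj0 kerq cokq] Ii; split=> H h.
  have [u qu] := Pp _ _ q (h ∘ p) qE.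
  have [v jv] : exists v, j ∘ v = u ∘ i.
    by apply: kerq; rewrite compA qu -compA pi0 compm0.
  have [w wi] := H v.
  have [h' h'p] : exists h', h' ∘ p = u - j ∘ w.
    by apply: cokp; rewrite compDl compNl -compA wi jv subrr.
  exists h'; apply: (epi_can pE); rewrite -compA h'p compDr compNr qu.
  by rewrite (compA q) qj0 comp0m subr0.
have [u ui] := Ii _ _ i (j ∘ h) iM.
have [v vp] : exists v, v ∘ p = q ∘ u.
  by apply: cokp; rewrite -compA ui compA qj0 comp0m.
have [w qw] := H v.
have [h' jh'] : exists h', j ∘ h' = u - w ∘ p.
  by apply: kerq; rewrite compDr compNr compA qw vp subrr.
exists h'; apply: (mono_can jM); rewrite compA jh' compDl compNl ui.
by rewrite -(compA w) pi0 compm0 subr0.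
Qed.

(** Both conditions express Ext^2(X, Y) = 0: on the left Ext^1(K, Y) = 0 through
    the copresentation of [Y], on the right Ext^1(X, D) = 0 through the
    presentation of [X]. *)
Lemma ext2_balanced X Y K P (i : mor K P) (p : mor P X) I D
    (j : mor Y I) (q : mor I D) :
  ses i p -> proj P -> ses j q -> inj I ->
  (forall h : mor K D, exists h', q ∘ h' = h) <->
  (forall h : mor K D, exists h', h' ∘ i = h).
Proof.
move=> [[iM pE] pi0 kerp cokp] Pp [[jM qE] qj0 kerq cokq] Ii; split=> H h.
  have [u qu] := H h; have [v vi] := Ii _ _ i u iM.
  by exists (q ∘ v); rewrite -compA vi.
have [u ui] := H h; have [v qv] := Pp _ _ q u qE.
by exists (v ∘ i); rewrite compA qv.
Qed.

End Basic.

(** The last field is the part of the Krull-Schmidt theorem that gets used: a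
    property stable under direct sums can be checked on indecomposables. *)
Record cat := Cat {
  cpre :> precat;
  enough_proj : forall X : cpre, exists K P (i : mor K P) (p : mor P X),
    ses i p /\ proj P;
  enough_inj : forall Y : cpre, exists I D (j : mor Y I) (q : mor I D),
    ses j q /\ inj I;
  indec_ind : forall Q : cpre -> Prop,
    (forall X Y, iso X Y -> Q X -> Q Y) -> (forall X, idm X = 0 -> Q X) ->
    (forall X, indec X -> Q X) ->
    (forall X Y, Q X -> Q Y -> Q (biprod X Y)) -> forall X, Q X }.

Lemma ses_op (C : precat) (X Y Z : C) (i : mor X Y) (p : mor Y Z) :
  ses i p -> @ses (op_precat C) Z Y X p i.
Proof. by case=> [[iM pE] pi0 kerp cokp]; split. Qed.

Lemma op_ses (C : precat) (X Y Z : C) (i : mor X Y) (p : mor Y Z) :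
  @ses (op_precat C) Z Y X p i -> ses i p.
Proof. by case=> [[iM pE] pi0 kerp cokp]; split. Qed.

Lemma isom_op (C : precat) (X Y : C) (f : mor X Y) :
  isom f <-> @isom (op_precat C) Y X f.
Proof. by split=> -[g [gf fg]]; exists g; split. Qed.

Lemma iso_op (C : precat) (X Y : C) : iso X Y <-> @iso (op_precat C) X Y.
Proof.
by split=> /iso_sym [f [g [gf fg]]]; exists f; exists g; split.
Qed.

Definition op_cat (C : cat) : cat.
Proof.
refine (@Cat (op_precat C) _ _ _).
- move=> X; have [I [D [j [q [jq Ii]]]]] := enough_inj X.
  by exists D, I, q, j; split; [exact: ses_op | exact: Ii].
- move=> X; have [K [P [i [p [ip Pp]]]]] := enough_proj X.
  by exists P, K, p, i; split; [exact: ses_op | exact: Pp].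
- move=> Q Qi Q0 QX QD X; apply: (@indec_ind C Q) => //.
  by move=> U V /iso_op; apply: Qi.
Defined.

Section Ext.
Variable C : cat.
Implicit Types X Y Z W : C.

(** Independence of the presentation: compare any two of them with one
    copresentation of [Y]. *)
Lemma vext0_proj X Y K P (i : mor K P) (p : mor P X) :
  ses i p -> proj P ->
  vext 0 X Y <-> forall h : mor K Y, exists h', h' ∘ i = h.
Proof.
move=> ip Pp; split=> [H|H K' P' i' p' ip' Pp']; first exact: H ip Pp.
have [I [D [j [q [jq Ii]]]]] := enough_inj Y.
by apply/(ext1_balanced ip' Pp' jq Ii)/(ext1_balanced ip Pp jq Ii).
Qed.

Lemma vext0_inj X Y I D (j : mor Y I) (q : mor I D) :
  ses j q -> inj I ->
  vext 0 X Y <-> forall h : mor X D, exists h', q ∘ h' = h.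
Proof.
move=> jq Ii; have [K [P [i [p [ip Pp]]]]] := enough_proj X.
split=> [/(vext0_proj Y ip Pp)|] H; first exact/(ext1_balanced ip Pp jq Ii).
by apply/(vext0_proj Y ip Pp)/(ext1_balanced ip Pp jq Ii).
Qed.

(** The two shifts have to be proved together: independence of the projective
    presentation in degree [k.+1] is obtained by moving to the cosyzygy. *)
Let shift k := (forall X Y K P (i : mor K P) (p : mor P X), ses i p -> proj P ->
    vext k.+1 X Y <-> vext k K Y) /\
  (forall X Y I D (j : mor Y I) (q : mor I D), ses j q -> inj I ->
    vext k.+1 X Y <-> vext k X D).

Let shiftP k : shift k.
Proof.
elim: k => [|k [IHp IHi]].
  have H X Y K P (i : mor K P) (p : mor P X) I D (j : mor Y I) (q : mor I D) :
      ses i p -> proj P -> ses j q -> inj I -> vext 0 K Y <-> vext 0 X D.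
    move=> ip Pp jq Ii; split=> [/(vext0_inj _ jq Ii)|/(vext0_proj _ ip Pp)] H.
      by apply/(vext0_proj _ ip Pp)/(ext2_balanced ip Pp jq Ii).
    by apply/(vext0_inj _ jq Ii)/(ext2_balanced ip Pp jq Ii).
  split=> [X Y K P i p ip Pp | X Y I D j q jq Ii].
    split=> [H0|H0 K' P' i' p' ip' Pp']; first exact: H0 ip Pp.
    have [I [D [j [q [jq Ii]]]]] := enough_inj Y.
    exact/(H _ _ _ _ _ _ _ _ _ _ ip' Pp' jq Ii)/(H _ _ _ _ _ _ _ _ _ _ ip Pp jq Ii).
  have [K [P [i [p [ip Pp]]]]] := enough_proj X.
  split=> [H0|H0 K' P' i' p' ip' Pp'].
    exact/(H _ _ _ _ _ _ _ _ _ _ ip Pp jq Ii)/(H0 _ _ _ _ ip Pp).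
  exact/(H _ _ _ _ _ _ _ _ _ _ ip' Pp' jq Ii).
have H X Y K P (i : mor K P) (p : mor P X) I D (j : mor Y I) (q : mor I D) :
    ses i p -> proj P -> ses j q -> inj I -> vext k.+1 K Y <-> vext k.+1 X D.
  move=> ip Pp jq Ii.
  split=> [/(IHi _ _ _ _ _ _ jq Ii)|] H; first exact/(IHp _ _ _ _ _ _ ip Pp).
  by apply/(IHi _ _ _ _ _ _ jq Ii); apply: H ip Pp.
split=> [X Y K P i p ip Pp | X Y I D j q jq Ii].
  split=> [H0|H0 K' P' i' p' ip' Pp']; first exact: H0 ip Pp.
  have [I [D [j [q [jq Ii]]]]] := enough_inj Y.
  exact/(H _ _ _ _ _ _ _ _ _ _ ip' Pp' jq Ii)/(H _ _ _ _ _ _ _ _ _ _ ip Pp jq Ii).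
have [K [P [i [p [ip Pp]]]]] := enough_proj X.
split=> [H0|H0 K' P' i' p' ip' Pp'].
  exact/(H _ _ _ _ _ _ _ _ _ _ ip Pp jq Ii)/(H0 _ _ _ _ ip Pp).
exact/(H _ _ _ _ _ _ _ _ _ _ ip' Pp' jq Ii).
Qed.

Lemma vextS_proj k X Y K P (i : mor K P) (p : mor P X) :
  ses i p -> proj P -> vext k.+1 X Y <-> vext k K Y.
Proof. by case: (shiftP k) => H _; apply: H. Qed.

Lemma vextS_inj k X Y I D (j : mor Y I) (q : mor I D) :
  ses j q -> inj I -> vext k.+1 X Y <-> vext k X D.
Proof. by case: (shiftP k) => _ H; apply: H. Qed.

(** Balancing: Ext may be computed with injectives. *)
Lemma vext_op k X Y : vext k X Y <-> @vext (op_cat C) k Y X.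
Proof.
elim: k X Y => [|k IH] X Y.
  split=> [H D I q j /op_ses jq Ii|H]; first exact/(vext0_inj _ jq Ii).
  have [I [D [j [q [jq Ii]]]]] := enough_inj Y.
  by apply/(vext0_inj _ jq Ii); exact: (H _ _ q j (ses_op jq) Ii).
split=> [H D I q j /op_ses jq Ii|H].
  exact/IH/(vextS_inj _ _ jq Ii).
have [I [D [j [q [jq Ii]]]]] := enough_inj Y.
by apply/(vextS_inj _ _ jq Ii)/IH; exact: (H _ _ q j (ses_op jq) Ii).
Qed.

Lemma vext_retract k X X' Y (s : mor X' X) (r : mor X X') :
  r ∘ s = idm X' -> vext k X Y -> vext k X' Y.
Proof.
move=> rs; elim: k Y => [|k IH] Y; have [I [D [j [q [jq Ii]]]]] := enough_inj Y.
  move=> /(vext0_inj _ jq Ii) H; apply/(vext0_inj _ jq Ii) => h.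
  have [u qu] := H (h ∘ r); exists (u ∘ s).
  by rewrite compA qu -compA rs compm1.
by move=> /(vextS_inj _ _ jq Ii) /IH H; apply/(vextS_inj _ _ jq Ii).
Qed.

Lemma vext_biprodl k X X' Y : vext k (biprod X X') Y <-> vext k X Y /\ vext k X' Y.
Proof.
split=> [H|]; first by
  split; [apply: vext_retract (pr1in1 _ _) H | apply: vext_retract (pr2in2 _ _) H].
elim: k Y => [|k IH] Y; have [I [D [j [q [jq Ii]]]]] := enough_inj Y.
  move=> [/(vext0_inj _ jq Ii) H1 /(vext0_inj _ jq Ii) H2].
  apply/(vext0_inj _ jq Ii) => h.
  have [u1 qu1] := H1 (h ∘ in1 _ _); have [u2 qu2] := H2 (h ∘ in2 _ _).
  exists (u1 ∘ pr1 _ _ + u2 ∘ pr2 _ _); rewrite compDr !compA qu1 qu2.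
  by rewrite -!compA -compDr biprod_split compm1.
by move=> [/(vextS_inj _ _ jq Ii) H1 /(vextS_inj _ _ jq Ii) H2];
  apply/(vextS_inj _ _ jq Ii)/IH.
Qed.

Lemma vext_isol k X X' Y : iso X X' -> vext k X Y -> vext k X' Y.
Proof. by case=> f [g [gf fg]]; apply: vext_retract fg. Qed.

Lemma vext_zerol k X Y : idm X = 0 -> vext k X Y.
Proof.
move=> X0; elim: k Y => [|k IH] Y; have [I [D [j [q [jq Ii]]]]] := enough_inj Y.
  apply/(vext0_inj _ jq Ii) => h; exists 0.
  by rewrite compm0 -[h]compm1 X0 compm0.
exact/(vextS_inj _ _ jq Ii).
Qed.

Lemma vext_projl k X Y : proj X -> vext k X Y.
Proof.
move=> Xp; elim: k Y => [|k IH] Y; have [I [D [j [q [jq Ii]]]]] := enough_inj Y.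
  by apply/(vext0_inj _ jq Ii) => h; case: jq => [[_ qE] _ _ _]; apply: Xp.
exact/(vextS_inj _ _ jq Ii).
Qed.

(** Ext^1 against the syzygy splits a projective presentation. *)
Lemma vext0_projP X : (forall Y, vext 0 X Y) -> proj X.
Proof.
move=> H; have [K [P [i [p [ip Pp]]]]] := enough_proj X.
have [r ri] := iffLR (vext0_proj K ip Pp) (H K) (idm K).
have [s ps] := ses_section ip ri; exact: proj_retract ps Pp.
Qed.

End Ext.

Section ExtDual.
Variable C : cat.
Implicit Types X Y Z W : C.

Lemma vext_biprodr k X Y Y' : vext k X (biprod Y Y') <-> vext k X Y /\ vext k X Y'.
Proof.
split=> [/vext_op H|[/vext_op H1 /vext_op H2]].
  by have [H1 H2] := iffLR (@vext_biprodl (op_cat C) k Y Y' X) H; split; apply/vext_op.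
by apply/vext_op/(@vext_biprodl (op_cat C)).
Qed.

Lemma vext_isor k X Y Y' : iso Y Y' -> vext k X Y -> vext k X Y'.
Proof. by move=> /iso_op YY' /vext_op H; apply/vext_op/(@vext_isol (op_cat C) k Y). Qed.

Lemma vext_zeror k X Y : idm Y = 0 -> vext k X Y.
Proof. by move=> Y0; apply/vext_op/(@vext_zerol (op_cat C)). Qed.

Lemma vext_injr k X Y : inj Y -> vext k X Y.
Proof. by move=> Yi; apply/vext_op/(@vext_projl (op_cat C)). Qed.

Lemma vext0_injP Y : (forall X, vext 0 X Y) -> inj Y.
Proof. by move=> H; apply: (@vext0_projP (op_cat C) Y) => X; exact/(@vext_op C). Qed.

Lemma vext_all_indec k : (forall X Y : C, indec X -> indec Y -> vext k X Y) ->
  forall X Y : C, vext k X Y.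
Proof.
move=> H X Y; elim/(@indec_ind C): X => [X X' XX'|X X0|X iX|X X' H1 H2].
- exact: vext_isol.
- exact: vext_zerol.
- elim/(@indec_ind C): Y => [Y Y' YY'|Y Y0|Y iY|Y Y' H1 H2].
  + exact: vext_isor.
  + exact: vext_zeror.
  + exact: H.
  + exact/vext_biprodr.
- exact/vext_biprodl.
Qed.

Lemma directed_op : directed C -> directed (op_cat C).
Proof.
move=> dC [t [M [t0 iM fM /iso_op M0t]]]; apply: dC.
exists t, (fun i => M (t - i)%N); split=> //.
- move=> i it; have [|nz idp] := iM (t - i)%N; first by rewrite leq_subr.
  by split.
- move=> i it; have [|f [f0 fi]] := fM (t - i.+1)%N; first by lia.
  move: f f0 fi; rewrite -subSn // subSS => f f0 fi.
  by exists f; split=> // /isom_op.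
- by rewrite subn0 subnn; apply: iso_sym.
Qed.

Lemma ct_op n (c : C -> Prop) : @ct C n c -> @ct (op_cat C) n c.
Proof.
case=> ci cb cl cr; split=> [X Y /(@iso_op C)|//|X|X]; first exact: ci.
  split=> [/cr H Y cY k kn|H]; first exact/vext_op/H.
  by apply/cr => Y cY k kn; apply/vext_op/H.
split=> [/cl H Y cY k kn|H]; first exact/vext_op/H.
by apply/cl => Y cY k kn; apply/vext_op/H.
Qed.

End ExtDual.

(** * Attaching a linear quiver at a shared vertex *)

(** Fully faithful exact functors; faithfulness is recorded twice because no
    additivity of [fmap] is assumed. *)
Record ffunctor (D C : precat) := FFunctor {
  fobj :> D -> C;
  fmap : forall X Y, mor X Y -> mor (fobj X) (fobj Y);
  fmap1 : forall X, fmap (idm X) = idm (fobj X);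
  fmapM : forall X Y Z (g : mor Y Z) (f : mor X Y),
    fmap (g ∘ f) = fmap g ∘ fmap f;
  fmap_eq0 : forall X Y (f : mor X Y), fmap f = 0 <-> f = 0;
  fmap_inj : forall X Y (f g : mor X Y), fmap f = fmap g -> f = g;
  fmap_full : forall X Y (h : mor (fobj X) (fobj Y)), exists f, fmap f = h;
  fmap_ses : forall X Y Z (i : mor X Y) (p : mor Y Z),
    ses i p -> ses (fmap i) (fmap p) }.

Definition op_ffunctor (D C : precat) (F : ffunctor D C) : ffunctor (op_precat D) (op_precat C).
Proof.
refine (@FFunctor (op_precat D) (op_precat C) F (fun X Y f => fmap F f) _ _ _ _ _ _).
- exact: (@fmap1 D C F).
- by move=> X Y Z g f; apply: (@fmapM D C F).
- by move=> X Y f; apply: (@fmap_eq0 D C F).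
- by move=> X Y; apply: (@fmap_inj D C F).
- by move=> X Y; apply: (@fmap_full D C F).
- by move=> X Y Z i p /op_ses /(fmap_ses F) /ses_op.
Defined.

Section Functor.
Variables (D C : cat) (F : ffunctor D C).

Lemma fmap_isom X Y (f : mor X Y) : isom f -> isom (fmap F f).
Proof. by case=> g [gf fg]; exists (fmap F g); rewrite -!fmapM gf fg !fmap1. Qed.

Lemma fobj_indec X : indec (F X) -> indec X.
Proof.
case=> nz idp; split=> [X0|g gg].
  by apply: nz; rewrite -fmap1; apply/fmap_eq0.
have [|/fmap_eq0|] := idp (fmap F g); first by rewrite -fmapM gg.
  by left.
by rewrite -fmap1 => /fmap_inj; right.
Qed.

(** A full embedding that preserves injective copresentations does not change
    the vanishing of Ext. *)
Lemma vext_fobj k X Y : (forall I : D, inj I -> inj (F I)) ->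
  vext k (F X) (F Y) <-> vext k X Y.
Proof.
move=> FI; elim: k Y => [|k IH] Y; have [I [E [j [q [jq Ii]]]]] := enough_inj Y.
  rewrite (vext0_inj _ jq Ii) (vext0_inj _ (fmap_ses F jq) (FI _ Ii)).
  split=> H h.
    have [h' e] := H (fmap F h); have [g gh'] := fmap_full h'; exists g.
    by apply: (@fmap_inj _ _ F); rewrite fmapM gh'.
  have [g <-] := fmap_full h; have [h' <-] := H g.
  by exists (fmap F h'); rewrite fmapM.
by rewrite (vextS_inj _ _ jq Ii) (vextS_inj _ _ (fmap_ses F jq) (FI _ Ii)).
Qed.

End Functor.

Lemma finite_choice (T : Type) (t : nat) (R : nat -> T -> Prop) :
  (forall i, (i <= t)%N -> exists x, R i x) ->
  exists f, forall i, (i <= t)%N -> R i (f i).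
Proof.
elim: t => [|t IH] H.
  by have [x Rx] := H 0%N isT; exists (fun=> x) => i; rewrite leqn0 => /eqP->.
have [|f Rf] := IH; first by move=> i it; apply: H; apply: leqW.
have [x Rx] := H t.+1 (leqnn _).
exists (fun i => if (i <= t)%N then f i else x) => i it.
case: (leqP i t) => [/Rf //|ti].
by have -> : i = t.+1 by apply/eqP; rewrite eqn_leq it.
Qed.

(** [C] is obtained from [D] by attaching the radical-square-zero linear quiver.
    In the category of modules over the gluing, [S 0] is the simple module at
    the shared vertex, [S 1], ..., [S n] are the new simples and the [Q j] are the
    new projective-injectives, with short exact sequences
    0 -> S (j+1) -> Q j -> S j -> 0; they compute every Ext group that involves
    the new simples. *)
Section Chain.
Variables (D C : cat) (F : ffunctor D C).
Hypothesis F_inj : forall I : D, inj I -> inj (F I).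

Variables (n : nat) (S Q : nat -> C).
Variables (u : forall j, mor (S j.+1) (Q j)) (v : forall j, mor (Q j) (S j)).
Hypothesis uv_ses : forall j, (j < n)%N -> ses (u j) (v j).
Hypothesis Q_proj : forall j, (j < n)%N -> proj (Q j).
Hypothesis Q_inj : forall j, (j < n)%N -> inj (Q j).
Hypothesis uv_nonsplit : forall j, (j < n)%N -> forall s, v j ∘ s <> idm (S j).
Hypothesis Sn_proj : proj (S n).
Hypothesis homSS : forall i j, (i <= n)%N -> (j <= n)%N -> i != j ->
  forall h : mor (S i) (S j), h = 0.
Hypothesis homSS_isom : forall j, (j <= n)%N ->
  forall h : mor (S j) (S j), h != 0 -> isom h.
Hypothesis homFS : forall X j, (0 < j <= n)%N -> forall h : mor (F X) (S j), h = 0.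

Variable T : D.
Hypothesis T_iso : iso (S 0) (F T).
Hypothesis T_proj : proj T.
Hypothesis T_simple : forall X (h : mor X T), h != 0 -> epi h.

Hypothesis indecP : forall X : C, indec X ->
  [\/ exists X', iso (F X') X,
      exists2 j, (0 < j <= n)%N & iso (S j) X |
      exists2 j, (j < n)%N & iso (Q j) X].

Let Fext k X Y := @vext_fobj D C F k X Y F_inj.

(** The objects [Q] being injective, [S i] is the [j]-th cosyzygy of [S (j + i)]. *)
Lemma vext_shift_codim k i j X : (j + i <= n)%N ->
  vext (j + k) X (S (j + i)) <-> vext k X (S i).
Proof.
elim: j => // j IH jn.
by rewrite !addSn (vextS_inj _ _ (uv_ses jn) (Q_inj jn)); apply/IH/ltnW.
Qed.

(** The objects [Q] being projective, [S (j + i)] is the [j]-th syzygy of [S i]. *)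
Lemma vext_shift_dim k i j Y : (j + i <= n)%N ->
  vext (j + k) (S i) Y <-> vext k (S (j + i)) Y.
Proof.
elim: j i => // j IH i jn; have i_n : (i < n)%N by lia.
rewrite addSn [(j.+1 + i)%N]addSnnS -IH; last by lia.
exact: (vextS_proj _ _ (uv_ses i_n) (Q_proj i_n)).
Qed.

(** The sequence 0 -> S (j+1) -> Q j -> S j -> 0 does not split. *)
Lemma vext_consecutive j : (j < n)%N -> ~ vext 0 (S j) (S j.+1).
Proof.
move=> jn /(vext0_inj _ (uv_ses jn) (Q_inj jn)) /(_ (idm _)) [s].
exact: uv_nonsplit.
Qed.

Lemma vext_S0 j : (j < n)%N -> ~ vext j (S 0) (S j.+1).
Proof.
move=> jn; have := @vext_shift_codim 0 1 j (S 0); rewrite addn0 addn1 => e.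
by move/(e jn); apply: vext_consecutive; apply: leq_ltn_trans jn.
Qed.

Lemma vext_Sn j : (j < n)%N -> ~ vext (n - j.+1) (S j) (S n).
Proof.
move=> jn; have n0 : (n.-1 < n)%N by lia.
have := @vext_shift_dim 0 j (n - j.+1) (S n); rewrite addn0.
have -> : (n - j.+1 + j = n.-1)%N by lia.
move=> e /(e (ltnW n0)); have := vext_consecutive n0.
by rewrite prednK //; lia.
Qed.

(** Shifting the codimension reduces to Ext^1(F X, S i) with [i >= 2], which
    vanishes since already Hom(F X, S (i-1)) does. *)
Lemma vext_FS k j X : (k.+1 < j <= n)%N -> vext k (F X) (S j).
Proof.
move=> /andP[kj jn].
have [i ej] : exists i, j = (k + i.+2)%N by exists (j - k.+2)%N; lia.
subst j; have i_n : (i.+1 < n)%N by lia.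
have := @vext_shift_codim 0 i.+2 k (F X); rewrite addn0 => -> //.
apply/(vext0_inj _ (uv_ses i_n) (Q_inj i_n)) => h; exists 0.
by rewrite compm0; symmetry; apply: homFS; lia.
Qed.

Lemma split_of_retraction j : (j < n)%N -> forall r, r ∘ u j <> idm (S j.+1).
Proof.
by move=> jn r /(ses_section (uv_ses jn)) [s]; apply: uv_nonsplit.
Qed.

(** A nonzero map from [F X] to [Q j] cannot have its image in the socle
    [S (j+1)], so it reaches the top [S j]. Then [j = 0], and [S 0] would split
    off [Q 0], as it comes from a simple projective of [D]. *)
Lemma homFQ X j : (j < n)%N -> forall h : mor (F X) (Q j), h = 0.
Proof.
move=> jn h; have [[_ _] _ keru _] := uv_ses jn.
suff vh : v j ∘ h = 0.
  by have [k <-] := keru _ _ vh; rewrite (@homFS X j.+1 _ k) ?compm0.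
case: j jn h {keru} => [|j] jn h; last by apply: homFS; rewrite (ltnW jn).
have [w [w' [w'w ww']]] := T_iso.
have [g Fg] := fmap_full (w ∘ (v 0 ∘ h)).
have [g0|gn0] := eqVneq g 0.
  have e : w ∘ (v 0 ∘ h) = 0 by rewrite -Fg g0; apply/fmap_eq0.
  by rewrite -[LHS]comp1m -w'w -compA e compm0.
have [s gs] := T_proj (idm T) (T_simple gn0).
case: (uv_nonsplit jn (s := h ∘ (fmap F s ∘ w))).
have : fmap F g ∘ fmap F s = idm _ by rewrite -fmapM gs fmap1.
rewrite Fg => e.
have -> : v 0 ∘ (h ∘ (fmap F s ∘ w)) = w' ∘ (w ∘ (v 0 ∘ h) ∘ fmap F s) ∘ w.
  by rewrite !compA w'w comp1m.
by rewrite e compm1.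
Qed.

Lemma homSQ i j : (i <= n)%N -> (j < n)%N ->
  forall h : mor (S i) (Q j), h != 0 -> i = j.+1.
Proof.
move=> i_n jn h h0; have [_ _ keru _] := uv_ses jn.
have [k uk] : exists k, u j ∘ k = h.
  apply: keru; have [eij|nij] := eqVneq i j; last exact: (homSS _ (ltnW jn)).
  subst i; have [//|vh] := eqVneq (v j ∘ h) 0.
  have [g [_ vhg]] := homSS_isom (ltnW jn) vh.
  by case: (uv_nonsplit jn (s := h ∘ g)); rewrite compA.
apply/eqP; apply: contraNT h0 => nij.
by rewrite -uk (homSS _ _ nij k) ?compm0.
Qed.

Lemma homQS i j : (i < n)%N -> (j <= n)%N ->
  forall h : mor (Q i) (S j), h != 0 -> i = j.
Proof.
move=> i_n jn h h0; have [_ _ _ cokv] := uv_ses i_n.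
have [k kv] : exists k, k ∘ v i = h.
  apply: cokv; have [eij|nij] := eqVneq i.+1 j; last exact: (homSS _ jn).
  subst j; have [//|hu] := eqVneq (h ∘ u i) 0.
  have [g [ghu _]] := homSS_isom jn hu.
  by case: (split_of_retraction i_n (r := g ∘ h)); rewrite -compA.
apply/eqP; apply: contraNT h0 => nij.
by rewrite -kv (homSS (ltnW i_n) jn nij k) comp0m.
Qed.

(** An endomorphism of [Q j] that is nonzero on the top induces an automorphism
    [c] of the top; lifting the inverse of [c] yields the inverse, because
    there is no nonzero map from [Q j] to its socle. *)
Lemma homQQ i j : (i < n)%N -> (j < n)%N ->
  forall h : mor (Q i) (Q j), h != 0 -> i = j.+1 \/ (i = j /\ isom h).
Proof.
move=> i_n jn h h0; have [_ _ keru _] := uv_ses jn.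
have [vh|vh] := eqVneq (v j ∘ h) 0.
  left; have [k uk] := keru _ _ vh; apply: homQS (k) _ => //.
  by apply: contraNneq h0 => k0; rewrite -uk k0 compm0.
right; have eij : i = j by apply: homQS vh => //; apply: ltnW.
split=> //; subst i; have [[_ vE] vu0 _ cokv] := uv_ses jn.
have hom_QS (k : mor (Q j) (S j.+1)) : k = 0.
  by apply/eqP; apply/idPn => /(homQS jn jn); lia.
have vhu : v j ∘ h ∘ u j = 0.
  by apply: homSS => //; [apply: ltnW | rewrite eq_sym neq_ltn ltnSn].
have [c cv] : exists c, c ∘ v j = v j ∘ h by apply: cokv.
have [|d [dc cd]] := homSS_isom (ltnW jn) (h := c).
  by apply: contraNneq vh => c0; rewrite -cv c0 comp0m.
have [w vw] := Q_proj jn (d ∘ v j) vE.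
have unit g : v j ∘ g = v j -> g = idm _.
  move=> vg; have [|k uk] := keru _ (g - idm _).
    by rewrite compDr compNr vg compm1 subrr.
  by have k0 := hom_QS k; apply/subr0_eq; rewrite -uk k0 compm0.
exists w; split; apply: unit; rewrite compA.
  by rewrite vw -compA -cv compA dc comp1m.
by rewrite -cv -compA vw compA cd comp1m.
Qed.

(** Every nonzero map between the indecomposables outside the image of [F] is
    invertible or lowers this rank. *)
Variant rank (X : C) : nat -> Prop :=
| RankS j of (0 < j <= n)%N & iso (S j) X : rank X j.*2
| RankQ j of (j < n)%N & iso (Q j) X : rank X j.*2.+1.

Lemma conj_neq0 (X X' Y Y' : C) (a : mor X' X) (b : mor Y Y') (f : mor X Y) :
  isom a -> isom b -> f != 0 -> b ∘ f ∘ a != 0.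
Proof.
move=> [a' [_ aa']] [b' [b'b _]]; apply: contraNneq => e.
have -> : f = b' ∘ (b ∘ f ∘ a) ∘ a'.
  by rewrite !compA b'b comp1m -compA aa' compm1.
by rewrite e compm0 comp0m.
Qed.

Lemma conj_isom (X X' Y Y' : C) (a : mor X' X) (b : mor Y Y') (f : mor X Y) :
  isom a -> isom b -> isom (b ∘ f ∘ a) -> isom f.
Proof.
move=> [a' [a'a aa']] [b' [b'b bb']] [g [gf fg]].
exists (a ∘ g ∘ b); split.
  have e : g ∘ b ∘ f = a'.
    have -> : g ∘ b ∘ f = g ∘ (b ∘ f ∘ a) ∘ a' by rewrite -!compA aa' compm1.
    by rewrite gf comp1m.
  by rewrite -!compA (compA g) e.
have e : f ∘ a ∘ g = b'.
  have -> : f ∘ a ∘ g = b' ∘ (b ∘ f ∘ a ∘ g) by rewrite !compA b'b comp1m.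
  by rewrite fg compm1.
by rewrite !compA e b'b.
Qed.

Lemma rank_hom X Y k l : rank X k -> rank Y l ->
  forall f : mor X Y, f != 0 -> (l < k)%N \/ (l = k /\ isom f).
Proof.
move=> rX rY f f0.
case: rX f f0 => {k} i i_n [a isa] f f0; case: rY f f0 => {l} j jn /iso_sym[b isb] f f0;
  have := conj_neq0 isa isb f0.
- have [eij|nij h0] := eqVneq i j.
    subst j => h0; right; split=> //; apply: (conj_isom isa isb).
    by apply: homSS_isom h0; lia.
  by move: h0; rewrite [_ ∘ a](homSS _ _ nij) ?eqxx //; lia.
- by case/andP: i_n => _ i_n /(homSQ i_n jn); lia.
- by case/andP: jn => _ jn /(homQS i_n jn); lia.
- move=> /(homQQ i_n jn) [eij|[eij /(conj_isom isa isb)]]; first by left; lia.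
  by right; rewrite eij.
Qed.

Lemma typeP X : indec X -> (exists X', iso (F X') X) \/ (exists k, rank X k).
Proof.
by move=> /indecP[|[j jn jX]|[j jn jX]]; [left | right; exists j.*2; left
  | right; exists j.*2.+1; right].
Qed.


Lemma isom_neq0 (X Y : C) (f : mor X Y) : idm X <> 0 -> isom f -> f != 0.
Proof. by move=> nz [g [gf _]]; apply/eqP => f0; apply: nz; rewrite -gf f0 compm0. Qed.

(** Along a cycle, objects of [D] can only be followed by objects of [D], since
    there is no nonzero map from them to the new indecomposables. So a cycle
    lies in [D] or consists of new indecomposables, where [rank] drops. *)
Lemma chain_directed : directed D -> directed C.
Proof.
move=> dD [t [M [t0 iM fM M0t]]].
have stepF i X' : (i < t)%N -> iso (F X') (M i) -> exists X', iso (F X') (M i.+1).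
  move=> it [a isa]; have [f [/eqP f0 _]] := fM _ it.
  have [//|[k rk]] := typeP (iM _ it); exfalso.
  case: rk => j jn /iso_sym[b isb]; have /eqP := conj_neq0 isa isb f0; apply.
    exact: homFS.
  exact: homFQ.
have stepsF i j X' : (i + j <= t)%N -> iso (F X') (M i) ->
    exists X', iso (F X') (M (i + j)%N).
  elim: j => [|j IH] ijt FM; first by exists X'; rewrite addn0.
  have [|X'' FM'] := IH _ FM; first by lia.
  by rewrite addnS; apply: stepF FM'; lia.
have allF i X' : (i <= t)%N -> iso (F X') (M i) ->
    forall j, (j <= t)%N -> exists X', iso (F X') (M j).
  move=> it FM j jt; have [|X1 F1] := stepsF i (t - i)%N X' _ FM; first by lia.
  rewrite subnKC // in F1.
  have F0 := iso_trans F1 (iso_sym M0t).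
  by have := stepsF 0%N j X1 jt F0; rewrite add0n.
have noF i : (i <= t)%N -> exists k, rank (M i) k.
  move=> it; have [[X' /(allF _ _ it) /finite_choice [M' FM']]|//] := typeP (iM _ it).
  case: dD; exists t, M'; split=> //.
  - move=> j jt; apply: (@fobj_indec D C F); have [nz idp] := iM _ jt.
    have [a [a' [a'a aa']]] := FM' _ jt; split=> [F0|g gg].
      by apply: nz; rewrite -aa' -[a]compm1 F0 compm0 comp0m.
    have gE : g = a' ∘ (a ∘ g ∘ a') ∘ a.
      by rewrite !compA a'a comp1m -compA a'a compm1.
    have [|e|e] := idp (a ∘ g ∘ a').
    + by rewrite !compA -(compA _ a' a) a'a compm1 -(compA _ g g) gg.
    + by left; rewrite gE e compm0 comp0m.
    + by right; rewrite gE e compm1.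
  - move=> j jt; have [f [/eqP f0 fni]] := fM _ jt.
    have [a isa] := FM' _ (ltnW jt); have [b isb] := iso_sym (FM' _ jt).
    have [g Fg] := fmap_full (b ∘ f ∘ a); exists g; split=> [g0|gi].
      have := conj_neq0 isa isb f0; rewrite -Fg g0 => /eqP; apply.
      exact/fmap_eq0.
    by apply: fni; apply: (conj_isom isa isb); rewrite -Fg; apply: fmap_isom.
  - have [h [h' [h'h hh']]] := iso_trans (iso_trans (FM' 0%N (leq0n _)) M0t)
      (iso_sym (FM' t (leqnn _))).
    have [g Fg] := fmap_full h; have [g' Fg'] := fmap_full h'.
    by exists g, g'; split; apply: (@fmap_inj _ _ F); rewrite fmapM fmap1 Fg Fg'.
have down i j k l : (i + j <= t)%N -> rank (M i) k -> rank (M (i + j)%N) l ->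
    (0 < j)%N -> (l < k)%N.
  elim: j l => // j IH l ijt rk rl _.
  have [|m rm] := noF (i + j)%N; first by lia.
  have [|f [/eqP f0 fni]] := fM (i + j)%N; first by lia.
  rewrite addnS in rl; have [lm|[_ //]] := rank_hom rm rl f0.
  have [j0|j0] := posnP j.
    move: rm lm; rewrite j0 addn0 => rm; have [nz _] : indec (M i) by apply: iM; lia.
    have /eqP id0 := nz.
    by have [|[-> _]] := rank_hom rm rk id0; have [|[-> _]] := rank_hom rk rm id0; lia.
  by have := IH m _ rk rm j0; lia.
have [k rk] := noF 0%N (leq0n _); have [l rl] := noF t (leqnn _).
have := @down 0%N t k l (leqnn _) rk rl t0.
have [h ish] := iso_sym M0t; have [nz _] := iM _ (leqnn t).
by have [|[-> _]] := rank_hom rl rk (isom_neq0 nz ish); lia.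
Qed.

(** Reduces to indecomposables; the new simples have dimension at most [n], and
    Ext^k(F X, S j) = Ext^(k-j)(F X, S 0) is computed in [D]. *)
Lemma chain_gldim d : (forall X Y : D, vext d X Y) ->
  forall X Y : C, vext (d + n) X Y.
Proof.
move=> gD.
have up m X Y : vext (d + m) (F X) (F Y).
  apply/Fext; elim: m X Y => [|m IH] X Y; first by rewrite addn0.
  have [K [P [i [p [ip Pp]]]]] := enough_proj X.
  by rewrite addnS; apply/(vextS_proj _ _ ip Pp).
have SE j : (j <= n)%N -> forall Y, vext (d + n) (S j) Y.
  move=> jn Y; have := @vext_shift_dim (d + j) j (n - j) Y.
  rewrite addnCA subnK // => -> //; exact: vext_projl.
apply: vext_all_indec => X Y /indecP[[X' X'X]|[j jn jX]|[j jn jX]]; last 2 first.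
- by move=> _; apply: (vext_isol jX); apply: SE; case/andP: jn.
- by move=> _; apply: (vext_isol jX); apply: vext_projl; apply: Q_proj.
move=> /indecP[[Y' Y'Y]|[j jn jY]|[j jn jY]]; apply: (vext_isol X'X).
- exact: vext_isor Y'Y (up _ _ _).
- apply: vext_isor jY _; case/andP: jn => _ jn.
  have := @vext_shift_codim (d + (n - j)) 0 j (F X').
  rewrite addn0 addnCA subnKC // => -> //.
  exact: vext_isor (iso_sym T_iso) (up _ _ _).
- by apply: vext_isor jY _; apply: vext_injr; apply: Q_inj.
Qed.

(** If [m < n], then Ext^(m+1)(S (n-m-1), S n) is nonzero; otherwise shifting by
    [n] leads to [S 0]. *)
Lemma chain_injdim d m : (forall m, (forall X : D, vext m X T) -> (d <= m)%N) ->
  (forall X : C, vext m X (S n)) -> (d + n <= m)%N.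
Proof.
move=> dD mS; have [mn|nm] := ltnP m n.
  have mn' : (n - m.+1 < n)%N by lia.
  have := vext_Sn mn'; have -> : (n - (n - m.+1).+1 = m)%N by lia.
  by move=> /(_ (mS _)).
have /dD : forall X : D, vext (m - n) X T; last by lia.
move=> X; apply/Fext; apply: vext_isor T_iso _.
have := @vext_shift_codim (m - n) 0 n (F X); rewrite addn0 subnKC // => e.
exact/e.
Qed.

(** Taking the objects right orthogonal to [F cD] makes closure under summands
    automatic. Its indecomposables turn out to be those of [cD], the [Q j] and
    [S n]: the simples [S j] with [0 < j < n] are excluded by Ext^j(S 0, S j), and
    dually by Ext^(n-j)(S j, S n). *)
Lemma chain_ct (cD : D -> Prop) : (0 < n)%N -> ct n cD ->
  ct n (fun X : C => forall Y, cD Y -> forall k, (k.+1 < n)%N -> vext k (F Y) X).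
Proof.
move=> n0 [ciD cbD clD crD]; set c := (fun X : C => _).
have cF X : c (F X) <-> cD X.
  split=> [cX|/clD H Y cY k kn]; last exact/Fext/H.
  by apply/clD => Y cY k kn; apply/Fext/cX.
have cT : cD T by apply/crD => Y cY k kn; apply: vext_projl.
have cQ j : (j < n)%N -> c (Q j).
  by move=> jn Y _ k _; apply: vext_injr; apply: Q_inj.
have cSn : c (S n) by move=> Y _ k kn; apply: vext_FS; rewrite kn leqnn.
have ncS j : (0 < j < n)%N -> ~ c (S j).
  case: j => // j /= jn /(_ T cT j jn); have := vext_S0 (ltnW jn) => H1 H2.
  by apply: H1; apply: vext_isol H2; apply: iso_sym.
have ci X Y : iso X Y -> c X -> c Y.
  by move=> XY cX Z cZ k kn; apply: vext_isor XY _; apply: cX.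
have cb X Y : c (biprod X Y) <-> c X /\ c Y.
  split=> [H|[H1 H2] Z cZ k kn]; last by apply/vext_biprodr; split; [apply: H1|apply: H2].
  by split=> Z cZ k kn; have /vext_biprodr[] := H Z cZ k kn.
have kappa X Y : c X -> c Y -> forall k, (k.+1 < n)%N -> vext k Y X.
  move=> cX cY k kn; elim/(@indec_ind C): Y cY => [Y Y' YY' IH|Y Y0 _|Y iY|Y Y' H1 H2].
  - by move=> /(ci _ _ (iso_sym YY')) /IH; apply: vext_isol.
  - exact: vext_zerol.
  - case: (indecP iY) => [[Y' Y'Y]|[j jn jY]|[j jn jY]] cY.
    + apply: (vext_isol Y'Y); apply: cX kn; apply/cF.
      exact: ci (iso_sym Y'Y) cY.
    + apply: (vext_isol jY); have [jn'|] := ltnP j n.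
        by case: (@ncS j); [lia | apply: ci (iso_sym jY) cY].
      move=> nj; have -> : j = n by lia.
      exact: vext_projl.
    + by apply: (vext_isol jY); apply: vext_projl; apply: Q_proj.
  - by move=> /cb[/H1 ? /H2 ?]; apply/vext_biprodl.
split=> // X; first split=> [cX Y cY|H Y cY]; try by [apply: kappa|apply: H; apply/cF].
split=> [cX Y cY|]; first exact: kappa.
elim/(@indec_ind C): X => [X X' XX' IH H|X X0 _|X iX|X X' H1 H2 H].
- apply: (ci _ _ XX'); apply: IH => Y cY k kn.
  by apply: vext_isol (iso_sym XX') _; apply: H.
- by move=> Z cZ k kn; apply: vext_zeror.
- case: (indecP iX) => [[X' X'X]|[j jn jX]|[j jn jX]] H.
  + apply: (ci _ _ X'X); apply/cF/crD => Y cY k kn; apply/Fext.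
    by apply: vext_isol (iso_sym X'X) _; apply: H kn; apply/cF.
  + apply: (ci _ _ jX); have [jn'|] := ltnP j n; last first.
      by move=> nj; have -> : j = n by lia.
    case: (vext_Sn jn'); apply: vext_isol (iso_sym jX) _.
    by apply: H => //; lia.
  + by apply: (ci _ _ jX); apply: cQ.
- apply/cb; split; [apply: H1|apply: H2] => Y cY k kn;
    by have /vext_biprodl[] := H Y cY k kn.
Qed.

Theorem chain_theorem d : (0 < n)%N -> directed D ->
  (forall X Y : D, vext d X Y) -> least (fun m => forall X : D, vext m X T) d ->
  (exists cD : D -> Prop, ct n cD) ->
  [/\ directed C, least (fun m => forall X Y : C, vext m X Y) (d + n),
      exists c : C -> Prop, ct n c &
      least (fun m => forall X : C, vext m X (S n)) (d + n)].
Proof.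
move=> n0 dD gD [_ lD] [cD ctD]; have gC := chain_gldim gD; split.
- exact: chain_directed.
- by split=> // m Hm; apply: chain_injdim lD _ => X; apply: Hm.
- by eexists; apply: chain_ct ctD.
- by split=> // m; apply: chain_injdim.
Qed.

End Chain.

(** * The category of modules *)

HB.lock Definition mklin (K : fieldType) (V W : vectType K) (f : V -> W)
    (Hf : linear f) : 'Hom(V, W) :=
  let g : {linear V -> W} := HB.pack f (GRing.isLinear.Build K V W _ f Hf) in
  linfun g.

Lemma mklinE (K : fieldType) (V W : vectType K) (f : V -> W) (Hf : linear f) x :
  mklin Hf x = f x.
Proof. by rewrite mklin.unlock lfunE. Qed.

Lemma limg_fullP (K : fieldType) (V W : vectType K) (f : 'Hom(V, W)) :
  limg f = fullv <-> forall w, exists v, f v = w.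
Proof.
split=> [fE w | H].
  by have := memvf w; rewrite -fE => /memv_imgP[v _ ->]; exists v.
apply/vspaceP => w; rewrite memvf; have [v <-] := H w.
by rewrite memv_img ?memvf.
Qed.

Lemma lker_injP (K : fieldType) (V W : vectType K) (f : 'Hom(V, W)) :
  lker f = 0%VS <-> injective f.
Proof. by split=> [/eqP/lker0P | /lker0P/eqP]. Qed.

Section ModuleMaps.
Variables (K : fieldType) (A : falgType K).
Implicit Types M N X Y Z : rmodule A.

Definition ract M (a : A) (x : M) : M := rm_act x a.
HB.instance Definition _ M a :=
  GRing.isLinear.Build K M M _ (ract (M := M) a) (@rm_act_linearl _ _ M a).
HB.instance Definition _ M x :=
  GRing.isLinear.Build K A M _ (@rm_act _ _ M x) (@rm_act_linearr _ _ M x).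

Lemma actDl M a : {morph (fun x : M => rm_act x a) : x y / x + y}.
Proof. exact: (linearD (ract a)). Qed.
Lemma actZl M a k : {morph (fun x : M => rm_act x a) : x / k *: x}.
Proof. exact: (linearZ_LR (ract a)). Qed.
Lemma act0l M a : rm_act (0 : M) a = 0.
Proof. exact: (linear0 (ract a)). Qed.
Lemma actBl M a : {morph (fun x : M => rm_act x a) : x y / x - y}.
Proof. exact: (linearB (ract a)). Qed.
Lemma act_suml M a I (r : seq I) (P : pred I) (F : I -> M) :
  rm_act (\sum_(i <- r | P i) F i) a = \sum_(i <- r | P i) rm_act (F i) a.
Proof. exact: (linear_sum (ract a)). Qed.

(** The homomorphisms form the common kernel of these maps when [a] runs over a
    basis of the algebra, so that they are a subspace. *)
Definition twist M N (a : A) (f : 'Hom(M, N)) : 'Hom(M, N) :=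
  ((f \o linfun (ract a)) - (linfun (ract a) \o f))%VF.

Lemma twist_linear M N a : linear (@twist M N a).
Proof.
move=> k f g; apply/lfunP => x; rewrite /twist !(add_lfunE, opp_lfunE, scale_lfunE, comp_lfunE) !lfunE /=.
by rewrite /ract actDl actZl scalerBr !opprD !addrA; congr (_ + _); rewrite addrAC.
Qed.
HB.instance Definition _ M N a :=
  GRing.isLinear.Build K _ _ _ (@twist M N a) (@twist_linear M N a).

Definition rhomV M N : {vspace 'Hom(M, N)} :=
  (\bigcap_(i < \dim {:A}) lker (linfun (@twist M N (vbasis {:A})`_i)))%VS.

Lemma rhomVP M N (f : 'Hom(M, N)) : reflect (rhom f) (f \in rhomV M N).
Proof.
rewrite /rhomV memvE; apply: (iffP subv_bigcapP) => [H x a | H i _].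
  rewrite (coord_vbasis (memvf a)) !linear_sum /=.
  apply: eq_bigr => i _; rewrite !linearZ /=; congr (_ *: _).
  have := H i isT; rewrite -memvE memv_ker lfunE /= => /eqP/lfunP/(_ x).
  by rewrite !(add_lfunE, opp_lfunE, comp_lfunE) !lfunE /= => /subr0_eq.
rewrite -memvE memv_ker lfunE /=; apply/eqP/lfunP => x.
by rewrite !(add_lfunE, opp_lfunE, comp_lfunE) !lfunE /= /ract H subrr.
Qed.

Definition rmor M N := subvs_of (rhomV M N).
HB.instance Definition _ M N := Vector.on (rmor M N).

Definition mfun M N (f : rmor M N) : 'Hom(M, N) := vsval f.
Coercion mfun : rmor >-> vector.hom.
Arguments mfun : simpl never.
Definition mkmor M N (f : 'Hom(M, N)) (Hf : rhom f) : rmor M N :=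
  Subvs (introT (rhomVP f) Hf).

Lemma mkmorE M N (f : 'Hom(M, N)) (Hf : rhom f) : mkmor Hf = f :> 'Hom(M, N).
Proof. by []. Qed.

Lemma morP M N (f g : rmor M N) : (forall x, f x = g x) <-> f = g.
Proof. by split=> [e|-> //]; apply/val_inj/lfunP. Qed.

Lemma mor_act M N (f : rmor M N) x a : f (rm_act x a) = rm_act (f x) a.
Proof. exact: (rhomVP _ (subvsP f)). Qed.

Lemma rhom_comp M N X (g : 'Hom(N, X)) (f : 'Hom(M, N)) :
  rhom g -> rhom f -> rhom (g \o f)%VF.
Proof. by move=> Hg Hf x a; rewrite !comp_lfunE Hf Hg. Qed.

Lemma rhom_id M : rhom (\1%VF : 'End(M)).
Proof. by move=> x a; rewrite !id_lfunE. Qed.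

Lemma mor_rhom M N (f : rmor M N) : rhom f.
Proof. exact: (rhomVP _ (subvsP f)). Qed.

Definition rid M : rmor M M := mkmor (@rhom_id M).
Definition rcomp M N X (g : rmor N X) (f : rmor M N) : rmor M X :=
  mkmor (rhom_comp (mor_rhom g) (mor_rhom f)).

(** Submodules and quotients, with the action transported along a linear
    injection or surjection. *)
Section Sub.
Variables (M : rmodule A) (V : vectType K) (i : 'Hom(V, M)).
Hypotheses (i_inj : lker i = 0%VS) (i_sub : submodule (limg i)).

Definition sub_act (v : V) a : V := (i^-1)%VF (rm_act (i v) a).

Lemma sub_actE v a : i (sub_act v a) = rm_act (i v) a.
Proof. by rewrite /sub_act limg_lfunVK // i_sub // memv_img // memvf. Qed.

Let iI : injective i. Proof. exact/lker0P/eqP. Qed.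

Fact sub_act_linearl a : linear (sub_act^~ a).
Proof. by move=> k x y; apply: iI; rewrite linearP /= !sub_actE linearP rm_act_linearl. Qed.
Fact sub_act_linearr x : linear (sub_act x).
Proof. by move=> k a b; apply: iI; rewrite linearP /= !sub_actE linearP. Qed.
Fact sub_act1 x : sub_act x 1 = x.
Proof. by apply: iI; rewrite sub_actE rm_act1. Qed.
Fact sub_actM x a b : sub_act x (a * b) = sub_act (sub_act x a) b.
Proof. by apply: iI; rewrite !sub_actE rm_actM. Qed.

Definition submod := RModule sub_act_linearl sub_act_linearr sub_act1 sub_actM.
Definition submod_incl : rmor submod M := mkmor (sub_actE : rhom (M := submod) i).
End Sub.

Section Quo.
Variables (M : rmodule A) (V : vectType K) (p : 'Hom(M, V)).
Hypotheses (p_epi : limg p = fullv) (p_ker : submodule (lker p)).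

Definition quo_act (v : V) a : V := p (rm_act ((p^-1)%VF v) a).

Let pK v : p ((p^-1)%VF v) = v.
Proof. by rewrite limg_lfunVK // p_epi memvf. Qed.

Lemma quo_actE x a : p (rm_act x a) = quo_act (p x) a.
Proof.
apply/subr0_eq; rewrite /quo_act -linearB -actBl; apply/eqP; rewrite -memv_ker.
by apply: p_ker; rewrite memv_ker linearB /= pK subrr.
Qed.

Fact quo_act_linearl a : linear (quo_act^~ a).
Proof. by move=> k x y; rewrite /quo_act linearP rm_act_linearl linearP. Qed.
Fact quo_act_linearr x : linear (quo_act x).
Proof. by move=> k a b; rewrite /quo_act !linearP. Qed.
Fact quo_act1 x : quo_act x 1 = x.
Proof. by rewrite /quo_act rm_act1 pK. Qed.
Fact quo_actM x a b : quo_act x (a * b) = quo_act (quo_act x a) b.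
Proof. by rewrite -[x]pK -!quo_actE rm_actM. Qed.

Definition quomod := RModule quo_act_linearl quo_act_linearr quo_act1 quo_actM.
Definition quomod_proj : rmor M quomod := mkmor (quo_actE : rhom (N := quomod) p).
End Quo.

Lemma vsval_limg (vT : vectType K) (U : {vspace vT}) :
  limg (linfun (vsval : subvs_of U -> vT)) = U.
Proof.
apply/vspaceP => x; apply/memv_imgP/idP => [[y _ ->]|xU].
  by rewrite lfunE /= subvsP.
by exists (vsproj U x); rewrite ?memvf // lfunE /= vsprojK.
Qed.

Lemma vsval_lker (vT : vectType K) (U : {vspace vT}) :
  lker (linfun (vsval : subvs_of U -> vT)) = 0%VS.
Proof. by apply/eqP/lker0P => x y; rewrite !lfunE => /val_inj. Qed.

(** The image of the complementary projection serves as the quotient space. *)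
Lemma quotient_exists (vT : vectType K) (U : {vspace vT}) :
  exists (V : vectType K) (p : 'Hom(vT, V)), limg p = fullv /\ lker p = U.
Proof.
pose q := (\1 - projv U)%VF; pose p := linfun (vsproj (limg q) \o q).
have pE x : vsval (p x) = q x by rewrite lfunE /= vsprojK // memv_img // memvf.
have qE x : q x = x - projv U x by rewrite !lfunE /= !lfunE.
exists (subvs_of (limg q)), p; split.
  apply/limg_fullP => v; have /memv_imgP[x _ vx] := subvsP v.
  by exists x; apply: val_inj; apply: etrans (pE x) (esym vx).
apply/vspaceP => x; rewrite memv_ker -(inj_eq subvs_inj) pE qE linear0 subr_eq0.
apply/eqP/idP => [-> |/projv_id //]; first exact: memv_proj.
Qed.

Lemma lker_submodule M N (f : rmor M N) : submodule (lker f).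
Proof. by move=> x a; rewrite !memv_ker mor_act => /eqP->; rewrite act0l. Qed.

Lemma limg_submodule M N (f : rmor M N) : submodule (limg f).
Proof.
move=> x a /memv_imgP[y _ ->]; rewrite -mor_act memv_img ?memvf //.
Qed.

Section Dsum.
Variables M N : rmodule A.

Fact dsum_in1_linear : linear (fun x : M => (x, 0) : dsum M N).
Proof. by move=> k x y; congr pair; rewrite /= scaler0 addr0. Qed.
Fact dsum_in2_linear : linear (fun x : N => (0, x) : dsum M N).
Proof. by move=> k x y; congr pair; rewrite /= scaler0 addr0. Qed.
Fact dsum_pr1_linear : linear (fun x : dsum M N => x.1).
Proof. by []. Qed.
Fact dsum_pr2_linear : linear (fun x : dsum M N => x.2).
Proof. by []. Qed.

Fact dsum_in1_rhom : rhom (mklin dsum_in1_linear : 'Hom(M, dsum M N)).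
Proof. by move=> x a; rewrite !mklinE; congr pair; rewrite act0l. Qed.
Fact dsum_in2_rhom : rhom (mklin dsum_in2_linear : 'Hom(N, dsum M N)).
Proof. by move=> x a; rewrite !mklinE; congr pair; rewrite act0l. Qed.
Fact dsum_pr1_rhom : rhom (mklin dsum_pr1_linear).
Proof. by move=> x a; rewrite !mklinE. Qed.
Fact dsum_pr2_rhom : rhom (mklin dsum_pr2_linear).
Proof. by move=> x a; rewrite !mklinE. Qed.

End Dsum.

Definition rmod_precat : precat.
Proof.
refine (@PreCat (rmodule A) (fun M N => rmor M N) rid
  (fun X Y Z g f => rcomp g f) _ _ _ _ _ (@dsum K A)
  (fun M N => mkmor (@dsum_in1_rhom M N)) (fun M N => mkmor (@dsum_in2_rhom M N))
  (fun M N => mkmor (@dsum_pr1_rhom M N)) (fun M N => mkmor (@dsum_pr2_rhom M N))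
  _ _ _ _ _); move=> *; apply/morP => x.
all: rewrite ?(comp_lfunE, id_lfunE, add_lfunE, zero_lfunE, linearD) //.
all: rewrite ?mklinE //.
by case: x => y z; congr pair; rewrite /= ?addr0 ?add0r.
Defined.

(** Test a monomorphism on the inclusion of its kernel. *)
Lemma mono_inj M N (f : rmor M N) : @mono rmod_precat M N f <-> lker f = 0%VS.
Proof.
split=> [fM | /lker_injP fI W h /morP H]; last first.
  apply/morP => x; apply: fI; have := H x.
  by rewrite /= !comp_lfunE !zero_lfunE linear0.
have HU : submodule (limg (linfun (vsval : subvs_of (lker f) -> M))).
  by rewrite vsval_limg; apply: lker_submodule.
pose i := submod_incl (vsval_lker (lker f)) HU.
have /morP i0 : i = 0.
  apply: fM; apply/morP => x; rewrite /= comp_lfunE zero_lfunE.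
  by apply/eqP; rewrite -memv_ker lfunE subvsP.
apply/eqP; rewrite -subv0; apply/subvP => x xU.
have := i0 (vsproj _ x); rewrite lfunE /= vsprojK // zero_lfunE => ->.
exact: mem0v.
Qed.

(** Test an epimorphism on the projection to its cokernel. *)
Lemma epi_surj M N (f : rmor M N) : @epi rmod_precat M N f <-> limg f = fullv.
Proof.
split=> [fE | /limg_fullP fS W h /morP H]; last first.
  by apply/morP => y; have [x <-] := fS y; have := H x; rewrite /= comp_lfunE !zero_lfunE.
have [V [p [pS pK]]] := quotient_exists (limg f).
have HU : submodule (lker p) by rewrite pK; apply: limg_submodule.
pose q := quomod_proj pS HU.
have /morP q0 : q = 0.
  apply: fE; apply/morP => x; rewrite /= comp_lfunE zero_lfunE.
  by apply/eqP; rewrite -memv_ker pK memv_img ?memvf.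
apply/vspaceP => y; rewrite memvf -pK memv_ker.
by have := q0 y; rewrite zero_lfunE => /eqP.
Qed.

Lemma sesP M N X (i : rmor M N) (p : rmor N X) :
  @ses rmod_precat M N X i p <-> [/\ lker i = 0%VS, limg p = fullv & lker p = limg i].
Proof.
split=> [[[/mono_inj iM /epi_surj pE] /morP pi kerp _] | [iM pE ex]].
  split=> //; apply/eqP; rewrite eqEsubv; apply/andP; split; apply/subvP => x; last first.
    case/memv_imgP=> y _ ->; have := pi y.
    by rewrite comp_lfunE zero_lfunE memv_ker => /eqP.
  move=> xK.
  have HU : submodule (limg (linfun (vsval : subvs_of (lker p) -> N))).
    by rewrite vsval_limg; apply: lker_submodule.
  have [|k /morP ik] := kerp _ (submod_incl (vsval_lker (lker p)) HU).
    apply/morP => y; rewrite /= comp_lfunE zero_lfunE.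
    by apply/eqP; rewrite -memv_ker lfunE subvsP.
  have := ik (vsproj _ x); rewrite comp_lfunE [RHS]lfunE /= vsprojK // => <-.
  by rewrite memv_img ?memvf.
have iI := iffLR (lker_injP i) iM; have pS := iffLR (limg_fullP p) pE.
split; first by split; [apply/mono_inj|apply/epi_surj].
- apply/morP => x; rewrite /= comp_lfunE zero_lfunE; apply/eqP.
  by rewrite -memv_ker ex memv_img ?memvf.
- move=> W h0; set h : rmor W N := h0; move=> /morP ph.
  have hi x : i ((i^-1 \o h)%VF x) = h x.
    rewrite comp_lfunE limg_lfunVK // -ex memv_ker.
    by have := ph x; rewrite comp_lfunE zero_lfunE => ->.
  have Hk : rhom (i^-1 \o h)%VF.
    by move=> x a; apply: iI; rewrite hi mor_act -hi -mor_act.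
  by exists (mkmor Hk); apply/morP => x; rewrite /= comp_lfunE hi.
- move=> W h0; set h : rmor N W := h0; move=> /morP hi.
  have hp x : (h \o p^-1)%VF (p x) = h x.
    apply/subr0_eq; rewrite comp_lfunE -linearB.
    have : (p^-1)%VF (p x) - x \in lker p.
      by rewrite memv_ker linearB /= limg_lfunVK ?subrr // memv_img ?memvf.
    by rewrite ex => /memv_imgP[y _ ->]; have := hi y; rewrite comp_lfunE zero_lfunE.
  have Hk : rhom (h \o p^-1)%VF.
    by move=> y a; have [x <-] := pS y; rewrite -mor_act !hp mor_act.
  by exists (mkmor Hk); apply/morP => x; rewrite /= comp_lfunE hp.
Qed.

Lemma projP M : @proj rmod_precat M <-> projective_rmodule M.
Proof.
split=> Mp X Y p h; last first.
  move=> /epi_surj pE; have [k Hk pk] := Mp _ _ _ _ (mor_rhom p) pE (mor_rhom h).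
  by exists (mkmor Hk); apply/morP => x; rewrite -pk.
move=> Hp pE Hh; have /epi_surj pE' : limg (mkmor Hp) = fullv by [].
have [k /morP pk] := Mp _ _ _ (mkmor Hh) pE'.
by exists (mfun k); [apply: mor_rhom | apply/lfunP].
Qed.

Lemma injP M : @inj rmod_precat M <-> injective_rmodule M.
Proof.
split=> Mp X Y p h; last first.
  move=> /mono_inj pE; have [k Hk pk] := Mp _ _ _ _ (mor_rhom p) pE (mor_rhom h).
  by exists (mkmor Hk); apply/morP => x; rewrite -pk.
move=> Hp pE Hh; have /mono_inj pE' : lker (mkmor Hp) = 0%VS by [].
have [k /morP pk] := Mp _ _ (mkmor Hp) (mkmor Hh) pE'.
by exists (mfun k); [apply: mor_rhom | apply/lfunP].
Qed.

Lemma isomP M N (f : rmor M N) : @isom rmod_precat M N f <-> is_riso f.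
Proof.
split=> [[g [/morP gf /morP fg]] | [_ [g gf fg]]].
  split; first exact: mor_rhom.
  by exists (g : rmor N M) => x;
    [have := gf x | have := fg x]; rewrite comp_lfunE id_lfunE.
have fI : lker f == 0%VS by apply/lker0P; apply: can_inj gf.
have gE y : (f^-1)%VF y = g y by rewrite -{1}[y]fg lker0_lfunK.
have Hg : rhom (f^-1)%VF.
  by move=> y a; rewrite !gE -{1}[y]fg -mor_act gf.
by exists (mkmor Hg); split; apply/morP => x;
  rewrite /= comp_lfunE id_lfunE gE ?gf ?fg.
Qed.

Lemma isoP M N : @iso rmod_precat M N <-> riso M N.
Proof.
split=> [[f /isomP fi] | [f fi]]; first by exists (mfun f).
by exists (mkmor fi.1); apply/isomP.
Qed.

End ModuleMaps.

Section ModuleCategory.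
Variables (K : fieldType) (A : falgType K).
Implicit Types M N X Y Z : rmodule A.

Lemma proj_lift M :
  (forall X Y (p : rmor X Y) (h : rmor M Y), limg p = fullv ->
     exists k : rmor M X, forall x, p (k x) = h x) -> @proj (rmod_precat A) M.
Proof.
move=> H X Y p h /epi_surj pE; have [k pk] := H _ _ p h pE.
by exists k; apply/morP => x; rewrite /= comp_lfunE pk.
Qed.

Lemma inj_extend M :
  (forall X Y (i : rmor X Y) (h : rmor X M), lker i = 0%VS ->
     exists k : rmor Y M, forall x, k (i x) = h x) -> @inj (rmod_precat A) M.
Proof.
move=> H X Y p h /mono_inj pE; have [k pk] := H _ _ p h pE.
by exists k; apply/morP => x; rewrite /= comp_lfunE pk.
Qed.

(** Free modules are enough projectives. *)
Section Free.
Variable k : nat.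
Local Notation V := {ffun 'I_k -> A}.

Definition free_act (v : V) a : V := [ffun i => v i * a].

Fact free_act_linearl a : linear (free_act^~ a).
Proof. by move=> c v w; apply/ffunP => i; rewrite !ffunE mulrDl scalerAl. Qed.
Fact free_act_linearr v : linear (free_act v).
Proof. by move=> c a b; apply/ffunP => i; rewrite !ffunE mulrDr scalerAr. Qed.
Fact free_act1 v : free_act v 1 = v.
Proof. by apply/ffunP => i; rewrite ffunE mulr1. Qed.
Fact free_actM v a b : free_act v (a * b) = free_act (free_act v a) b.
Proof. by apply/ffunP => i; rewrite !ffunE mulrA. Qed.

Definition free_mod :=
  RModule free_act_linearl free_act_linearr free_act1 free_actM.

Definition free_map M (x : 'I_k -> M) (v : V) : M := \sum_i rm_act (x i) (v i).

Fact free_map_linear M (x : 'I_k -> M) : linear (free_map x).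
Proof.
move=> c v w; rewrite /free_map scaler_sumr -big_split /=.
by apply: eq_bigr => i _; rewrite !ffunE linearP.
Qed.

Fact free_map_rhom M (x : 'I_k -> M) : rhom (M := free_mod) (mklin (free_map_linear x)).
Proof.
move=> v a; rewrite !mklinE /free_map act_suml.
by apply: eq_bigr => i _; rewrite ffunE rm_actM.
Qed.

Lemma free_mapE M (h : rmor free_mod M) :
  exists x : 'I_k -> M, forall v, h v = free_map x v.
Proof.
pose b i : free_mod := [ffun j => (i == j)%:R].
exists (fun i => h (b i)) => v; rewrite /free_map.
under eq_bigr do rewrite -mor_act.
rewrite -linear_sum; congr (h _); apply/ffunP => j; rewrite sum_ffunE (bigD1 j) //=.
rewrite !ffunE eqxx mul1r big1 ?addr0 // => i /negPf ij.
by rewrite !ffunE ij mul0r.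
Qed.

Lemma free_proj : @proj (rmod_precat A) free_mod.
Proof.
apply: proj_lift => X Y p h pE; have [y hy] := free_mapE h.
exists (mkmor (free_map_rhom (fun i => (p^-1)%VF (y i)))) => v.
rewrite hy /= mklinE /free_map linear_sum /=; apply: eq_bigr => i _.
by rewrite mor_act limg_lfunVK // pE memvf.
Qed.

End Free.

Definition cover X : rmodule A := free_mod (\dim {:X}).
Definition cover_map X : rmor (cover X) X :=
  mkmor (free_map_rhom (fun i : 'I_(\dim {:X}) => (vbasis {:X})`_i)).

Fact ker_submodule M N (f : rmor M N) :
  submodule (limg (linfun (vsval : subvs_of (lker f) -> M))).
Proof. by rewrite vsval_limg; apply: lker_submodule. Qed.

Definition ker M N (f : rmor M N) : rmodule A :=
  submod (vsval_lker (lker f)) (@ker_submodule M N f).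
Definition ker_incl M N (f : rmor M N) : rmor (ker f) M := submod_incl _ _.

Lemma ker_ses M N (f : rmor M N) :
  limg f = fullv -> @ses (rmod_precat A) _ _ _ (ker_incl f) f.
Proof.
by move=> fE; apply/sesP; split=> //; [apply: vsval_lker | rewrite /= vsval_limg].
Qed.

Lemma cover_epi X : limg (cover_map X) = fullv.
Proof.
apply/limg_fullP => m; exists [ffun i => (coord (vbasis {:X}) i m)%:A].
rewrite mklinE {2}(coord_vbasis (memvf m)); apply: eq_bigr => i _.
by rewrite ffunE linearZ /= rm_act1.
Qed.

Definition syzygy X := ker (cover_map X).

Lemma mod_enough_proj (X : rmod_precat A) :
  exists (M P : rmod_precat A) (i : mor M P) (p : mor P X), ses i p /\ proj P.
Proof.
exists (syzygy X), (cover X), (ker_incl _), (cover_map X).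
by split; [apply/ker_ses/cover_epi | apply: free_proj].
Qed.

(** The module of linear maps from the algebra to a space [V] is coinduced:
    homomorphisms into it are the linear maps into [V], which extend. *)
Section Cofree.
Variable V : vectType K.

Definition cofree_act (f : 'Hom(A, V)) a : 'Hom(A, V) := (f \o amull a)%VF.

Fact cofree_act_linearl a : linear (cofree_act^~ a).
Proof. by move=> c v w; rewrite /cofree_act comp_lfunDl comp_lfunZl. Qed.
Fact cofree_act_linearr v : linear (cofree_act v).
Proof. by move=> c a b; rewrite /cofree_act linearP comp_lfunDr comp_lfunZr. Qed.
Fact cofree_act1 v : cofree_act v 1 = v.
Proof. by apply/lfunP => x; rewrite comp_lfunE lfunE /= mul1r. Qed.
Fact cofree_actM v a b : cofree_act v (a * b) = cofree_act (cofree_act v a) b.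
Proof. by apply/lfunP => x; rewrite !comp_lfunE !lfunE /= mulrA. Qed.

Definition cofree_mod :=
  RModule cofree_act_linearl cofree_act_linearr cofree_act1 cofree_actM.

Lemma cofree_map_exists M (f : 'Hom(M, V)) :
  exists h : rmor M cofree_mod, forall x a, (h x : 'Hom(A, V)) a = f (rm_act x a).
Proof.
have h0L x : linear (fun a => f (rm_act x a)).
  by move=> c a b; rewrite !linearP.
have hL : linear (fun x => mklin (h0L x) : cofree_mod).
  by move=> c x y; apply/lfunP => a; rewrite add_lfunE scale_lfunE !mklinE actDl actZl linearP.
have hR : rhom (mklin hL : 'Hom(M, cofree_mod)).
  move=> x a; rewrite !mklinE; apply/lfunP => b.
  by rewrite comp_lfunE !mklinE lfunE /= rm_actM.
by exists (mkmor hR) => x a; rewrite /= !mklinE.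
Qed.

Fact eval1_linear : linear (fun g : cofree_mod => (g : 'Hom(A, V)) 1).
Proof. by move=> c f g; rewrite add_lfunE scale_lfunE. Qed.

Lemma cofree_inj : @inj (rmod_precat A) cofree_mod.
Proof.
apply: inj_extend => X Y i h iM.
have [k kE] := cofree_map_exists (mklin eval1_linear \o h \o i^-1)%VF.
exists k => x; apply/lfunP => a.
rewrite kE -mor_act !comp_lfunE lker0_lfunK ?iM // mor_act mklinE.
by rewrite comp_lfunE lfunE /= mulr1.
Qed.

End Cofree.

Lemma mod_enough_inj (X : rmod_precat A) : exists (I M : rmod_precat A) (j : mor X I) (q : mor I M),
  ses j q /\ inj I.
Proof.
have [j jE] := cofree_map_exists (\1%VF : 'End(rm_sort X)).
have [V [q [qS qK]]] := quotient_exists (limg j).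
have HU : submodule (M := cofree_mod X) (lker q).
  by rewrite qK; apply: limg_submodule.
exists (cofree_mod X), (quomod qS HU), j, (quomod_proj qS HU).
split; last exact: cofree_inj.
apply/sesP; split=> //; apply/lker_injP => x y /lfunP/(_ 1).
by rewrite !jE !id_lfunE !rm_act1.
Qed.

Lemma split_idem (M : rmod_precat A) (g : mor M M) : g ∘ g = g ->
  exists (U : rmod_precat A) (s : mor U M) (r : mor M U),
    [/\ r ∘ s = idm U, s ∘ r = g & \dim {:rm_sort U} = \dim (limg (mfun (g : rmor M M)))].
Proof.
set g' : rmor M M := g => /morP gg.
have HU : submodule (limg (linfun (vsval : subvs_of (limg g') -> M))).
  by rewrite vsval_limg; apply: limg_submodule.
pose s := submod_incl (vsval_lker (limg g')) HU.
have sI : lker s = 0%VS by apply: vsval_lker.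
have sE : limg s = limg g' by apply: vsval_limg.
have sK x : s ((s^-1)%VF (g' x)) = g' x.
  by rewrite limg_lfunVK // sE memv_img ?memvf.
have rR : rhom ((s : 'Hom(_, _))^-1 \o g')%VF.
  move=> x a; apply: (iffLR (lker_injP _) sI).
  by rewrite mor_act !comp_lfunE !sK mor_act.
exists (submod (vsval_lker (limg g')) HU), s, (mkmor rR); split.
- apply/morP => x; apply: (iffLR (lker_injP _) sI).
  rewrite /= !comp_lfunE sK id_lfunE.
  have sub : (limg s <= limg g')%VS by rewrite sE.
  have : s x \in limg g' by apply: (subvP sub); rewrite memv_img ?memvf.
  by case/memv_imgP => y _ ->; have := gg y; rewrite comp_lfunE.
- by apply/morP => x; rewrite /= !comp_lfunE sK.
- by apply: etrans (congr1 (fun U => \dim U) sE); rewrite limg_dim_eq // sI capv0.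
Qed.

Lemma idm_zero M : @idm (rmod_precat A) M = 0 <-> zero_rmodule M.
Proof.
split=> [/morP e | M0].
  by apply/eqP; rewrite -subv0; apply/subvP => x _; have := e x;
    rewrite id_lfunE zero_lfunE => ->; apply: mem0v.
apply/morP => x; rewrite id_lfunE zero_lfunE; apply/eqP.
by rewrite -memv0 -M0 memvf.
Qed.

Lemma indec_rmoduleP M : @indec (rmod_precat A) M <-> indecomposable M.
Proof.
split=> [[nz idp] | [nz dec]]; split.
- by move/idm_zero.
- move=> U V HU HV UV UV0; pose p := daddv_pi U V.
  have pU u : u \in U -> p u = u by apply: daddv_pi_id.
  have pV v : v \in V -> p v = 0.
    move=> vV; have vUV : v \in (U + V)%VS by rewrite UV memvf.
    have := daddv_pi_add UV0 vUV; rewrite [X in _ + X]daddv_pi_id //; last first.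
      by rewrite capvC.
    by move/(canRL (addrK _)); rewrite subrr.
  have pR : rhom p.
    move=> x a; have := memvf x; rewrite -UV => /memv_addP[y yU [z zV ->]].
    rewrite actDl !linearD /= (pU _ yU) (pV _ zV) (pU _ (HU _ a yU)).
    by rewrite (pV _ (HV _ a zV)) !addr0.
  have [|/morP p0|/morP p1] := idp (mkmor pR).
  + apply/morP => x; rewrite /= comp_lfunE.
    have := memvf x; rewrite -UV => /memv_addP[y yU [z zV ->]].
    have pyz : p (y + z) = y by rewrite linearD /= (pU _ yU) (pV _ zV) addr0.
    have : p (p (y + z)) = p (y + z) by rewrite !pyz pU.
    exact.
  + left; apply/eqP; rewrite -subv0; apply/subvP => x xU.
    by rewrite -(pU _ xU); have := p0 x; rewrite zero_lfunE => ->; apply: mem0v.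
  + right; apply/eqP; rewrite -subv0; apply/subvP => x xV.
    by have := p1 x; rewrite id_lfunE /= pV // => <-; apply: mem0v.
- by move/idm_zero.
- move=> g0; set g : rmor M M := g0 => /morP gg.
  have ggE x : g (g x) = g x by have := gg x; rewrite comp_lfunE.
  have [||||g0E|/lker_injP gI] := dec (limg g) (lker g).
  + exact: limg_submodule.
  + exact: lker_submodule.
  + apply/vspaceP => x; rewrite memvf; apply/memv_addP.
    exists (g x); first by rewrite memv_img ?memvf.
    exists (x - g x); last by rewrite addrC subrK.
    by rewrite memv_ker linearB /= ggE subrr.
  + apply/eqP; rewrite -subv0; apply/subvP => x.
    rewrite memv_cap => /andP[/memv_imgP[y _ ->]].
    by rewrite memv_ker ggE => /eqP->; apply: mem0v.
  + left; apply/morP => x; rewrite zero_lfunE; apply/eqP.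
    by rewrite -memv0 -g0E memv_img ?memvf.
  + by right; apply/morP => x; rewrite id_lfunE; apply: gI; rewrite ggE.
Qed.

Lemma split_biprod (M U V : rmod_precat A) (g : mor M M) (s : mor U M) (r : mor M U)
    (s' : mor V M) (r' : mor M V) :
  r ∘ s = idm U -> s ∘ r = g -> r' ∘ s' = idm V -> s' ∘ r' = idm M - g ->
  iso (biprod U V) M.
Proof.
move=> rs sr rs' sr'.
have gg : g ∘ g = g by rewrite -sr -compA (compA r) rs comp1m.
have rs0 : r ∘ s' = 0.
  have e : g ∘ (s' ∘ r') = 0 by rewrite sr' compDr compNr compm1 gg subrr.
  have -> : r ∘ s' = r ∘ (g ∘ (s' ∘ r')) ∘ s'.
    by rewrite -sr !compA rs comp1m -compA rs' compm1.
  by rewrite e compm0 comp0m.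
have rs0' : r' ∘ s = 0.
  have e : (s' ∘ r') ∘ (s ∘ r) = 0 by rewrite sr' sr compDl compNl comp1m gg subrr.
  have -> : r' ∘ s = r' ∘ (s' ∘ r' ∘ (s ∘ r)) ∘ s.
    by rewrite !compA rs' comp1m -compA rs compm1.
  by rewrite e compm0 comp0m.
exists (s ∘ pr1 U V + s' ∘ pr2 U V), (in1 U V ∘ r + in2 U V ∘ r'); split.
  rewrite compDl !compDr -!compA !(compA r) !(compA r') rs rs' rs0 rs0'.
  by rewrite !comp1m !comp0m !compm0 addr0 add0r biprod_split.
rewrite compDl !compDr -!compA !(compA (pr1 _ _)) !(compA (pr2 _ _)).
rewrite pr1in1 pr2in2 pr1in2 pr2in1 !comp1m !comp0m !compm0 addr0 add0r.
by rewrite sr sr' addrC subrK.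
Qed.

(** Induction on the dimension: a module that is neither zero nor indecomposable
    has a nontrivial idempotent endomorphism, hence smaller summands. *)
Lemma mod_indec_ind (Q : rmod_precat A -> Prop) :
  (forall X Y : rmod_precat A, iso X Y -> Q X -> Q Y) -> (forall X : rmod_precat A, idm X = 0 -> Q X) ->
  (forall X : rmod_precat A, indec X -> Q X) ->
  (forall X Y : rmod_precat A, Q X -> Q Y -> Q (biprod X Y)) -> forall X : rmod_precat A, Q X.
Proof.
move=> Qi Q0 QX QD X; have [m] := ubnP (\dim {:rm_sort X}).
elim: m X => // m IH X Xm.
have [/Q0 //|nz] := classic (idm X = 0).
have [[g [gg g0 g1]]|H] := classic (exists g : mor X X, [/\ g ∘ g = g, g <> 0 & g <> idm X]); last first.
  apply: QX; split=> // g gg; apply: NNPP => /not_or_and[g0 g1].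
  by apply: H; exists g.
have small (h : mor X X) : h ∘ h = h -> h <> idm X -> (\dim (limg (mfun h)) < m)%N.
  move=> hh h1; rewrite -ltnS; apply: leq_trans Xm; rewrite ltnS ltn_neqAle dimvS ?subvf // andbT.
  apply: contra_notN h1 => /eqP e; have /limg_fullP hS : limg (mfun h) = fullv.
    by apply/eqP; rewrite eqEdim subvf e leqnn.
  apply/morP => x; rewrite id_lfunE; have [y <-] := hS x.
  by have /morP/(_ y) := hh; rewrite comp_lfunE.
have [U [s [r [rs sr dU]]]] := split_idem gg.
have gg' : (idm X - g) ∘ (idm X - g) = idm X - g.
  by rewrite compDl compNl comp1m compDr compNr gg compm1 subrr subr0.
have [V [s' [r' [rs' sr' dV]]]] := split_idem gg'.
apply: Qi (split_biprod rs sr rs' sr') _; apply: QD; apply: IH.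
  by rewrite dU; apply: small.
rewrite dV; apply: small => // e; apply: g0.
by have := congr1 (fun h => idm X - h) e; rewrite subrr subKr.
Qed.

Definition rmod : cat := Cat mod_enough_proj mod_enough_inj mod_indec_ind.

End ModuleCategory.

(** * Resolutions compute the same vanishing and dimensions *)
Section Resolutions.
Variables (K : fieldType) (A : falgType K).
Implicit Types M N X Y Z W : rmodule A.
Notation modA := (rmod A).

Lemma ses_lift M N X (i : rmor M N) (p : rmor N X) W (h : rmor W N) :
  @ses modA M N X i p -> (forall x, h x \in lker p) ->
  exists k : rmor W M, forall x, i (k x) = h x.
Proof.
case=> _ _ kerp _ hp; have [|k /morP ik] := kerp W h.
  by apply/morP => x; rewrite /= comp_lfunE zero_lfunE; apply/eqP; rewrite -memv_ker.
by exists k => x; have := ik x; rewrite comp_lfunE.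
Qed.

Lemma ses_colift M N X (i : rmor M N) (p : rmor N X) W (h : rmor N W) :
  @ses modA M N X i p -> (forall x, h (i x) = 0) ->
  exists k : rmor X W, forall x, k (p x) = h x.
Proof.
case=> _ _ _ cokp hp; have [|k /morP ik] := cokp W h.
  by apply/morP => x; rewrite /= comp_lfunE zero_lfunE.
by exists k => x; have := ik x; rewrite comp_lfunE.
Qed.

Lemma ses_factor M N X (i : rmor M N) (p : rmor N X) W (h : 'Hom(W, N)) :
  @ses modA M N X i p -> rhom h -> limg h = lker p ->
  exists2 k : rmor W M, (i \o k)%VF = h & limg k = fullv.
Proof.
move=> ip Hh hp; have [iM pE ex] := iffLR (sesP _ _) ip.
have [|k ik] := ses_lift (h := mkmor Hh) ip.
  by move=> x; rewrite -hp memv_img ?memvf.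
have ikE : (i \o k)%VF = h by apply/lfunP => x; rewrite comp_lfunE ik.
exists k => //; apply/limg_fullP => y.
have : i y \in limg h by rewrite hp ex memv_img ?memvf.
rewrite -ikE => /memv_imgP[z _]; rewrite comp_lfunE => /(iffLR (lker_injP _) iM) ->.
by exists z.
Qed.

Lemma ses_cofactor M N X (i : rmor M N) (p : rmor N X) W (h : 'Hom(N, W)) :
  @ses modA M N X i p -> rhom h -> lker h = limg i ->
  exists2 k : rmor X W, (k \o p)%VF = h & lker k = 0%VS.
Proof.
move=> ip Hh hp; have [iM pE ex] := iffLR (sesP _ _) ip.
have [|k kp] := ses_colift (h := mkmor Hh) ip.
  by move=> x; apply/eqP; rewrite -memv_ker hp memv_img ?memvf.
have kpE : (k \o p)%VF = h by apply/lfunP => x; rewrite comp_lfunE kp.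
exists k => //; apply/eqP; rewrite -subv0; apply/subvP => y.
have [x <-] := iffLR (limg_fullP _) pE y.
rewrite memv_ker -comp_lfunE kpE -memv_ker hp -ex memv_ker => /eqP->.
exact: mem0v.
Qed.

Definition res_vanish X (P : proj_resolution X) Y i :=
  forall f : 'Hom(P i, Y), cocycle f -> coboundary f.

Section Shift.
Variables (X : rmodule A) (P : proj_resolution X).

Definition res_aug : rmor (P 0%N) X := mkmor (@pr_aug_rhom _ _ _ P).

Lemma res_ses : @ses modA _ _ _ (ker_incl res_aug) res_aug.
Proof. exact/ker_ses/pr_aug_epi. Qed.

(** Truncating a resolution resolves the first syzygy and lowers the degree of
    the cohomology by one. *)
Lemma pr_shift : exists P' : proj_resolution (ker res_aug),
  (forall Y, (res_vanish P Y 1 <-> forall h : rmor (ker res_aug) Y,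
     exists h' : rmor (P 0%N) Y, rcomp h' (ker_incl res_aug) = h)) /\
  forall Y k, res_vanish P Y k.+2 <-> res_vanish P' Y k.+1.
Proof.
have [||k ik kE] := ses_factor (h := pr_d P 0) res_ses; first exact: pr_d_rhom.
  by rewrite (pr_exact0 P).
have kerk : lker k = limg (pr_d P 1).
  rewrite -(pr_exact P) -ik; apply/vspaceP => x; rewrite !memv_ker comp_lfunE.
  apply/eqP/eqP => [->|e]; first by rewrite linear0.
  have [iM _ _] := iffLR (sesP _ _) res_ses.
  by apply: (iffLR (lker_injP _) iM); rewrite linear0.
exists (@ProjResolution K A (ker res_aug) (fun i => P i.+1) (fun i => pr_d P i.+1)
  k (fun i => @pr_projective K A X P i.+1) (fun i => @pr_d_rhom K A X P i.+1)
  (mor_rhom k) kE kerk (fun i => pr_exact P i.+1)).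
split=> // Y; split=> [H h | H f [Hf fd]].
  have hk : rhom (h \o k)%VF by apply: rhom_comp; apply: mor_rhom.
  have [|g Hg e] := H (h \o k)%VF.
    split=> //; apply/lfunP => x; rewrite !comp_lfunE zero_lfunE.
    have : pr_d P 1 x \in lker k by rewrite kerk memv_img ?memvf.
    by rewrite memv_ker => /eqP->; rewrite linear0.
  exists (mkmor Hg); apply/morP => y; have [x <-] := iffLR (limg_fullP _) kE y.
  by have /lfunP/(_ x) := e; rewrite -ik !comp_lfunE.
have kses : @ses modA _ _ _ (ker_incl k) k by apply: ker_ses.
have [|h hk] := ses_colift (h := mkmor Hf) kses.
  move=> x; have : ker_incl k x \in lker k by rewrite lfunE /= subvsP.
  rewrite kerk => /memv_imgP[y _ ->].
  by have /lfunP/(_ y) := fd; rewrite comp_lfunE zero_lfunE.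
have [h' /morP h'h] := H h; exists (mfun h'); first exact: mor_rhom.
apply/lfunP => x; have /= <- := hk x.
by rewrite -h'h -ik !comp_lfunE.
Qed.

End Shift.

Lemma res_vanishP X (P : proj_resolution X) Y k :
  res_vanish P Y k.+1 <-> @vext modA k X Y.
Proof.
elim: k X P => [|k IH] X P; have [P' [P1 PS]] := pr_shift P;
  have Pp : @proj modA (P 0%N) by apply/projP; apply: pr_projective.
  by rewrite P1 (vext0_proj _ (res_ses P) Pp).
by rewrite PS IH (vextS_proj _ _ (res_ses P) Pp).
Qed.

(** The resolution by the free covers of the iterated syzygies. *)
Section Canonical.
Variable X : rmodule A.
Let Om i := iter i (@syzygy K A) X.
Let d i : rmor (cover (Om i.+1)) (cover (Om i)) :=
  rcomp (ker_incl (cover_map (Om i))) (cover_map (Om i.+1)).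

Let d_img i : lker (cover_map (Om i)) = limg (d i).
Proof.
have [_ _ ->] := iffLR (sesP _ _) (ker_ses (cover_epi (Om i))).
by rewrite /d /rcomp mkmorE limg_comp cover_epi.
Qed.

Let d_ker i : lker (d i) = limg (d i.+1).
Proof.
rewrite -d_img; apply/vspaceP => x; rewrite !memv_ker comp_lfunE.
apply/eqP/eqP => [e|->]; last by rewrite linear0.
have [iM _ _] := iffLR (sesP _ _) (ker_ses (cover_epi (Om i))).
by apply: (iffLR (lker_injP _) iM); rewrite linear0.
Qed.

Lemma proj_resolution_exists : exists P : proj_resolution X, True.
Proof.
by exists (@ProjResolution K A X (fun i => cover (Om i)) d (cover_map X)
  (fun i => iffLR (projP _) (@free_proj K A _)) (fun i => mor_rhom (d i))
  (mor_rhom _) (cover_epi X) (d_img 0) d_ker).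
Qed.
End Canonical.

Lemma Ext_zeroP X Y k : Ext_zero k.+1 X Y <-> @vext modA k X Y.
Proof.
split=> [H|/res_vanishP H P f]; last exact: H.
have [P _] := proj_resolution_exists X.
by apply/(res_vanishP P) => f; apply: H.
Qed.

Lemma zero_mor M N (f : 'Hom(M, N)) : zero_rmodule M -> f = 0.
Proof.
move=> M0; apply/lfunP => x; have := memvf x; rewrite M0 memv0 => /eqP->.
by rewrite linear0 zero_lfunE.
Qed.

Fact zero_rhom M N : rhom (0 : 'Hom(M, N)).
Proof. by move=> x a; rewrite !zero_lfunE act0l. Qed.

(** Splice a resolution of a syzygy. *)
Lemma pr_cons X Q Z (i : rmor Z Q) (p : rmor Q X) (R : proj_resolution Z) d :
  @ses modA _ _ _ i p -> @proj modA Q ->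
  (forall j, (d <= j)%N -> zero_rmodule (R j)) -> pd_le X d.
Proof.
move=> ip Qp R0; have [iM pE ex] := iffLR (sesP _ _) ip.
pose ob j := if j is j'.+1 then R j' else Q.
pose dd j : 'Hom(ob j.+1, ob j) :=
  if j is j'.+1 return 'Hom(ob j.+1, ob j) then pr_d R j' else (i \o pr_aug R)%VF.
have Hp j : projective_rmodule (ob j).
  by case: j => [|j]; [apply/projP | apply: pr_projective].
have Hd j : rhom (dd j).
  case: j => [|j]; last exact: pr_d_rhom.
  by apply: rhom_comp; [apply: mor_rhom | apply: pr_aug_rhom].
have e0 : lker p = limg (dd 0%N) by rewrite ex limg_comp pr_aug_epi.
have eS j : lker (dd j) = limg (dd j.+1).
  case: j => [|j]; last exact: pr_exact.
  rewrite /= -(pr_exact0 R); apply/vspaceP => x; rewrite !memv_ker comp_lfunE.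
  apply/eqP/eqP => [e|->]; last by rewrite linear0.
  by apply: (iffLR (lker_injP _) iM); rewrite linear0.
exists (@ProjResolution K A X ob dd p Hp Hd (mor_rhom p) pE e0 eS).
by case=> // j /R0.
Qed.

Lemma free0_zero : zero_rmodule (free_mod A 0).
Proof.
apply/eqP; rewrite -subv0; apply/subvP => x _; rewrite memv0.
by apply/eqP/ffunP; case.
Qed.

Lemma zero_vspace M (U V : {vspace M}) : zero_rmodule M -> U = V.
Proof.
move=> M0; apply/vspaceP => x.
by have := memvf x; rewrite M0 memv0 => /eqP->; rewrite !mem0v.
Qed.

Lemma zero_proj M : zero_rmodule M -> @proj modA M.
Proof.
move=> M0; apply: proj_lift => X Y p h _; exists 0 => x.
by rewrite (zero_mor h M0) !zero_lfunE linear0.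
Qed.

Lemma zero_inj M : zero_rmodule M -> @inj modA M.
Proof.
move=> M0; apply: inj_extend => X Y p h _; exists 0 => x; apply/eqP.
by rewrite -subr_eq0 -memv0 -M0 memvf.
Qed.

(** From right to left, splice presentations until the syzygy is projective; the
    extra step [e = 0] lets the resolution end with zero modules. *)
Lemma pd_leP X d : pd_le X d <-> forall Y, @vext modA d X Y.
Proof.
split=> [[P P0] Y | ].
  apply/(res_vanishP P) => f _; exists 0; first exact: zero_rhom.
  by rewrite (zero_mor f) ?comp_lfun0l //; apply: P0.
suff H e Z : (if e is e'.+1 then forall Y, @vext modA e' Z Y else zero_rmodule Z) ->
    exists P : proj_resolution Z, forall i, (e <= i)%N -> zero_rmodule (P i).
  by move=> /(H d.+1).
elim: e Z => [|e IH] Z; last first.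
  move=> HZ; have [S [Q [i [p [ip Qp]]]]] :
      exists (S Q : modA) (i : mor S Q) (p : mor Q Z), [/\ ses i p, proj Q &
        if e is e'.+1 then forall Y, @vext modA e' S Y else zero_rmodule S].
    case: e HZ {IH} => [HZ|e HZ].
      have Zp : @proj modA Z by apply: vext0_projP.
      pose z : rmor (free_mod A 0) Z := 0.
      exists (free_mod A 0), Z, z, (rid Z); split=> //; last exact: free0_zero.
      apply/sesP; split.
      - exact: zero_vspace free0_zero.
      - by apply/limg_fullP => x; exists x; rewrite mkmorE id_lfunE.
      - apply/vspaceP => x; rewrite memv_ker mkmorE id_lfunE.
        apply/eqP/memv_imgP => [->|[y _ ->]]; last by rewrite zero_lfunE.
        by exists 0; rewrite ?mem0v // linear0.
    have [S [Q [i [p [ip Qp]]]]] := @enough_proj modA Z.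
    by exists S, Q, i, p; split=> // Y; apply/(vextS_proj _ _ ip Qp).
  case/IH => R R0.
  by have [P HP] := pr_cons ip Qp R0; exists P.
move=> Z0; pose ZP (_ : nat) := iffLR (projP _) (zero_proj Z0).
pose R := @ProjResolution K A Z (fun=> Z) (fun=> 0) 0 ZP
  (fun=> @zero_rhom Z Z) (@zero_rhom Z Z) (zero_vspace _ _ Z0)
  (zero_vspace _ _ Z0) (fun=> zero_vspace _ _ Z0).
by exists R.
Qed.

Section Coshift.
Variables (X : rmodule A) (I : inj_resolution X).

(** The dual of truncation. *)
Lemma ir_shift : exists (C : rmodule A) (q : rmor (I 0%N) C) (I' : inj_resolution C),
  @ses modA _ _ _ (mkmor (@ir_aug_rhom _ _ _ I)) q /\ forall i, I' i = I i.+1.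
Proof.
pose j : rmor X (I 0%N) := mkmor (@ir_aug_rhom _ _ _ I).
have [V [q0 [qS qK]]] := quotient_exists (limg j).
have HU : submodule (M := I 0%N) (lker q0) by rewrite qK; apply: limg_submodule.
pose q := quomod_proj qS HU.
have jq : @ses modA _ _ _ j q by apply/sesP; split=> //; apply: ir_aug_mono.
have [||k kq kI] := ses_cofactor (h := ir_d I 0) jq; first exact: ir_d_rhom.
  by rewrite (ir_exact0 I).
have kimg : lker (ir_d I 1) = limg k by rewrite (ir_exact I) -kq limg_comp qS.
exists (quomod qS HU), q, (@InjResolution K A _ (fun i => I i.+1) (fun i => ir_d I i.+1)
  k (fun i => @ir_injective K A X I i.+1) (fun i => @ir_d_rhom K A X I i.+1)
  (mor_rhom k) kI kimg (fun i => ir_exact I i.+1)).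
by [].
Qed.

End Coshift.

Lemma ir_cons X J Z (j : rmor X J) (q : rmor J Z) (R : inj_resolution Z) d :
  @ses modA _ _ _ j q -> @inj modA J ->
  (forall i, (d <= i)%N -> zero_rmodule (R i)) -> id_le X d.
Proof.
move=> jq Ji R0; have [jM qE ex] := iffLR (sesP _ _) jq.
pose ob i := if i is i'.+1 then R i' else J.
pose dd i : 'Hom(ob i, ob i.+1) :=
  if i is i'.+1 return 'Hom(ob i, ob i.+1) then ir_d R i' else (ir_aug R \o q)%VF.
have Hp i : injective_rmodule (ob i).
  by case: i => [|i]; [apply/injP | apply: ir_injective].
have Hd i : rhom (dd i).
  case: i => [|i]; last exact: ir_d_rhom.
  by apply: rhom_comp; [apply: ir_aug_rhom | apply: mor_rhom].
have e0 : lker (dd 0%N) = limg j.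
  rewrite -ex /=; apply/vspaceP => x; rewrite !memv_ker comp_lfunE.
  apply/eqP/eqP => [e|->]; last by rewrite linear0.
  by apply: (iffLR (lker_injP _) (ir_aug_mono R)); rewrite linear0.
have eS i : lker (dd i.+1) = limg (dd i).
  case: i => [|i]; last exact: ir_exact.
  by rewrite /= limg_comp qE (ir_exact0 R).
exists (@InjResolution K A X ob dd j Hp Hd (mor_rhom j) jM e0 eS).
by case=> // i /R0.
Qed.

Lemma id_leP X d : id_le X d <-> forall Y, @vext modA d Y X.
Proof.
split=> [[I I0] Y | ].
  elim: d X I I0 => [|d IH] X I I0; have [C [q [I' [jq I'E]]]] := ir_shift I;
    have Ii : @inj modA (I 0%N) by apply/injP; apply: ir_injective.
    apply/(vext0_inj _ jq Ii) => h; exists 0.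
    have C0 : zero_rmodule C.
      have := I0 1%N isT; rewrite -I'E => Z0.
      apply/eqP; rewrite -subv0; apply/subvP => x _.
      rewrite memv0; apply/eqP; apply: (iffLR (lker_injP _) (ir_aug_mono I')).
      by rewrite linear0; apply/eqP; rewrite -memv0 -Z0 memvf.
    apply/morP => x; rewrite /= comp_lfunE; symmetry; apply/eqP.
    by rewrite !zero_lfunE linear0 -memv0 -C0 memvf.
  apply/(vextS_inj _ _ jq Ii); apply: (IH C I') => i di.
  by rewrite I'E; apply: I0.
suff H e Z : (if e is e'.+1 then forall Y, @vext modA e' Y Z else zero_rmodule Z) ->
    exists I : inj_resolution Z, forall i, (e <= i)%N -> zero_rmodule (I i).
  by move=> /(H d.+1).
elim: e Z => [|e IH] Z; last first.
  move=> HZ; have [Q [S [j [q [jq Qi]]]]] :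
      exists (Q S : modA) (j : mor (Z : modA) Q) (q : mor Q S), [/\ ses j q, inj Q &
        if e is e'.+1 then forall Y, @vext modA e' Y S else zero_rmodule S].
    case: e HZ {IH} => [HZ|e HZ].
      have Zi : @inj modA Z by apply: vext0_injP.
      pose z : rmor Z (free_mod A 0) := 0.
      exists Z, (free_mod A 0), (rid Z), z; split=> //; last exact: free0_zero.
      apply/sesP; split.
      - by apply/lker_injP => x y; rewrite mkmorE !id_lfunE.
      - exact: zero_vspace free0_zero.
      - apply/vspaceP => x; rewrite memv_ker zero_lfunE eqxx.
        by symmetry; apply/memv_imgP; exists x; rewrite ?memvf // mkmorE id_lfunE.
    have [Q [S [j [q [jq Qi]]]]] := @enough_inj modA Z.
    by exists Q, S, j, q; split=> // Y; apply/(vextS_inj _ _ jq Qi).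
  case/IH => R R0.
  by have [P HP] := ir_cons jq Qi R0; exists P.
move=> Z0; pose ZP (_ : nat) := iffLR (injP _) (zero_inj Z0).
pose R := @InjResolution K A Z (fun=> Z) (fun=> 0) 0 ZP
  (fun=> @zero_rhom Z Z) (@zero_rhom Z Z) (zero_vspace _ _ Z0)
  (zero_vspace _ _ Z0) (fun=> zero_vspace _ _ Z0).
by exists R.
Qed.

Lemma ctP n (c : rmodule A -> Prop) : cluster_tilting n c <-> @ct modA n c.
Proof.
have E X Y : (forall i, (0 < i < n)%N -> Ext_zero i X Y) <->
    (forall k, (k.+1 < n)%N -> @vext modA k X Y).
  split=> H; first by move=> k kn; apply/Ext_zeroP; apply: H.
  by case=> // i i_n; apply/Ext_zeroP; apply: H.
split=> -[ci cb cl cr]; split=> //.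
- by move=> X Y /isoP; apply: ci.
- by move=> X; rewrite cl; split=> H Y cY; apply/E; apply: H.
- by move=> X; rewrite cr; split=> H Y cY; apply/E; apply: H.
- by move=> X Y XY; apply: ci; apply/isoP.
- by move=> X; rewrite cl; split=> H Y cY; apply/E; apply: H.
- by move=> X; rewrite cr; split=> H Y cY; apply/E; apply: H.
Qed.

Lemma directedP : representation_directed A <-> directed modA.
Proof.
split=> H [t [M [t0 iM fM M0t]]]; apply: H; exists t, M; split=> //.
- by move=> i /iM /indec_rmoduleP.
- move=> i /fM[f [f0 fi]]; exists (mfun f); split; first exact: mor_rhom.
    by apply: contra_not_neq f0 => f0; apply/morP => x; rewrite f0.
  by move=> /isomP.
- exact/isoP.
- by move=> i /iM ?; apply/indec_rmoduleP.
- move=> i /fM[f [Hf f0 fi]]; exists (mkmor Hf); split; last by move/isomP.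
  move=> /morP e; case/eqP: f0; apply/lfunP => x; exact: e.
- exact/isoP.
Qed.

Lemma gldimP d : gldim A d <->
  least (fun m => forall X Y, @vext modA m X Y) d.
Proof.
split=> -[H1 H2]; split=> [X|m Hm].
- exact/pd_leP/H1.
- by apply: H2 => X; apply/pd_leP/Hm.
- exact/pd_leP/H1.
- by apply: H2 => X; apply/pd_leP/Hm.
Qed.

Lemma injdimP X d : injdim X d <-> least (fun m => forall Y, @vext modA m Y X) d.
Proof.
split=> -[/id_leP H1 H2]; split=> // m; first by move/id_leP; apply: H2.
by move=> /id_leP; apply: H2.
Qed.

Lemma projdimP X d : projdim X d <-> least (fun m => forall Y, @vext modA m X Y) d.
Proof.
split=> -[/pd_leP H1 H2]; split=> // m; first by move/pd_leP; apply: H2.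
by move=> /pd_leP; apply: H2.
Qed.

End Resolutions.

(** * Restriction of scalars, and the modules of the linear quiver *)
Record algmor (K : fieldType) (A B : falgType K) := AlgMor {
  afun :> A -> B;
  afun_linear : linear afun;
  afun1 : afun 1 = 1;
  afunM : forall a b, afun (a * b) = afun a * afun b }.

Lemma afun0 (K : fieldType) (A B : falgType K) (f : algmor A B) : f 0 = 0.
Proof. by rewrite -[0 in LHS](subrr 0) -scaleN1r addrC afun_linear scaleN1r addNr. Qed.

Lemma afunD (K : fieldType) (A B : falgType K) (f : algmor A B) : {morph f : x y / x + y}.
Proof. by move=> x y; rewrite -[x]scale1r afun_linear !scale1r. Qed.

Lemma afunZ (K : fieldType) (A B : falgType K) (f : algmor A B) (k : K) x :
  f (k *: x) = k *: f x.
Proof. by rewrite -[k *: x]addr0 afun_linear afun0 addr0. Qed.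

Definition acomp (K : fieldType) (A B C : falgType K) (g : algmor B C) (f : algmor A B) :
  algmor A C.
Proof.
refine (@AlgMor K A C (g \o f) _ _ _).
- by move=> k x y; rewrite /= !afun_linear.
- by rewrite /= !afun1.
- by move=> x y; rewrite /= !afunM.
Defined.

Lemma afun_sum (K : fieldType) (A B : falgType K) (f : algmor A B) I (r : seq I)
    (P : pred I) (F : I -> A) :
  f (\sum_(i <- r | P i) F i) = \sum_(i <- r | P i) f (F i).
Proof.
rewrite -(mklinE (@afun_linear _ _ _ f)) linear_sum.
by apply: eq_bigr => i _; apply: mklinE.
Qed.

(** Restriction along a surjection is a full exact embedding. *)
Section Restriction.
Variables (K : fieldType) (A B : falgType K) (phi : algmor B A).

Section Object.
Variable M : rmodule A.
Definition res_act (x : M) (b : B) : M := rm_act x (phi b).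
Fact res_act_linearl b : linear (res_act^~ b).
Proof. exact: rm_act_linearl. Qed.
Fact res_act_linearr x : linear (res_act x).
Proof. by move=> c a b; rewrite /res_act afun_linear linearP. Qed.
Fact res_act1 x : res_act x 1 = x.
Proof. by rewrite /res_act afun1 rm_act1. Qed.
Fact res_actM x a b : res_act x (a * b) = res_act (res_act x a) b.
Proof. by rewrite /res_act afunM rm_actM. Qed.
Definition restr := RModule res_act_linearl res_act_linearr res_act1 res_actM.
End Object.

Fact res_rhom (M N : rmodule A) (f : rmor M N) : rhom (mfun f : 'Hom(restr M, restr N)).
Proof. by move=> x a; rewrite /= /res_act mor_act. Qed.
Definition res_mor (M N : rmodule A) (f : rmor M N) : rmor (restr M) (restr N) :=
  mkmor (@res_rhom M N f).

Hypothesis phi_surj : forall a, exists b, phi b = a.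

Definition infl : ffunctor (rmod A) (rmod B).
Proof.
refine (@FFunctor (rmod A) (rmod B) restr (fun X Y f => res_mor f) _ _ _ _ _ _).
- by move=> X; apply/morP.
- by move=> X Y Z g f; apply/morP.
- by move=> X Y f; split=> /morP e; apply/morP => x; have := e x; rewrite !zero_lfunE.
- by move=> X Y f g /morP e; apply/morP => x; apply: e.
- move=> X Y h0; set h : rmor (restr X) (restr Y) := h0.
  have hR : rhom (mfun h : 'Hom(rm_sort X, rm_sort Y)).
    by move=> x a; have [b <-] := phi_surj a; apply: (mor_act h).
  by exists (mkmor hR); apply/morP.
- by move=> X Y Z i p /sesP ip; apply/sesP.
Defined.

End Restriction.

(** Let [A] be both a quotient and, through [s], a subalgebra of [B]. The element
    [c] commutes with [A], is sent to 1 and, in each of the two lemmas, kills the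
    kernel of [rho] on one side; in a gluing it is the complement of the attached
    vertices. *)
Section Retract.
Variables (K : fieldType) (A B : falgType K) (rho : algmor B A) (s : algmor A B) (c : B).
Hypothesis rhoK : forall a, rho (s a) = a.
Hypothesis rho_kappa : rho c = 1.
Hypothesis s_kappa : forall a, s a * c = c * s a.

Lemma retract_surj a : exists b, rho b = a.
Proof. by exists (s a). Qed.

(** An [A]-linear extension [k] of a map becomes [B]-linear after precomposition
    with the action of [c]: this kills what the kernel of [rho] moves, and does
    not affect the original map since [rho c = 1]. *)
Lemma restr_inj : (forall b, b * c = s (rho b) * c) ->
  forall I : rmod A, inj I -> inj (infl retract_surj I).
Proof.
move=> bc I /injP Ii; apply: inj_extend => X Y i h iM.
have hR : rhom (mfun h : 'Hom(restr s X, I)).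
  by move=> x a; rewrite /= /res_act (mor_act h) /= /res_act rhoK.
have [k Hk ki] := Ii _ _ (mfun (res_mor s i)) _ (mor_rhom _) iM hR.
have kR : rhom (k \o linfun (ract c) : 'Hom(Y, restr rho I))%VF.
  move=> y b; rewrite !comp_lfunE !lfunE /= /ract /res_act -rm_actM bc s_kappa rm_actM.
  exact: Hk.
exists (mkmor kR) => x; rewrite mkmorE comp_lfunE lfunE /= /ract -mor_act.
have /lfunP/(_ (rm_act x c)) := ki; rewrite comp_lfunE /= => ->.
apply: etrans (mor_act h x c) _.
by rewrite /= /res_act rho_kappa rm_act1.
Qed.

(** Dually, correct an [A]-linear lift by applying [c] to its values. *)
Lemma restr_proj : (forall b, c * b = c * s (rho b)) ->
  forall P : rmod A, proj P -> proj (infl retract_surj P).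
Proof.
move=> bc P /projP Pp; apply: proj_lift => X Y p h pE.
have hR : rhom (mfun h : 'Hom(P, restr s Y)).
  move=> x a; rewrite /= /res_act -(mor_act h) /= /res_act rhoK //.
have [k Hk pk] := Pp _ _ (mfun (res_mor s p)) _ (mor_rhom _) pE hR.
have kR : rhom (linfun (ract c) \o k : 'Hom(restr rho P, X))%VF.
  move=> y b; rewrite !comp_lfunE !lfunE /= /ract /res_act -rm_actM bc -s_kappa rm_actM.
  by rewrite Hk.
exists (mkmor kR) => x; rewrite mkmorE comp_lfunE lfunE /= /ract mor_act.
have /lfunP/(_ x) := pk; rewrite comp_lfunE /= => ->.
apply: etrans (esym (mor_act h x c)) _.
by rewrite /= /res_act rho_kappa rm_act1.
Qed.

End Retract.

(** The one-dimensional module of a character. *)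
Section Simple.
Variables (K : fieldType) (A : falgType K) (chi : algmor A K^o).

Definition char_mod_act (x : K^o) (a : A) : K^o := x * chi a.
Fact char_mod_act_linearl a : linear (char_mod_act^~ a).
Proof. by move=> c v w; rewrite /char_mod_act mulrDl scalerAl. Qed.
Fact char_mod_act_linearr x : linear (char_mod_act x).
Proof. by move=> c a b; rewrite /char_mod_act afun_linear mulrDr scalerAr. Qed.
Fact char_mod_act1 x : char_mod_act x 1 = x.
Proof. by rewrite /char_mod_act afun1 mulr1. Qed.
Fact char_mod_actM x a b : char_mod_act x (a * b) = char_mod_act (char_mod_act x a) b.
Proof. by rewrite /char_mod_act afunM mulrA. Qed.
Definition char_mod := RModule char_mod_act_linearl char_mod_act_linearr char_mod_act1 char_mod_actM.

Lemma char_mod_gen M (f : rmor char_mod M) (x : char_mod) : f x = (x : K) *: f 1.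
Proof. by rewrite -linearZ /= -[in LHS](mulr1 x). Qed.

Lemma char_mod_map_exists (M : rmodule A) (x : M) :
  (forall a, rm_act x a = (chi a : K) *: x) ->
  exists f : rmor char_mod M, forall t : char_mod, f t = (t : K) *: x.
Proof.
move=> xa; have L : linear (fun t : char_mod => (t : K) *: x).
  by move=> c t u; rewrite scalerDl scalerA.
have R : rhom (mklin L) by move=> t a; rewrite !mklinE actZl xa scalerA.
by exists (mkmor R) => t; rewrite mkmorE mklinE.
Qed.

Lemma char_mod_comap_exists (M : rmodule A) (u : 'Hom(M, K^o)) :
  (forall x a, u (rm_act x a) = chi a * u x) ->
  exists f : rmor M char_mod, forall x, f x = u x.
Proof.
move=> ua; have R : rhom (u : 'Hom(M, char_mod)) by move=> x a; rewrite /= ua mulrC.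
by exists (mkmor R).
Qed.

(** Under the hypotheses the right ideal of [E] is this module, generated by an
    idempotent. *)
Lemma char_mod_proj E : chi E = 1 -> (forall a, E * a = (chi a : K) *: E) ->
  @proj (rmod A) char_mod.
Proof.
move=> chiE Ea; apply: proj_lift => X Y p h pE.
have [x px] := iffLR (limg_fullP _) pE (h 1).
have [|k kE] := @char_mod_map_exists X (rm_act x E).
  by move=> a; rewrite -rm_actM Ea linearZ.
exists k => t; rewrite kE linearZ /= mor_act px -mor_act [RHS]char_mod_gen.
by rewrite /= /char_mod_act chiE mulr1.
Qed.

(** Under the hypotheses the left ideal of [E] is one-dimensional, and the module
    is its dual. *)
Lemma char_mod_inj E : chi E = 1 -> (forall a, a * E = (chi a : K) *: E) ->
  @inj (rmod A) char_mod.
Proof.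
move=> chiE Ea; apply: inj_extend => X Y i h iM.
have [|k kE] := @char_mod_comap_exists Y (h \o i^-1 \o linfun (ract E))%VF.
  move=> y a; rewrite !comp_lfunE !lfunE /= /ract -rm_actM Ea linearZ /=.
  by rewrite !linearZ.
exists k => x; rewrite kE !comp_lfunE lfunE /= /ract -mor_act lker0_lfunK ?iM //.
apply: etrans (mor_act h x E) _.
by rewrite /= /char_mod_act chiE mulr1.
Qed.

Lemma char_mod_simple : simple_rmodule char_mod.
Proof.
have d1 : \dim {:K^o} = 1 by rewrite dimvf.
split=> [z|U _]; first by move: d1; rewrite (z : _ = _) dimv0.
have := dimvS (subvf U); rewrite d1 leq_eqVlt ltnS leqn0 => /orP[dU|]; last first.
  by rewrite dimv_eq0 => /eqP; left.
by right; apply/eqP; rewrite eqEdim subvf d1 (eqP dU).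
Qed.

Lemma char_mod_isom_mor (f : rmor char_mod char_mod) : f <> 0 -> @isom (rmod A) _ _ f.
Proof.
move=> f0; have f1 : (f 1 : K) != 0.
  by apply: contra_not_neq f0 => f1; apply/morP => x; rewrite char_mod_gen f1 scaler0 zero_lfunE.
have [|g gE] := @char_mod_map_exists char_mod ((f 1 : K)^-1 : char_mod).
  by move=> a; rewrite /= /char_mod_act mulrC.
have gE' (t : K) : g t = t / (f 1 : K) by apply: gE.
have fE (t : K) : f t = t * (f 1 : K) by apply: char_mod_gen.
exists g; split; apply/morP => x; rewrite /= comp_lfunE id_lfunE.
  by apply: etrans (congr1 _ (fE x)) _; apply: etrans (gE' _) _; apply: mulfK.
by apply: etrans (congr1 _ (gE' x)) _; apply: etrans (fE _) _; apply: mulfVK.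
Qed.

Lemma char_mod_epi (M : rmodule A) (f : rmor M char_mod) : f <> 0 -> limg f = fullv.
Proof.
move=> f0; have [_ /(_ (limg f) (limg_submodule (f := f)))[e|//]] := char_mod_simple.
case: f0; apply/morP => x; rewrite zero_lfunE; apply/eqP.
by rewrite -memv0 -e memv_img ?memvf.
Qed.

Lemma char_mod_mono (M : rmodule A) (f : rmor char_mod M) : f <> 0 -> lker f = 0%VS.
Proof.
move=> f0; have [_ /(_ (lker f) (lker_submodule (f := f)))[//|e]] := char_mod_simple.
case: f0; apply/morP => x; rewrite zero_lfunE; apply/eqP.
by rewrite -memv_ker e memvf.
Qed.

End Simple.

(** The two-dimensional module with top [c] and socle [c'] joined by an arrow
    [al] from the vertex idempotent [E] to [E']. The hypotheses say that [E] and
    [al] span the right ideal of [E], and that [E'] and [al] span the left ideal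
    of [E']; hence the module is both the projective at [E] and the injective
    at [E']. *)
Section Arrow.
Variables (K : fieldType) (A : falgType K) (c c' : algmor A K^o) (a : A -> K^o).
Variables (E E' al : A).
Record is_arrow : Prop := IsArrow {
  arrow_linear : linear a;
  arrowM : forall x y, a (x * y) = c x * a y + a x * c' y;
  arrow_EE : [/\ c E = 1, a E = 0, c' E' = 1, a E' = 0 & c E' = 0];
  arrow_al : [/\ c al = 0, a al = 1 & c' al = 0];
  arrow_E_l : forall x, E * x = (c x : K) *: E + (a x : K) *: al;
  arrow_al_l : forall x, al * x = (c' x : K) *: al;
  arrow_E_r : forall x, x * E' = (c' x : K) *: E' + (a x : K) *: al;
  arrow_al_r : forall x, x * al = (c x : K) *: al }.

Hypothesis arr : is_arrow.

Definition arrow_mod_act (v : K^o * K^o) x : K^o * K^o :=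
  (v.1 * c x, v.1 * a x + v.2 * c' x).
Fact arrow_mod_act_linearl x : linear (arrow_mod_act^~ x).
Proof.
move=> k v w; congr pair; rewrite /= -?[_ *: _]/(_ * _) ?mulrDl ?mulrA //.
by rewrite mulrDr addrACA !mulrA.
Qed.
Fact arrow_mod_act_linearr v : linear (arrow_mod_act v).
Proof.
move=> k x y; rewrite /arrow_mod_act !afun_linear (arrow_linear arr).
by congr pair; rewrite /= -?[_ *: _]/(_ * _); ring.
Qed.
Fact arrow_mod_act1 v : arrow_mod_act v 1 = v.
Proof.
have a1 : a 1 = 0.
  by apply: (addrI (a 1)); rewrite addr0 -{3}[1]mulr1 (arrowM arr) !afun1 mul1r mulr1.
by rewrite /arrow_mod_act !afun1 a1 mulr0 add0r !mulr1; case: v.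
Qed.
Fact arrow_mod_actM v x y : arrow_mod_act v (x * y) = arrow_mod_act (arrow_mod_act v x) y.
Proof.
by rewrite /arrow_mod_act !afunM (arrowM arr); congr pair; rewrite /=; ring.
Qed.
Definition arrow_mod := RModule arrow_mod_act_linearl arrow_mod_act_linearr arrow_mod_act1 arrow_mod_actM.

Lemma arrow_mod_e1al : rm_act ((1, 0) : arrow_mod) al = (0, 1).
Proof.
have [e1 e2 e3] := arrow_al arr.
by rewrite /= /arrow_mod_act /= e1 e2 e3 mulr0 mul0r mul1r addr0.
Qed.

Lemma arrow_mod_map_exists (M : rmodule A) (x : M) : exists f : rmor arrow_mod M,
  forall v, f v = (v.1 : K) *: rm_act x E + (v.2 : K) *: rm_act x al.
Proof.
have L : linear (fun v : arrow_mod => (v.1 : K) *: rm_act x E + (v.2 : K) *: rm_act x al).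
  by move=> k v w; rewrite /= !scalerDl scalerDr !scalerA addrACA.
have R : rhom (mklin L).
  move=> v y; rewrite !mklinE actDl !actZl -!rm_actM (arrow_E_l arr) (arrow_al_l arr).
  rewrite linearD !linearZ /= scalerDr !scalerA scalerDl -addrA.
  by rewrite [c' y * _]mulrC.
by exists (mkmor R) => v; rewrite mkmorE mklinE.
Qed.

Lemma arrow_mod_proj : @proj (rmod A) arrow_mod.
Proof.
apply: proj_lift => X Y p h pE.
have [x px] := iffLR (limg_fullP _) pE (h (1, 0)).
have [k kE] := arrow_mod_map_exists x.
have vE (v : arrow_mod) : v = (v.1 : K) *: rm_act ((1, 0) : arrow_mod) E +
    (v.2 : K) *: rm_act ((1, 0) : arrow_mod) al.
  rewrite arrow_mod_e1al /= /arrow_mod_act /=; have [-> -> _ _ _] := arrow_EE arr.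
  case: v => v1 v2; congr pair; rewrite /= -?[_ *: _]/(_ * _); ring.
exists k => v; rewrite kE linearD !linearZ /= !mor_act px.
rewrite [in RHS](vE v) linearD !linearZ.
by congr (_ *: _ + _ *: _); exact: (esym (mor_act h (1, 0) _)).
Qed.

(** Maps into the dual of the left ideal of [E'] are linear forms; the two
    coordinates are the form at [al] and at [E']. *)
Lemma arrow_mod_comap_exists (M : rmodule A) (u : 'Hom(M, K^o)) : exists f : rmor M arrow_mod,
  forall x, f x = (u (rm_act x al), u (rm_act x E')).
Proof.
have L : linear (fun x => (u (rm_act x al), u (rm_act x E')) : arrow_mod).
  by move=> k x y; rewrite !actDl !actZl !linearP.
have R : rhom (mklin L).
  move=> x y; rewrite !mklinE -!rm_actM (arrow_E_r arr) (arrow_al_r arr).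
  rewrite linearD !linearZ /= linearD !linearZ /= /arrow_mod_act /=.
  by congr pair; rewrite -?[_ *: _]/(_ * _); ring.
by exists (mkmor R) => v; rewrite mkmorE mklinE.
Qed.

Fact snd_linear : linear (fun v : arrow_mod => v.2).
Proof. by []. Qed.

Lemma arrow_mod_inj : @inj (rmod A) arrow_mod.
Proof.
apply: inj_extend => X Y i h iM.
have [k kE] := arrow_mod_comap_exists (mklin snd_linear \o h \o i^-1)%VF.
exists k => x; rewrite kE -!mor_act !comp_lfunE !lker0_lfunK ?iM // !mor_act !mklinE.
have [_ _ e1 e2 e3] := arrow_EE arr; have [d1 d2 d3] := arrow_al arr.
case: (h x) => h1 h2; rewrite /= /arrow_mod_act /= e1 e2 d2 d3.
by congr pair; ring.
Qed.

Fact fst_linear : linear (fun v : arrow_mod => v.1).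
Proof. by []. Qed.

Lemma arrow_mod_ses : exists (u : rmor (char_mod c') arrow_mod) (v : rmor arrow_mod (char_mod c)),
  @ses (rmod A) _ _ _ u v /\ forall s : rmor (char_mod c) arrow_mod, rcomp v s <> rid _.
Proof.
have [|u uE] := @char_mod_map_exists _ _ c' arrow_mod (0, 1).
  by move=> x; rewrite /= /arrow_mod_act /=; congr pair;
      rewrite -?[_ *: _]/(_ * _); rewrite /=; ring.
have [|v vE] := @char_mod_comap_exists _ _ c arrow_mod (mklin fst_linear).
  by move=> x y; rewrite !mklinE /= mulrC.
exists u, v; split; last first.
  move=> s /morP e.
  have [e1 e2 e3] := arrow_al arr.
  have s1 : (s 1).1 = 1 by have := e 1; rewrite /= comp_lfunE id_lfunE vE mklinE.
  have : rm_act (s 1) al = 0.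
    by rewrite -mor_act /= /char_mod_act e1 mulr0 linear0.
  rewrite /= /arrow_mod_act s1 e2 e3 mulr0 mulr1 addr0 => -[_ /eqP].
  by rewrite oner_eq0.
apply/sesP; split.
- apply/lker_injP => x y; rewrite !uE => -[_].
  by rewrite -![_ *: _]/(_ * _) !mulr1.
- by apply/limg_fullP => x; exists (x, 0); rewrite vE mklinE.
- apply/vspaceP => x; rewrite memv_ker vE mklinE; apply/eqP/memv_imgP.
    move=> x0; exists x.2; rewrite ?memvf // uE.
    case: x x0 => x1 x2 /= ->; congr pair; rewrite /= -?[_ *: _]/(_ * _); ring.
  by case=> t _ ->; rewrite uE /= -[_ *: _]/(_ * _) mulr0.
Qed.

(** An element not killed by the arrow generates a copy of the injective
    module [arrow_mod], which splits off. *)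
Lemma arrow_mod_summand (M : rmodule A) (x : M) : @indec (rmod A) M ->
  rm_act x al != 0 -> @iso (rmod A) arrow_mod M.
Proof.
move=> [nz idp] xal; have [k kE] := arrow_mod_map_exists x.
have [c1 c2 c3] := arrow_al arr.
have Eal : E * al = al by rewrite (arrow_E_l arr) c1 c2 scale0r add0r scale1r.
have alal : al * al = 0 by rewrite (arrow_al_l arr) c3 scale0r.
have kI : lker k = 0%VS.
  apply/eqP; rewrite -subv0; apply/subvP => v; rewrite memv_ker kE => /eqP e.
  have v1 : v.1 = 0.
    have := congr1 (fun y => rm_act y al) e.
    rewrite act0l actDl !actZl -!rm_actM Eal alal linear0 scaler0 addr0 => /eqP.
    by rewrite scaler_eq0 (negPf xal) orbF => /eqP.
  move: e; rewrite v1 scale0r add0r => /eqP; rewrite scaler_eq0 (negPf xal) orbF => /eqP.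
  by case: v v1 => v1 v2 /= -> ->; apply: mem0v.
have [r0] : exists r : mor (M : rmod A) arrow_mod, r ∘ (k : mor (arrow_mod : rmod A) M) = idm _.
  by apply: arrow_mod_inj; apply/mono_inj.
move=> rk; have [|e|e] := idp ((k : mor (arrow_mod : rmod A) M) ∘ r0).
- by rewrite -compA (compA r0) rk comp1m.
- case/eqP: xal; have k01 : k (0, 1) = rm_act x al.
    by rewrite kE /= scale0r add0r scale1r.
  have := congr1 (fun h => h ∘ (k : mor (arrow_mod : rmod A) M)) e.
  by rewrite -compA rk compm1 comp0m => /morP/(_ (0, 1)); rewrite k01 zero_lfunE.
by exists k, r0; split.
Qed.

End Arrow.

(** * Modules over an algebra with an attached linear quiver *)
Section Facts.
Variables (K : fieldType) (A : falgType K).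
Implicit Types (M : rmodule A) (chi : algmor A K^o) (E : A).

Lemma char_mod_hom0 chi chi' E : chi E = 1 -> chi' E = 0 ->
  forall h : rmor (char_mod chi) (char_mod chi'), h = 0.
Proof.
move=> e e' h; apply/morP => x; rewrite char_mod_gen zero_lfunE.
have : h (rm_act (1 : char_mod chi) E) = rm_act (h 1) E by rewrite mor_act.
by rewrite /= /char_mod_act e e' mulr1 mulr0 => ->; rewrite scaler0.
Qed.

(** Multiplication by [E] is an idempotent endomorphism, so it is 0 or 1; in the
    second case the action is by scalars and every line is a summand. *)
Lemma scalar_summand M chi E : @indec (rmod A) M -> E * E = E ->
  (forall (x : M) a, rm_act x (E * a) = (chi a : K) *: rm_act x E) ->
  (forall (x : M) a, rm_act x (a * E) = (chi a : K) *: rm_act x E) ->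
  (forall x : M, rm_act x E = 0) \/ @iso (rmod A) (char_mod chi) M.
Proof.
move=> [nz idp] EE El Er.
have R : rhom (linfun (ract E) : 'Hom(M, M)).
  by move=> x a; rewrite !lfunE /= /ract -!rm_actM El Er.
have [|/morP e|/morP e] := idp (mkmor R).
- by apply/morP => x; rewrite /= comp_lfunE !lfunE /= /ract -rm_actM EE.
- by left=> x; have := e x; rewrite zero_lfunE lfunE.
right; have xE (x : M) : rm_act x E = x by have := e x; rewrite id_lfunE lfunE.
have [x x0] : exists x : M, x != 0.
  apply: NNPP => H; apply: nz; apply/morP => x; rewrite id_lfunE zero_lfunE.
  by apply/eqP/idPn => x0; apply: H; exists x.
have [|k kE] := @char_mod_map_exists _ _ chi M x.
  by move=> a; rewrite -{1}(xE x) -rm_actM El xE.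
have kn0 : k <> 0.
  by move=> k0; case/eqP: x0; rewrite -[x]scale1r -(kE 1) k0 zero_lfunE.
have kI := char_mod_mono kn0.
have [|r rE] := @char_mod_comap_exists _ _ chi M (k^-1)%VF.
  by move=> y a; rewrite -{1}(xE y) -rm_actM El xE linearZ.
have rk : rcomp r k = rid _.
  by apply/morP => t; rewrite /= comp_lfunE rE lker0_lfunK ?kI // id_lfunE.
have [|/morP f|f] := idp (rcomp k r).
- by apply/morP => y; have /morP/(_ (r y)) := rk;
    rewrite /= !comp_lfunE id_lfunE => ->.
- case: kn0; apply/morP => t; have := f (k t).
  by have /morP/(_ t) := rk; rewrite /= !comp_lfunE id_lfunE !zero_lfunE => ->.
by exists k, r.
Qed.

Lemma arrow_pack c c' a (E E' al : A) : is_arrow c c' a E E' al ->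
  exists (Q : rmod A) (uv : rmor (char_mod c') Q * rmor Q (char_mod c)),
  [/\ @ses (rmod A) _ _ _ uv.1 uv.2,
      forall s, rcomp uv.2 s <> rid _ /\ forall r, rcomp r uv.1 <> rid _,
      proj Q, inj Q &
      forall M (x : M), @indec (rmod A) M -> rm_act x al != 0 -> @iso (rmod A) Q M].
Proof.
move=> arr; have [u [v [uv ns]]] := arrow_mod_ses arr.
exists (arrow_mod arr), (u, v); split=> //.
- move=> s; split; first exact: ns.
  by move=> r /(ses_section uv) [s' /ns].
- exact: arrow_mod_proj.
- exact: arrow_mod_inj.
- by move=> M x; apply: arrow_mod_summand.
Qed.

End Facts.

(** [A] is the quotient of [B] by the ideal generated by the vertices [E 1], ...,
    [E n], attached one after the other to the shared vertex [E 0]. *)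
Section Attach.
Variables (K : fieldType) (A B : falgType K) (rho : algmor B A) (s : algmor A B) (kappa : B).
Hypothesis rhoK : forall a, rho (s a) = a.
Hypothesis rho_kappa : rho kappa = 1.
Hypothesis s_kappa : forall a, s a * kappa = kappa * s a.
Let F := infl (retract_surj rhoK).

Variables (n : nat) (chi : nat -> algmor B K^o) (a : nat -> B -> K^o) (E al : nat -> B).
Hypothesis n_gt0 : (0 < n)%N.
Hypothesis chiE : forall i j, (i <= n)%N -> (j <= n)%N -> chi i (E j) = (i == j)%:R.
Hypothesis EE : forall j, (j <= n)%N -> E j * E j = E j.
Hypothesis rhoE : forall j, (0 < j <= n)%N -> rho (E j) = 0.
Hypothesis sumE : 1 - kappa = \sum_(1 <= j < n.+1) E j.

Variable chiA : algmor A K^o.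
Hypothesis chi0 : forall b, chi 0%N b = chiA (rho b).
Let T := char_mod chiA.

Let T_iso : @iso (rmod B) (char_mod (chi 0%N)) (F T).
Proof.
have R : rhom (\1%VF : 'Hom(char_mod (chi 0%N), F T)).
  by move=> x b; rewrite !id_lfunE /= /res_act /= /char_mod_act chi0.
have R' : rhom (\1%VF : 'Hom(F T, char_mod (chi 0%N))).
  by move=> x b; rewrite !id_lfunE /= /res_act /= /char_mod_act chi0.
by exists (mkmor R), (mkmor R'); split; apply/morP => x; rewrite /= !comp_lfunE !id_lfunE.
Qed.

Let homSS i j : (i <= n)%N -> (j <= n)%N -> i != j ->
  forall h : rmor (char_mod (chi i)) (char_mod (chi j)), h = 0.
Proof.
move=> i_n jn ij; apply: (@char_mod_hom0 _ _ _ _ (E i)); rewrite chiE ?eqxx //.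
by rewrite eq_sym (negPf ij).
Qed.

(** If the attached vertices act by zero, then [kappa] acts as the identity, so
    that the kernel of [rho] acts by zero as well. *)
Let inflated (M : rmod B) :
  (forall b, b * kappa = s (rho b) * kappa) \/ (forall b, kappa * b = kappa * s (rho b)) ->
  (forall j (x : M), (0 < j <= n)%N -> rm_act x (E j) = 0) ->
  @iso (rmod B) (F (restr s M)) M.
Proof.
move=> bc ME.
have Mc (x : M) : rm_act x kappa = x.
  apply/eqP; rewrite eq_sym -subr_eq0 -{1}[x]rm_act1 -linearB sumE linear_sum.
  by rewrite big_nat big1 //= => j jn; apply: ME.
have act (x : M) b : rm_act x (s (rho b)) = rm_act x b.
  case: bc => bc; first by rewrite -[LHS]Mc -[RHS]Mc -!rm_actM -(bc b).
  by rewrite -[in LHS](Mc x) -[in RHS](Mc x) -!rm_actM (bc b).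
have R : rhom (\1%VF : 'Hom(F (restr s M), M)).
  by move=> x b; rewrite !id_lfunE /= /res_act /= /res_act act.
have R' : rhom (\1%VF : 'Hom(M, F (restr s M))).
  by move=> x b; rewrite !id_lfunE /= /res_act /= /res_act act.
by exists (mkmor R), (mkmor R'); split; apply/morP => x; rewrite /= !comp_lfunE !id_lfunE.
Qed.

Let Fhom0 X j : (0 < j <= n)%N ->
  (forall h : rmor (F X) (char_mod (chi j)), h = 0) /\
  (forall h : rmor (char_mod (chi j)) (F X), h = 0).
Proof.
move=> jn; have chij : chi j (E j) = 1 by rewrite chiE ?eqxx //; case/andP: jn.
split=> h; apply/morP => x; rewrite zero_lfunE.
  have := mor_act h x (E j); rewrite /= /res_act rhoE // linear0 linear0.
  by rewrite /char_mod_act chij mulr1 => <-.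
rewrite char_mod_gen; have := mor_act h (1 : char_mod (chi j)) (E j).
by rewrite /= /res_act rhoE // linear0 /char_mod_act chij mulr1 => ->; rewrite scaler0.
Qed.

(** If an arrow acts nontrivially, its projective-injective module splits off.
    Otherwise every attached vertex acts as a central idempotent. *)
Let classify (M : rmod B) : indec M ->
  (forall b, b * kappa = s (rho b) * kappa) \/ (forall b, kappa * b = kappa * s (rho b)) ->
  (forall j, (0 < j <= n)%N -> (forall i (x : M), (i < n)%N -> rm_act x (al i) = 0) ->
    forall (x : M) b, rm_act x (E j * b) = (chi j b : K) *: rm_act x (E j) /\
                      rm_act x (b * E j) = (chi j b : K) *: rm_act x (E j)) ->
  [\/ exists X', iso (F X') M,
      exists2 j, (0 < j <= n)%N & @iso (rmod B) (char_mod (chi j)) M |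
      exists2 j, (j < n)%N & exists x : M, rm_act x (al j) != 0].
Proof.
move=> iM bc act.
have [[j [jn [x xal]]]|noal] := classic (exists j, (j < n)%N /\ exists x : M, rm_act x (al j) != 0).
  by apply: Or33; exists j => //; exists x.
have al0 i (x : M) : (i < n)%N -> rm_act x (al i) = 0.
  by move=> i_n; apply/eqP/idPn => x0; apply: noal; exists i; split=> //; exists x.
have [[j [jn jM]]|noS] := classic (exists j, (0 < j <= n)%N /\ @iso (rmod B) (char_mod (chi j)) M).
  by apply: Or32; exists j.
apply: Or31; exists (restr s M); apply: inflated bc _ => j x jn.
have [|x' b|x' b|H|H] := @scalar_summand _ _ M (chi j) (E j) iM.
- by apply: EE; case/andP: jn.
- by case: (act j jn al0 x' b).
- by case: (act j jn al0 x' b).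
- exact: H.
by case: noS; exists j.
Qed.

(** The linear quiver leaves the shared vertex: the new modules have no nonzero
    map from [A]-modules, and [chain_theorem] applies as it stands. *)
Theorem attach_out d :
  (forall b, b * kappa = s (rho b) * kappa) ->
  (forall i, (i < n)%N -> is_arrow (chi i) (chi i.+1) (a i) (E i) (E i.+1) (al i)) ->
  (forall b, E n * b = (chi n b : K) *: E n) ->
  @proj (rmod A) T -> directed (rmod A) -> (forall X Y : rmod A, vext d X Y) ->
  least (fun m => forall X : rmod A, vext m X T) d ->
  (exists cD : rmod A -> Prop, ct n cD) ->
  [/\ directed (rmod B), least (fun m => forall X Y : rmod B, vext m X Y) (d + n),
      exists c : rmod B -> Prop, ct n c &
      least (fun m => forall X : rmod B, vext m X (char_mod (chi n))) (d + n)].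
Proof.
move=> bc arr En Tp dA gA lA cA.
(* The sequences exist for [j < n] only; beyond, zero maps are chosen. *)
have pack j : exists w : {Q : rmod B & (rmor (char_mod (chi j.+1)) Q * rmor Q (char_mod (chi j)))%type},
    (j < n)%N -> [/\ @ses (rmod B) _ _ _ (projT2 w).1 (projT2 w).2,
      forall s, rcomp (projT2 w).2 s <> rid _ /\ forall r, rcomp r (projT2 w).1 <> rid _,
      proj (projT1 w), inj (projT1 w) &
      forall (M : rmodule B) (x : M), @indec (rmod B) M -> rm_act x (al j) != 0 ->
        @iso (rmod B) (projT1 w) M].
  have [jn|jn] := ltnP j n; last by exists (existT _ (char_mod (chi j) : rmod B) (0, 0)).
  by have [Q [uv H]] := arrow_pack (arr _ jn); exists (existT _ Q uv).
pose w j := proj1_sig (constructive_indefinite_description _ (pack j)).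
have wP j := proj2_sig (constructive_indefinite_description _ (pack j)).
apply: (@chain_theorem (rmod A) (rmod B) F _ n (fun j => char_mod (chi j) : rmod B)
  (fun j => projT1 (w j)) (fun j => (projT2 (w j)).1) (fun j => (projT2 (w j)).2)
  _ _ _ _ _ _ _ _ T _ _ _ _ d) => //.
- exact: (restr_inj rho_kappa s_kappa bc).
- by move=> j /wP[].
- by move=> j /wP[].
- by move=> j /wP[].
- by move=> j /wP[_ ns _ _ _] s'; case: (ns s').
- by apply: char_mod_proj En; rewrite chiE ?eqxx.
- move=> j jn h /eqP h0; exact: char_mod_isom_mor.
- by move=> X j jn h; case: (Fhom0 X jn) => + _; apply.
- by move=> X h /eqP h0; apply/epi_surj/char_mod_epi.
- move=> M iM; have [] := classify iM (or_introl bc).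
  + move=> j /andP[j0 jn] al0 x b; split; last first.
      case: j j0 jn => // j _ jn; rewrite (arrow_E_r (arr _ jn)).
      by rewrite linearD !linearZ /= al0 // scaler0 addr0.
    move: jn; rewrite leq_eqVlt => /orP[/eqP->|jn]; first by rewrite En linearZ.
    by rewrite (arrow_E_l (arr _ jn)) linearD !linearZ /= al0 // scaler0 addr0.
  + by move=> ?; apply: Or31.
  + by move=> ?; apply: Or32.
  + case=> j jn [x xal]; apply: Or33; exists j => //.
    by have [_ _ _ _ H] := wP j jn; apply: H xal.
Qed.

(** The linear quiver enters the shared vertex. Numbered from there, its arrows
    point backwards, and [chain_theorem] applies to the opposite categories. *)
Theorem attach_in d :
  (forall b, kappa * b = kappa * s (rho b)) ->
  (forall i, (i < n)%N -> is_arrow (chi i.+1) (chi i) (a i) (E i.+1) (E i) (al i)) ->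
  (forall b, b * E n = (chi n b : K) *: E n) ->
  @inj (rmod A) T -> directed (rmod A) -> (forall X Y : rmod A, vext d X Y) ->
  least (fun m => forall X : rmod A, vext m (T : rmod A) X) d ->
  (exists cD : rmod A -> Prop, ct n cD) ->
  [/\ directed (rmod B), least (fun m => forall X Y : rmod B, vext m X Y) (d + n),
      exists c : rmod B -> Prop, ct n c &
      least (fun m => forall X : rmod B, vext m (char_mod (chi n) : rmod B) X) (d + n)].
Proof.
move=> bc arr En Ti dA gA lA cA.
have pack j : exists w : {Q : rmod B & (rmor (char_mod (chi j)) Q * rmor Q (char_mod (chi j.+1)))%type},
    (j < n)%N -> [/\ @ses (rmod B) _ _ _ (projT2 w).1 (projT2 w).2,
      forall s, rcomp (projT2 w).2 s <> rid _ /\ forall r, rcomp r (projT2 w).1 <> rid _,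
      proj (projT1 w), inj (projT1 w) &
      forall (M : rmodule B) (x : M), @indec (rmod B) M -> rm_act x (al j) != 0 ->
        @iso (rmod B) (projT1 w) M].
  have [jn|jn] := ltnP j n; last by exists (existT _ (char_mod (chi j) : rmod B) (0, 0)).
  by have [Q [uv H]] := arrow_pack (arr _ jn); exists (existT _ Q uv).
pose w j := proj1_sig (constructive_indefinite_description _ (pack j)).
have wP j := proj2_sig (constructive_indefinite_description _ (pack j)).
have [dB gB [c ctB] lB] : [/\ directed (op_cat (rmod B)),
    least (fun m => forall X Y : op_cat (rmod B), vext m X Y) (d + n),
    exists c : op_cat (rmod B) -> Prop, ct n c &
    least (fun m => forall X : op_cat (rmod B), vext m X (char_mod (chi n) : rmod B)) (d + n)].
  apply: (@chain_theorem (op_cat (rmod A)) (op_cat (rmod B)) (op_ffunctor F) _ n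
    (fun j => char_mod (chi j) : op_cat (rmod B))
    (fun j => projT1 (w j)) (fun j => (projT2 (w j)).2) (fun j => (projT2 (w j)).1)
    _ _ _ _ _ _ _ _ T _ _ _ _ d) => //.
  - exact: (restr_proj rho_kappa s_kappa bc).
  - by move=> j /wP[/ses_op].
  - by move=> j /wP[].
  - by move=> j /wP[].
  - by move=> j /wP[_ ns _ _ _] s'; case: (ns 0) => _; apply.
  - by apply: char_mod_inj En; rewrite chiE ?eqxx.
  - by move=> i j i_n jn ij h; apply: homSS => //; rewrite eq_sym.
  - by move=> j jn h /eqP h0; apply/(@isom_op (rmod B))/char_mod_isom_mor.
  - by move=> X j jn h; case: (Fhom0 X jn) => _; apply.
  - exact/(@iso_op (rmod B)).
  - by move=> X h /eqP h0; apply/mono_inj/char_mod_mono.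
  - move=> M iM; have [] := @classify M iM (or_intror bc).
    + move=> j /andP[j0 jn] al0 x b; split.
        case: j j0 jn => // j _ jn; rewrite (arrow_E_l (arr _ jn)).
        by rewrite linearD !linearZ /= al0 // scaler0 addr0.
      move: jn; rewrite leq_eqVlt => /orP[/eqP->|jn]; first by rewrite En linearZ.
      by rewrite (arrow_E_r (arr _ jn)) linearD !linearZ /= al0 // scaler0 addr0.
    + by case=> X' /(@iso_op (rmod B)) ?; apply: Or31; exists X'.
    + by case=> j jn /(@iso_op (rmod B)) ?; apply: Or32; exists j.
    + case=> j jn [x xal]; apply: Or33; exists j => //.
      have [_ _ _ _ H] := wP j jn; apply/(@iso_op (rmod B)); exact: H xal.
  - exact: directed_op.
  - by move=> X Y; apply/(@vext_op (rmod A)).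
  - by case: lA => l1 l2; split=> [X|m Hm]; first exact/(@vext_op (rmod A));
      apply: l2 => X; apply/(@vext_op (rmod A)).
  - by case: cA => c /ct_op; exists c.
split.
- exact: (directed_op dB).
- case: gB => g1 g2; split=> [X Y|m Hm]; first exact/(@vext_op (rmod B)).
  by apply: g2 => X Y; apply/(@vext_op (rmod B)).
- by exists c; apply: (@ct_op (op_cat (rmod B)) n c ctB).
- case: lB => g1 g2; split=> [X|m Hm]; first exact/(@vext_op (rmod B)).
  by apply: g2 => X; apply/(@vext_op (rmod B)).
Qed.
End Attach.

(** * The algebra of the linear quiver *)
Section Entries.
Variables (K : fieldType) (n : nat).
Local Notation KAn := (KA K n.+1).
Implicit Types (x y : KAn) (i j k l : 'I_n.+1).

(** The path algebra as upper triangular matrices. *)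
Definition entry i j x : K := if insub (i, j) is Some p then x (p : lpath n.+1) else 0.

Lemma entry_linear i j : linear (entry i j : KAn -> K^o).
Proof. by move=> c x y; rewrite /entry; case: insub => [p|]; rewrite ?ffunE ?scaler0 ?addr0. Qed.

Lemma entry_path x (p : lpath n.+1) : entry (lsrc p) (ltgt p) x = x p.
Proof. by rewrite /entry -surjective_pairing valK. Qed.

Lemma entry_lt i j x : (j < i)%N -> entry i j x = 0.
Proof. by move=> ji; rewrite /entry insubN //= -ltnNge. Qed.

Lemma entry_inj x y : (forall i j, entry i j x = entry i j y) -> x = y.
Proof. by move=> e; apply/ffunP => p; rewrite -!entry_path e. Qed.

Lemma entry1 i j : entry i j (1 : KAn) = (i == j)%:R.
Proof.
rewrite /entry; case: insubP => [p _ Dp|/= ij]; first by rewrite ffunE /lsrc /ltgt Dp.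
by case: eqP ij => // ->; rewrite leqnn.
Qed.

Lemma entryM i j x y : entry i j (x * y) = \sum_k entry i k x * entry k j y.
Proof.
have [ij|ji] := leqP i j; last first.
  rewrite entry_lt // big1 // => k _; have [ki|ik] := ltnP k i.
    by rewrite entry_lt ?mul0r.
  by rewrite [entry k j y]entry_lt ?mulr0 //; apply: leq_trans ik.
pose p : lpath n.+1 := Sub (i, j) ij.
rewrite -[LHS]/(entry (lsrc p) (ltgt p) _) entry_path ffunE pair_big_dep /=.
rewrite (partition_big (fun qr : lpath n.+1 * lpath n.+1 => ltgt qr.1) xpredT) //=.
apply: eq_bigr => k _; have [/andP[ik kj]|nk] := boolP (i <= k <= j)%N.
  pose q : lpath n.+1 := Sub (i, k) ik; pose r : lpath n.+1 := Sub (k, j) kj.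
  rewrite (big_pred1 (q, r)) /=; first by rewrite -!entry_path.
  move=> [q' r'] /=.
  apply/idP/eqP => [/andP[/and3P[/eqP Dk /eqP Di /eqP Dj] /eqP Dk'] | [-> ->]].
    by congr pair; apply: val_inj; rewrite /= [LHS]surjective_pairing;
      rewrite -?[(val q').1]/(lsrc q') -?[(val r').1]/(lsrc r')
        -?[(val q').2]/(ltgt q') -?[(val r').2]/(ltgt r') -?Di -?Dj -?Dk Dk'.
  by rewrite /lconcat /lsrc /ltgt /= !eqxx.
rewrite big_pred0 => [|[q r]] /=.
  by case/nandP: nk; rewrite -ltnNge => H; [rewrite entry_lt ?mul0r | rewrite [entry k j y]entry_lt ?mulr0].
apply: contraNF nk => /andP[/and3P[/eqP Dk /eqP Di /eqP Dj] /eqP <-].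
rewrite -[i]/(lsrc p) -[j]/(ltgt p) Di {2}Dk Dj.
by apply/andP; split; [case: (q) | case: (r)].
Qed.

Definition path_elt i j : KAn := [ffun p => ((lsrc p == i) && (ltgt p == j))%:R].

Lemma entry_path_elt i j k l : (i <= j)%N -> entry k l (path_elt i j) = ((k == i) && (l == j))%:R.
Proof.
move=> ij; rewrite /entry; case: insubP => [p _ Dp|/= kl]; first by rewrite ffunE /lsrc /ltgt Dp.
by case: eqP kl => // ->; case: eqP => // ->; rewrite ij.
Qed.

Lemma entry_path_eltM i j k l x : (i <= j)%N -> entry k l (path_elt i j * x) = (k == i)%:R * entry j l x.
Proof.
move=> ij; rewrite entryM (bigD1 j) //= entry_path_elt // eqxx andbT big1 ?addr0 // => m mj.
by rewrite entry_path_elt // (negPf mj) andbF mul0r.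
Qed.

Lemma entryM_path_elt i j k l x : (i <= j)%N -> entry k l (x * path_elt i j) = entry k i x * (l == j)%:R.
Proof.
move=> ij; rewrite entryM (bigD1 i) //= entry_path_elt // eqxx big1 ?addr0 // => m mi.
by rewrite entry_path_elt // (negPf mi) mulr0.
Qed.

Definition entryV i j : 'Hom(KAn, K^o) := mklin (@entry_linear i j).

Lemma entryVE i j x : entryV i j x = entry i j x.
Proof. exact: mklinE. Qed.

Lemma memv_entry i j x : (x \in lker (entryV i j)) = (entry i j x == 0).
Proof. by rewrite memv_ker entryVE. Qed.

Lemma entry_sum i j I (r : seq I) (P : pred I) (F : I -> KAn) :
  entry i j (\sum_(t <- r | P t) F t) = \sum_(t <- r | P t) entry i j (F t).
Proof. by rewrite -entryVE linear_sum; apply: eq_bigr => t _; apply: entryVE. Qed.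

Lemma entryD i j x y : entry i j (x + y) = entry i j x + entry i j y.
Proof. by rewrite -!entryVE linearD. Qed.

Lemma entryB i j x y : entry i j (x - y) = entry i j x - entry i j y.
Proof. by rewrite -!entryVE linearB. Qed.

Lemma entryZ i j (c : K) x : entry i j (c *: x) = c * entry i j x.
Proof. by rewrite -!entryVE linearZ. Qed.

Lemma sum_path_elt : \sum_i path_elt i i = 1.
Proof.
apply: entry_inj => k l; rewrite entry1 entry_sum (bigD1 k) //= entry_path_elt // eqxx eq_sym.
by rewrite big1 ?addr0 // => i ik; rewrite entry_path_elt // eq_sym (negPf ik).
Qed.

Lemma path_elt_sum x :
  x = \sum_(i : 'I_n.+1) \sum_(j : 'I_n.+1 | (i <= j)%N) entry i j x *: path_elt i j.
Proof.
apply: entry_inj => k l; rewrite entry_sum (bigD1 k) //= entry_sum [X in _ + X]big1 ?addr0.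
  have [kl|lk] := leqP k l.
    rewrite (bigD1 l) //= entryZ entry_path_elt // !eqxx mulr1 big1 ?addr0 // => j /andP[kj jl].
    by rewrite entryZ entry_path_elt // eq_sym (negPf jl) andbF mulr0.
  rewrite entry_lt // big1 // => j kj; rewrite entryZ entry_path_elt //.
  have /negPf-> : l != j by rewrite -val_eqE /=; lia.
    by rewrite andbF mulr0.
move=> i ik; rewrite entry_sum big1 // => j ij; rewrite entryZ entry_path_elt //.
by rewrite eq_sym (negPf ik) mulr0.
Qed.

Lemma nilpotent x m : (forall i, entry i i x = 0) ->
  forall i j, (j < i + m)%N -> entry i j (x ^+ m) = 0.
Proof.
move=> x0; elim: m => [|m IH] i j; first by rewrite addn0; apply: entry_lt.
move=> jm; rewrite exprSr entryM big1 // => k _; have [km|mk] := ltnP k (i + m).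
  by rewrite IH // mul0r.
have [->|kj] := eqVneq k j; first by rewrite x0 mulr0.
by rewrite [entry k j x]entry_lt ?mulr0 //; move: kj; rewrite -val_eqE /=; lia.
Qed.

Lemma entryM_diag i x y : entry i i (x * y) = entry i i x * entry i i y.
Proof.
rewrite entryM (bigD1 i) //= big1 ?addr0 // => k ki.
have [ik|ik] := ltnP i k; first by rewrite [entry k i y]entry_lt ?mulr0.
by rewrite entry_lt ?mul0r // ltn_neqAle ik andbT val_eqE.
Qed.

(** An element with zero diagonal is nilpotent, so 1 minus it is invertible; this
    puts it in every maximal right ideal. Conversely each diagonal entry cuts
    out a maximal right ideal. *)
Lemma radicalP (J : {vspace KAn}) : is_radical J ->
  forall x, x \in J <-> forall i, entry i i x = 0.
Proof.
move=> radJ x; rewrite radJ; split=> [H i | x0 U [Ur Uf Umax]].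
  apply/eqP; rewrite -memv_entry; apply: H; split.
  - by move=> y a; rewrite !memv_entry entryM_diag => /eqP->; rewrite mul0r.
  - by move=> e; have := memvf (1 : KAn); rewrite -e memv_entry entry1 eqxx oner_eq0.
  - move=> V Vr UV; have [VU|/subvPn[v vV]] := boolP (V <= lker (entryV i i))%VS.
      by left; apply/eqP; rewrite eqEsubv VU UV.
    rewrite memv_entry => v0; right; apply/vspaceP => y; rewrite memvf.
    rewrite -[y](subrK ((entry i i y / entry i i v) *: v)); apply: memvD.
      by apply: (subvP UV); rewrite memv_entry entryB entryZ divfK // subrr.
    exact: memvZ.
pose N := (\bigcap_i lker (entryV i i))%VS.
have memN y : y \in N <-> forall i, entry i i y = 0.
  rewrite /N memvE; split=> [/subv_bigcapP H i | H].
    by apply/eqP; rewrite -memv_entry memvE; apply: H.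
  by apply/subv_bigcapP => i _; rewrite -memvE memv_entry H.
have Vr : right_ideal (U + N)%VS.
  move=> y a /memv_addP[u uU [v /memN vN ->]]; rewrite mulrDl memv_add ?Ur //.
  by apply/memN => i; rewrite entryM_diag vN mul0r.
have [UN|UN] := Umax _ Vr (addvSl _ _).
  by rewrite -UN; apply: (subvP (addvSr _ _)); apply/memN.
case: Uf; apply/vspaceP => y; rewrite memvf.
have := memvf (1 : KAn); rewrite -UN => /memv_addP[u uU [v /memN vN e]].
have u1 : u = 1 - v by rewrite e addrK.
have vn : v ^+ n.+1 = 0.
  by apply: entry_inj => i j; rewrite nilpotent //; [rewrite -entryVE linear0 | have := ltn_ord j; lia].
have : u * (\sum_(i < n.+1) v ^+ i) * y \in U by rewrite !Ur.
have -> : u * (\sum_(i < n.+1) v ^+ i) = 1.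
  by apply: oppr_inj; rewrite -mulNr u1 opprB -subrX1 vn sub0r.
by rewrite mul1r.
Qed.

(** A path of length at least 2 is the product of its first arrow and the
    rest. *)
Lemma radical2P (J : {vspace KAn}) : is_radical J ->
  forall x, x \in (J ^+ 2)%VS <-> forall i j, (j <= i.+1)%N -> entry i j x = 0.
Proof.
move=> /radicalP memJ x; rewrite expv2; split=> [xJ i j ij | H].
  have : (J * J <= lker (entryV i j))%VS.
    apply/prodvP => u v /memJ u0 /memJ v0; rewrite memv_entry entryM big1 // => k _.
    have [ki|ki|ki] := ltngtP k i; first by rewrite entry_lt ?mul0r.
      have [->|kj] := eqVneq k j; first by rewrite v0 mulr0.
      by rewrite [entry k j v]entry_lt ?mulr0 //; move: kj; rewrite -val_eqE /=; lia.
    by have -> : k = i; [apply: val_inj | rewrite u0 mul0r].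
  by move=> /subvP/(_ _ xJ); rewrite memv_entry => /eqP.
rewrite [x]path_elt_sum; apply: memv_suml => i _; apply: memv_suml => j ij.
have [ji|ij2] := leqP j i.+1; first by rewrite H // scale0r mem0v.
apply: memvZ; have i1n : (i.+1 < n.+1)%N by have := ltn_ord j; lia.
pose i1 := Ordinal i1n; have -> : path_elt i j = path_elt i i1 * path_elt i1 j.
  by apply: entry_inj => k l; rewrite entry_path_eltM //= !entry_path_elt //= 1?ltnW // eqxx -natrM mulnb.
by apply: memv_mul; apply/memJ => k; rewrite entry_path_elt //= 1?ltnW //;
  case: eqP => // ->; case: eqP => // /(congr1 val) /=; lia.
Qed.

End Entries.

(** The quotient by the square of the radical remembers the entries on the
    diagonal and just above it. *)
Section Lambda.
Variables (K : fieldType) (n : nat) (L : falgType K) (pi : 'AHom(KA K n.+1, L)).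
Hypothesis L_def : is_Lambda 2 pi.
Local Notation KAn := (KA K n.+1).

Let pi_surj l : exists x, pi x = l.
Proof. by case: L_def => /limg_fullP H _; apply: H. Qed.

Let pi_eq x y : pi x = pi y <->
  forall i j : 'I_n.+1, (j <= i.+1)%N -> entry i j x = entry i j y.
Proof.
have [_ [J /radical2P memJ kerE]] := L_def.
split=> [e i j ij|H].
  apply/eqP; rewrite -subr_eq0 -entryB; apply/eqP; move: i j ij; apply/memJ.
  by rewrite -kerE memv_ker linearB /= e subrr.
apply/eqP; rewrite -subr_eq0 -linearB -memv_ker kerE; apply/memJ => i j ij.
by rewrite entryB H // subrr.
Qed.

Definition L_entry (i j : 'I_n.+1) (l : L) : K^o := entry i j ((pi : 'Hom(KAn, L))^-1 l)%VF.

Lemma L_entryE (i j : 'I_n.+1) x : (j <= i.+1)%N -> L_entry i j (pi x) = entry i j x.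
Proof.
move=> ij; rewrite /L_entry; move: i j ij; apply/pi_eq; rewrite limg_lfunVK //.
by rewrite memv_img ?memvf.
Qed.

Lemma L_entry_linear i j : linear (L_entry i j).
Proof. by move=> c x y; rewrite /L_entry linearP /= entry_linear. Qed.

Fact L_entry_diag1 i : L_entry i i 1 = 1.
Proof. by rewrite -(rmorph1 pi) L_entryE // entry1 eqxx. Qed.

Fact L_entry_diagM i x y : L_entry i i (x * y) = L_entry i i x * L_entry i i y.
Proof.
have [[x' <-] [y' <-]] := (pi_surj x, pi_surj y).
by rewrite -rmorphM !L_entryE // entryM_diag.
Qed.

Definition L_char i : algmor L K^o := AlgMor (@L_entry_linear i i) (L_entry_diag1 i) (L_entry_diagM i).

Let eL i := pi (path_elt K i i).

Lemma L_arrow (i j : 'I_n.+1) : j = i.+1 :> nat ->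
  is_arrow (L_char i) (L_char j) (L_entry i j) (eL i) (eL j) (pi (path_elt K i j)).
Proof.
move=> ij; have le_ij : (i <= j)%N by lia.
have ji : (j == i) = false by rewrite -val_eqE /=; lia.
have ij' : (i == j) = false by rewrite eq_sym.
split.
- exact: L_entry_linear.
- move=> x y; have [[x' <-] [y' <-]] := (pi_surj x, pi_surj y).
  rewrite -rmorphM /= !L_entryE ?ij // entryM (bigD1 i) //= (bigD1 j) ?ji //= big1 ?addr0 //.
  move=> k /andP[ki kj]; move: ki kj; rewrite -!val_eqE /= => ki kj.
  have [lt_ki|le_ik] := ltnP k i; first by rewrite entry_lt ?mul0r.
  by rewrite [entry k j y']entry_lt ?mulr0 //; lia.
- by rewrite /= /eL !L_entryE ?ij // !entry_path_elt // !eqxx ij' ji.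
- by rewrite /= /eL !L_entryE ?ij // !entry_path_elt // !eqxx ij' ji.
- move=> x; have [x' <-] := pi_surj x; rewrite /= !L_entryE ?ij // -!linearZ -linearD -rmorphM.
  apply/pi_eq => k l lk; rewrite entry_path_eltM // entryD !entryZ !entry_path_elt //.
  have [ki|ki] := eqVneq k i; last by rewrite !mulr0 addr0 mul0r.
  rewrite {k}ki in lk *.
  have [->|li] := eqVneq l i; first by rewrite ij' mul1r mulr1 mulr0 addr0.
  have [->|lj] := eqVneq l j; first by rewrite mul1r mulr1 mulr0 add0r.
  by rewrite !mulr0 addr0 mul1r entry_lt //; move: li lj lk; rewrite -!val_eqE /=; lia.
- move=> x; have [x' <-] := pi_surj x; rewrite /= !L_entryE ?ij // -!linearZ -rmorphM.
  apply/pi_eq => k l lk; rewrite entry_path_eltM // !entryZ !entry_path_elt //.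
  have [ki|ki] := eqVneq k i; last by rewrite !mulr0 mul0r.
  rewrite {k}ki in lk *.
  have [->|lj] := eqVneq l j; first by rewrite mul1r mulr1.
  by rewrite !mulr0 mul1r entry_lt //; move: lj lk; rewrite -!val_eqE /=; lia.
- move=> x; have [x' <-] := pi_surj x; rewrite /= !L_entryE ?ij // -!linearZ -linearD -rmorphM.
  apply/pi_eq => k l lk; rewrite entryM_path_elt // entryD !entryZ !entry_path_elt //.
  have [lj|lj] := eqVneq l j; last by rewrite !andbF !mulr0 addr0.
  rewrite {l}lj in lk *; rewrite !andbT mulr1.
  have [->|kj] := eqVneq k j; first by rewrite ji mulr1 mulr0 addr0.
  have [->|ki] := eqVneq k i; first by rewrite mulr0 mulr1 add0r.
  by rewrite !mulr0 addr0 entry_lt //; move: ki kj lk; rewrite -!val_eqE /=; lia.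
- move=> x; have [x' <-] := pi_surj x; rewrite /= !L_entryE ?ij // -!linearZ -rmorphM.
  apply/pi_eq => k l lk; rewrite entryM_path_elt // !entryZ !entry_path_elt //.
  have [lj|lj] := eqVneq l j; last by rewrite !andbF !mulr0.
  rewrite {l}lj in lk *; rewrite !andbT mulr1.
  have [->|ki] := eqVneq k i; first by rewrite mulr1.
  by rewrite !mulr0 entry_lt //; move: ki lk; rewrite -!val_eqE /=; lia.
Qed.

Lemma L_chiE i j : L_char i (eL j) = (i == j)%:R.
Proof. by rewrite /= /eL L_entryE // entry_path_elt // andbb. Qed.

Lemma L_orth i j : eL i * eL j = (i == j)%:R *: eL i.
Proof.
rewrite -rmorphM -linearZ; apply/pi_eq => k l _.
rewrite entry_path_eltM // entryZ !entry_path_elt // eq_sym.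
by case: (eqVneq i j) => [->|ij]; case: eqVneq => [->|kj]; rewrite /= ?(eqxx, mul1r, mul0r, mulr0) //;
  case: eqVneq => [lj|]; rewrite ?mulr0 // ?mul0r.
Qed.

Lemma L_corner i l : eL i * l * eL i = (L_char i l : K) *: eL i.
Proof.
have [x <-] := pi_surj l; rewrite /= L_entryE // -linearZ -!rmorphM.
apply/pi_eq => k m _; rewrite entryM_path_elt // entry_path_eltM // entryZ entry_path_elt //.
have [_|_] := eqVneq m i; last by rewrite andbF !mulr0.
by rewrite andbT mulr1 mulrC; case: eqP => [_|]; rewrite ?mulr0.
Qed.

Lemma L_sum : \sum_i eL i = 1.
Proof. by rewrite /eL -rmorph_sum sum_path_elt rmorph1. Qed.

Lemma L_sink (i : 'I_n.+1) l : i = n :> nat -> eL i * l = (L_char i l : K) *: eL i.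
Proof.
move=> i_n; have [x <-] := pi_surj l; rewrite /= L_entryE // -linearZ -rmorphM.
apply/pi_eq => k m lk; rewrite entry_path_eltM // entryZ entry_path_elt //.
have [_|_] := eqVneq k i; last by rewrite mulr0 mul0r.
have [->|mi] := eqVneq m i; first by rewrite mul1r mulr1.
rewrite mulr0 mul1r entry_lt //; move: mi; rewrite -val_eqE /=.
by have := ltn_ord m; lia.
Qed.

Lemma L_source (i : 'I_n.+1) l : i = 0%N :> nat -> l * eL i = (L_char i l : K) *: eL i.
Proof.
move=> i_n; have [x <-] := pi_surj l; rewrite /= L_entryE // -linearZ -rmorphM.
apply/pi_eq => k m lk; rewrite entryM_path_elt // entryZ entry_path_elt //.
have [_|_] := eqVneq m i; last by rewrite andbF !mulr0.
rewrite andbT mulr1; have [->|ki] := eqVneq k i; first by rewrite mulr1.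
by rewrite mulr0 entry_lt //; move: ki; rewrite -val_eqE /=; lia.
Qed.

End Lambda.

(** * Basic algebras and gluing *)
Section Idempotents.
Variables (K : fieldType) (A : falgType K).
Implicit Types e u v : A.

Lemma proj_at_mem e (x : proj_at e) : e * e = e -> e * vsval x = vsval x.
Proof.
move=> ee; case/memv_imgP: (subvsP x) => y _ ->.
by rewrite lfunE /= mulrA ee.
Qed.

Lemma mem_proj_at e x : e * x = x -> x \in limg (amull e).
Proof. by move=> ex; apply/memv_imgP; exists x; rewrite ?memvf // lfunE. Qed.

(** Equivalence in the sense of von Neumann; unlike an isomorphism of modules, it
    is visibly inherited by the components of a gluing. *)
Definition equiv_idem e e' := exists u v,
  [/\ u * v = e, v * u = e', e * u = u & e' * v = v].

Lemma riso_proj_at e e' : e * e = e -> e' * e' = e' ->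
  riso (proj_at e) (proj_at e') <-> equiv_idem e e'.
Proof.
move=> ee ee'; have vsK (h : A) x : h * x = x -> vsval (vsproj (limg (amull h)) x) = x.
  by move=> hx; rewrite vsprojK // mem_proj_at.
split=> [[f [Hf [g fK gK]]] | [u [v [uv vu eu ev]]]].
  pose x := vsproj (limg (amull e)) e : proj_at e.
  pose y := vsproj (limg (amull e')) e' : proj_at e'.
  have xE : vsval x = e by apply: vsK.
  have yE : vsval y = e' by apply: vsK.
  have Hg z a : g (rm_act z a) = rm_act (g z) a by rewrite -{1}[z]gK -Hf fK.
  have gen (z : proj_at e) : rm_act x (vsval z) = z.
    by apply: val_inj; apply: etrans (vsval_eA_act _ _) _; rewrite xE proj_at_mem.
  have gen' (z : proj_at e') : rm_act y (vsval z) = z.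
    by apply: val_inj; apply: etrans (vsval_eA_act _ _) _; rewrite yE proj_at_mem.
  exists (vsval (g y)), (vsval (f x)); split; rewrite ?proj_at_mem //.
    rewrite -[_ * _]vsval_eA_act.
    have -> : eA_act (g y) (vsval (f x)) = g (rm_act y (vsval (f x))) by rewrite Hg.
    by rewrite gen' fK.
  rewrite -[_ * _]vsval_eA_act.
  have -> : eA_act (f x) (vsval (g y)) = f (rm_act x (vsval (g y))) by rewrite Hf.
  by rewrite gen gK.
have lin (h h' w : A) : linear (fun x : proj_at h => vsproj _ (w * vsval x) : proj_at h').
  by move=> c x y; rewrite linearP /= mulrDr -scalerAr linearP.
have vE (x : proj_at e) : vsval (mklin (@lin e e' v) x) = v * vsval x.
  by rewrite mklinE vsK // mulrA ev.
have uE (x : proj_at e') : vsval (mklin (@lin e' e u) x) = u * vsval x.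
  by rewrite mklinE vsK // mulrA eu.
exists (mklin (@lin e e' v)); split.
  move=> x a; apply: val_inj; apply: etrans (vE _) _.
  by rewrite /= !vsval_eA_act vE mulrA.
exists (mklin (@lin e' e u)) => x; apply: val_inj.
  by apply: etrans (uE _) _; rewrite vE mulrA uv proj_at_mem.
by apply: etrans (vE _) _; rewrite uE mulrA vu proj_at_mem.
Qed.

End Idempotents.

Section LambdaBasic.
Variables (K : fieldType) (n : nat) (L : falgType K) (pi : 'AHom(KA K n.+1, L)).
Hypothesis L_def : is_Lambda 2 pi.

(** The corner at a vertex is one-dimensional, hence the vertex is primitive; its
    character separates it from the others. *)
Lemma L_basic : basic L.
Proof.
pose e i := pi (path_elt K i i).
have ee i : e i * e i = e i by rewrite (L_orth L_def) eqxx scale1r.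
have e0 i : e i != 0.
  apply/eqP => e0; have := L_chiE L_def i i; rewrite -/(e i) e0 eqxx afun0 => /eqP.
  by rewrite eq_sym oner_eq0.
exists n.+1, e; split.
- move=> i; split=> // x y xx yy xy yx exy.
  have ex : e i * x = x by rewrite exy mulrDl xx yx addr0.
  have xe : x * e i = x by rewrite exy mulrDr xx xy addr0.
  have xc : x = (L_char L_def i x : K) *: e i by rewrite -(L_corner L_def) ex xe.
  have c2 : (L_char L_def i x : K) * L_char L_def i x = L_char L_def i x.
    by rewrite -[LHS](afunM (L_char L_def i)) xx.
  have [c0|c0] := eqVneq (L_char L_def i x : K) 0; first by left; rewrite xc c0 scale0r.
  right; have c1 : (L_char L_def i x : K) = 1 by apply: (mulfI c0); rewrite mulr1.
  by apply: (addrI x); rewrite -exy addr0 [RHS]xc c1 scale1r.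
- by move=> i j ij; rewrite (L_orth L_def) (negPf ij) scale0r.
- exact: L_sum.
- move=> i j ij /(riso_proj_at (ee i) (ee j)) [u [v [uv vu _ _]]].
  have := L_chiE L_def i i; rewrite -/(e i) -uv afunM mulrC -afunM vu.
  by rewrite (L_chiE L_def) (negPf ij) eqxx => /eqP; rewrite eq_sym oner_eq0.
Qed.

End LambdaBasic.

(** An element of the gluing is a pair on which the characters agree. *)
Section Glue.
Variables (K : fieldType) (A B : falgType K).
Variables (f : 'AHom(A, K^o)) (g : 'AHom(B, K^o)).
Local Notation G := (glue f g).

Definition char_mor (C : falgType K) (h : 'AHom(C, K^o)) : algmor C K^o.
Proof.
refine (@AlgMor K C K^o h _ _ _).
- exact: linearP.
- exact: rmorph1.
- exact: rmorphM.
Defined.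

Definition gfst (x : G) : A := (vsval x).1.
Definition gsnd (x : G) : B := (vsval x).2.

Lemma glueP x : f (gfst x) = g (gsnd x).
Proof.
apply/eqP; rewrite -(mem_glue f g) -surjective_pairing; exact: subvsP.
Qed.

Definition gpair a b (ab : f a = g b) : G :=
  Subvs (introT idP (etrans (mem_glue f g a b) (introT eqP ab))).

Lemma gfstE a b (ab : f a = g b) : gfst (gpair ab) = a. Proof. by []. Qed.
Lemma gsndE a b (ab : f a = g b) : gsnd (gpair ab) = b. Proof. by []. Qed.

Lemma glue_inj x y : gfst x = gfst y -> gsnd x = gsnd y -> x = y.
Proof.
move=> e1 e2; apply: val_inj; rewrite /= [LHS]surjective_pairing [RHS]surjective_pairing.
by congr pair.
Qed.

Lemma gfst_linear : linear gfst.
Proof. by move=> c x y; rewrite /gfst linearP. Qed.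
Lemma gsnd_linear : linear gsnd.
Proof. by move=> c x y; rewrite /gsnd linearP. Qed.
Lemma gfstM x y : gfst (x * y) = gfst x * gfst y. Proof. by []. Qed.
Lemma gsndM x y : gsnd (x * y) = gsnd x * gsnd y. Proof. by []. Qed.

Lemma glue1 : vsval (1 : G) = 1.
Proof.
have fg1 : f 1 = g 1 by rewrite !rmorph1.
suff -> : 1 = gpair fg1 by [].
rewrite -[RHS]mul1r; apply: glue_inj.
  by rewrite gfstM gfstE mulr1.
by rewrite gsndM gsndE mulr1.
Qed.

Lemma gfst1 : gfst 1 = 1. Proof. by rewrite /gfst glue1. Qed.
Lemma gsnd1 : gsnd 1 = 1. Proof. by rewrite /gsnd glue1. Qed.

Definition rho1 : algmor G A := AlgMor gfst_linear gfst1 gfstM.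
Definition rho2 : algmor G B := AlgMor gsnd_linear gsnd1 gsndM.

Lemma gfst0 : gfst 0 = 0. Proof. exact: (afun0 rho1). Qed.
Lemma gsnd0 : gsnd 0 = 0. Proof. exact: (afun0 rho2). Qed.

Lemma gfstB x y : gfst (x - y) = gfst x - gfst y.
Proof. by rewrite -scaleN1r addrC gfst_linear scaleN1r addrC. Qed.
Lemma gsndB x y : gsnd (x - y) = gsnd x - gsnd y.
Proof. by rewrite -scaleN1r addrC gsnd_linear scaleN1r addrC. Qed.
Lemma gfstZ (k : K) x : gfst (k *: x) = k *: gfst x.
Proof. exact: (afunZ rho1). Qed.
Lemma gsndZ (k : K) x : gsnd (k *: x) = k *: gsnd x.
Proof. exact: (afunZ rho2). Qed.
Lemma gfst_sum I (r : seq I) (P : pred I) (F : I -> G) :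
  gfst (\sum_(i <- r | P i) F i) = \sum_(i <- r | P i) gfst (F i).
Proof. exact: (afun_sum rho1). Qed.
Lemma gsnd_sum I (r : seq I) (P : pred I) (F : I -> G) :
  gsnd (\sum_(i <- r | P i) F i) = \sum_(i <- r | P i) gsnd (F i).
Proof. exact: (afun_sum rho2). Qed.

(** Each factor embeds by completing an element with a scalar. *)
Fact sect1_subproof a : f a = g ((f a : K)%:A).
Proof. by rewrite linearZ /= rmorph1 -[_ *: _]/(_ * _) mulr1. Qed.
Definition sect1 : algmor A G.
Proof.
refine (@AlgMor K A G (fun a => gpair (sect1_subproof a)) _ _ _).
- move=> c a b; apply: glue_inj; first by rewrite gfst_linear.
  by rewrite gsnd_linear !gsndE linearP /= scalerDl scalerA.
- by apply: glue_inj; rewrite ?gfst1 ?gsnd1 ?gfstE ?gsndE ?rmorph1 ?scale1r.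
- move=> a b; apply: glue_inj; first by rewrite gfstM.
  by rewrite gsndM !gsndE rmorphM -scalerAl mul1r scalerA.
Defined.

Fact sect2_subproof b : f ((g b : K)%:A) = g b.
Proof. by rewrite linearZ /= rmorph1 -[_ *: _]/(_ * _) mulr1. Qed.
Definition sect2 : algmor B G.
Proof.
refine (@AlgMor K B G (fun a => gpair (sect2_subproof a)) _ _ _).
- move=> c a b; apply: glue_inj; last by rewrite gsnd_linear.
  by rewrite gfst_linear !gfstE linearP /= scalerDl scalerA.
- by apply: glue_inj; rewrite ?gfst1 ?gsnd1 ?gfstE ?gsndE ?rmorph1 ?scale1r.
- move=> a b; apply: glue_inj; last by rewrite gsndM.
  by rewrite gfstM !gfstE rmorphM -scalerAl mul1r scalerA.
Defined.

(** In each factor exactly one idempotent of the given system has a nonzero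
    character; these two are glued and the others completed by 0. If two
    of the resulting idempotents are equivalent, so are their components, and a
    component vanishes for both or for neither. *)
Lemma glue_basic : basic A -> basic B -> basic G.
Proof.
have unit_chr (C : falgType K) (h : 'AHom(C, K^o)) r (e : 'I_r -> C) :
    (forall i, primitive_idempotent (e i)) -> (forall i j, i != j -> e i * e j = 0) ->
    \sum_i e i = 1 -> exists i0, forall i, h (e i) = (i == i0)%:R.
  move=> pe oe se; have [i0 hi0] : exists i0, (h (e i0) : K) != 0.
    apply/existsP; apply: contraT; rewrite negb_exists => /forallP H.
    have : h 1 = 0.
      by rewrite -se linear_sum big1 // => i _; have := H i; rewrite negbK => /eqP.
    by rewrite rmorph1 => /eqP; rewrite oner_eq0.
  exists i0 => i; case: eqVneq => [->|ii0].
    apply: (mulfI (hi0 : (h (e i0) : K) != 0)); rewrite mulr1.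
    by have [_ ee _] := pe i0; rewrite -{3}ee [RHS](rmorphM h).
  apply: (mulIf (hi0 : (h (e i0) : K) != 0)); rewrite mul0r.
  by rewrite -[LHS](rmorphM h) /= oe // linear0.
move=> [r [e [pe oe se ne]]] [[|r'] [e' [pe' oe' se' ne']]].
  by move: se'; rewrite big_ord0 => /esym/eqP; rewrite oner_eq0.
have [i0 fe] := unit_chr _ f _ _ pe oe se.
have [j0 ge] := unit_chr _ g _ _ pe' oe' se'.
have inE i : f (e i) = g ((f (e i) : K) *: e' j0).
  by rewrite linearZ /= ge eqxx -[_ *: _]/(_ * _) mulr1.
have outE j : f 0 = g (e' (lift j0 j)).
  by rewrite linear0 ge eq_sym (negPf (neq_lift _ _)).
pose E (k : 'I_r + 'I_r') := match k with inl i => gpair (inE i) | inr j => gpair (outE j) end.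
have oel j : e' j0 * e' (lift j0 j) = 0 by apply: oe'; apply: neq_lift.
have oer j : e' (lift j0 j) * e' j0 = 0 by apply: oe'; rewrite eq_sym neq_lift.
have idp i : e i * e i = e i by case: (pe i).
have idp' j : e' j * e' j = e' j by case: (pe' j).
have ff i i' : (f (e i) : K) * f (e i') = (i == i')%:R * f (e i).
  case: eqVneq => [<-|ii']; first by rewrite mul1r -[LHS](rmorphM f) idp.
  by rewrite mul0r -[LHS](rmorphM f) /= oe // linear0.
have E2 k k' : E k * E k' = (k == k')%:R *: E k.
  case: k k' => [i|j] [i'|j']; apply: glue_inj;
    rewrite ?(gfstM, gsndM) ?(linearZ_LR gfst_linear) /gfst /gsnd /=.
  - rewrite -[inl i == inl i']/(i == i').
    by case: eqVneq => [->|ii']; rewrite ?idp ?scale1r // oe ?scale0r.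
  - rewrite -[inl i == inl i']/(i == i').
    by rewrite -scalerAl -scalerAr scalerA ff idp' -scalerA.
  - by rewrite mulr0 scale0r.
  - by rewrite -scalerAl oel scaler0 scale0r.
  - by rewrite mul0r scaler0.
  - by rewrite -scalerAr oer scaler0 scale0r.
  - by rewrite mul0r scaler0.
  - rewrite -[inr j == inr j']/(j == j').
    case: eqVneq => [->|jj']; rewrite ?idp' ?scale1r // oe' ?scale0r //.
    by rewrite (inj_eq (@lift_inj _ _)).
have E0 k : E k != 0.
  apply/eqP; case: k => [i|j] e0.
    have := congr1 gfst e0; rewrite gfstE gfst0 => ei0.
    by have [/eqP] := pe i.
  have := congr1 gsnd e0; rewrite gsndE gsnd0 => ej0.
  by have [/eqP] := pe' (lift j0 j).
have Eorth k k' : k != k' -> E k * E k' = 0 by rewrite E2 => /negPf->; rewrite scale0r.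
have Eidem k : E k * E k = E k by rewrite E2 eqxx scale1r.
have orth0 (C : falgType K) (x y : C) : x * x = x -> x * y = 0 -> 0 = x + y -> x = 0.
  move=> xx xy /esym/eqP; rewrite addrC addr_eq0 => /eqP yx; apply/eqP.
  by rewrite -oppr_eq0 -xx -mulrN -yx xy.
have Eprim k : primitive_idempotent (E k).
  split=> // x y xx yy xy yx Exy.
  have c1 (a b c : G) : a * b = c -> gfst a * gfst b = gfst c by move<-.
  have c2 (a b c : G) : a * b = c -> gsnd a * gsnd b = gsnd c by move<-.
  have xy1 := c1 _ _ _ xy; have yx1 := c1 _ _ _ yx; rewrite gfst0 in xy1 yx1.
  have xy2 := c2 _ _ _ xy; have yx2 := c2 _ _ _ yx; rewrite gsnd0 in xy2 yx2.
  have {c1} xx1 := c1 _ _ _ xx; have yy1 := congr1 gfst yy; rewrite gfstM in yy1.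
  have {c2} xx2 := c2 _ _ _ xx; have yy2 := congr1 gsnd yy; rewrite gsndM in yy2.
  have E1 : gfst (E k) = gfst x + gfst y by rewrite Exy -[LHS]/(rho1 _) afunD.
  have E2' : gsnd (E k) = gsnd x + gsnd y by rewrite Exy -[LHS]/(rho2 _) afunD.
  have zero2 z : gfst z = 0 -> (g (gsnd z) : K) = 0 by rewrite -glueP => ->; rewrite linear0.
  case: k Exy E1 E2' => [i|j] Exy /= E1 E2'; last first.
    have x1 : gfst x = 0 by apply: orth0 xy1 _.
    have y1 : gfst y = 0 by apply: orth0 yx1 _; rewrite // addrC.
    have [_ _ prim] := pe' (lift j0 j).
    by have [x2|y2] := prim _ _ xx2 yy2 xy2 yx2 E2'; [left|right]; apply: glue_inj;
      rewrite ?gfst0 ?gsnd0.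
  have half z w : z * z = z -> z * w = 0 -> w * z = 0 -> w * w = w ->
      f (e i) *: e' j0 = z + w -> (g z : K) = 0 -> z = 0.
    rewrite fe; case: eqVneq => [_|_] zz zw wz ww; last first.
      by rewrite scale0r => e0w _; apply: orth0 zz zw e0w.
    rewrite scale1r => ezw gz; have [_ _ prim] := pe' j0.
    have [//|w0] := prim _ _ zz ww zw wz ezw.
    have := ge j0; rewrite ezw w0 addr0 gz eqxx => /eqP.
    by rewrite eq_sym oner_eq0.
  have [_ _ prim] := pe i.
  have [x1|y1] := prim _ _ xx1 yy1 xy1 yx1 E1; [left|right]; apply: glue_inj;
    rewrite ?gfst0 ?gsnd0 //.
    exact: half xx2 xy2 yx2 yy2 E2' (zero2 _ x1).
  by apply: half yy2 yx2 xy2 xx2 _ (zero2 _ y1); rewrite addrC.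
have Ene k k' : k != k' -> ~ riso (proj_at (E k)) (proj_at (E k')).
  move=> kk' /(riso_proj_at (Eidem k) (Eidem k')) [u [v [uv vu eu ev]]].
  have e1 (h : algmor G A) : h (E k') = 0 -> h (E k) = 0.
    by move=> h0; rewrite -Eidem -uv !afunM mulrA -(mulrA (h u)) -(afunM h v) vu h0 mulr0 mul0r.
  have e2 (h : algmor G A) : h (E k) = 0 -> h (E k') = 0.
    by move=> h0; rewrite -Eidem -vu !afunM mulrA -(mulrA (h v)) -(afunM h u) uv h0 mulr0 mul0r.
  case: k k' kk' uv vu eu ev e1 e2 => [i|j] [i'|j'] kk' uv vu eu ev e1 e2.
  - apply: (ne i i'); first exact: kk'.
    apply/(riso_proj_at (idp i) (idp i')); exists (gfst u), (gfst v).
    by split; [exact: (congr1 gfst uv) | exact: (congr1 gfst vu)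
              | exact: (congr1 gfst eu) | exact: (congr1 gfst ev)].
  - by have [/eqP + _ _] := pe i; apply; apply: (e1 rho1).
  - by have [/eqP + _ _] := pe i'; apply; apply: (e2 rho1).
  - apply: (ne' (lift j0 j) (lift j0 j')); first by rewrite (inj_eq (@lift_inj _ _)).
    apply/(riso_proj_at (idp' _) (idp' _)); exists (gsnd u), (gsnd v).
    by split; [exact: (congr1 gsnd uv) | exact: (congr1 gsnd vu)
              | exact: (congr1 gsnd eu) | exact: (congr1 gsnd ev)].
exists (r + r')%N, (fun k => E (split k)); split=> //.
- by move=> k k' kk'; apply: Eorth; apply: contra_neq kk' => /(can_inj (@splitK _ _)).
- rewrite big_split_ord /=.
  rewrite (eq_bigr _ (fun i _ => congr1 E (unsplitK (inl i)))).
  rewrite (eq_bigr _ (fun j _ => congr1 E (unsplitK (inr j)))).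
  apply: glue_inj; rewrite ?gfst1 ?gsnd1.
    rewrite -[LHS]/(rho1 _) afunD !afun_sum /= -[RHS]addr0 -se.
    by congr (_ + _); rewrite big1.
  rewrite -[LHS]/(rho2 _) afunD !afun_sum /= -[RHS]se' (bigD1_ord j0) //=.
  congr (_ + _); under eq_bigr do rewrite gsndE.
  rewrite -scaler_suml (bigD1 i0) //= fe eqxx big1 ?addr0 ?scale1r // => i ii0.
  by rewrite fe (negPf ii0).
- by move=> k k' kk'; apply: Ene; apply: contra_neq kk' => /(can_inj (@splitK _ _)).
Qed.

End Glue.

(** * The shared vertex *)
Section SimpleAt.
Variables (K : fieldType) (A : falgType K).

Lemma iso_of_bij (M N : rmodule A) (h : rmor M N) :
  lker h = 0%VS -> limg h = fullv -> @iso (rmod A) M N.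
Proof.
move=> hI hS; exists h; apply/isomP; split; first exact: mor_rhom.
exists (h^-1)%VF => x; first by rewrite lker0_lfunK // hI.
by rewrite limg_lfunVK // hS memvf.
Qed.

Lemma simple_mono (P : rmodule A) N (h : rmor P N) : simple_rmodule P -> h <> 0 ->
  lker h = 0%VS.
Proof.
move=> [_ simP] h0; have [//|e] := simP _ (lker_submodule (f := h)).
case: h0; apply/morP => x; rewrite zero_lfunE; apply/eqP.
by rewrite -memv_ker e memvf.
Qed.

Lemma simple_epi (P : rmodule A) N (h : rmor N P) : simple_rmodule P -> h <> 0 ->
  limg h = fullv.
Proof.
move=> [_ simP] h0; have [e|//] := simP _ (limg_submodule (f := h)).
case: h0; apply/morP => x; rewrite zero_lfunE; apply/eqP.
by rewrite -memv0 -e memv_img ?memvf.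
Qed.

(** Evaluation of the character on [eA] is a nonzero map from a simple
    module, hence injective. *)
Lemma simple_proj_at (P : rmodule A) e (f : 'AHom(A, K^o)) :
  simple_rmodule P -> e * e = e -> riso P (proj_at e) -> f e = 1 ->
  (forall a, e * a = (f a : K) *: e) /\ @iso (rmod A) P (char_mod (char_mor f)).
Proof.
move=> simP ee [phi [Hphi [psi phiK psiK]]] fe.
have L : linear (fun p : P => f (vsval (phi p))).
  by move=> c x y; rewrite !linearP.
have [|h hE] := @char_mod_comap_exists _ _ (char_mor f) P (mklin L).
  by move=> x a; rewrite !mklinE Hphi /= vsval_eA_act rmorphM mulrC.
have memE a : e * a \in limg (amull e) by rewrite mem_proj_at // mulrA ee.
have vK a : vsval (vsproj (limg (amull e)) (e * a)) = e * a by rewrite vsprojK.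
have h0 : h <> 0.
  move=> /morP/(_ (psi (vsproj _ (e * 1)))).
  rewrite hE mklinE psiK vK mulr1 fe zero_lfunE => /eqP.
  by rewrite oner_eq0.
have hI := simple_mono simP h0; split; last exact: iso_of_bij hI (char_mod_epi h0).
move=> a; pose z := e * (a - (f a : K)%:A).
have : psi (vsproj _ z) = 0.
  apply: (iffLR (lker_injP _) hI); rewrite linear0 hE mklinE psiK vK.
  by rewrite rmorphM /= linearB linearZ /= rmorph1 -[_ *: _]/(_ * _) mulr1 subrr mulr0.
move=> /(congr1 phi)/(congr1 vsval); rewrite psiK vK linear0 linear0 => /eqP.
by rewrite mulrBr subr_eq0 -scalerAr mulr1 => /eqP.
Qed.

(** The restriction of the character to [A eps] spans a nonzero submodule of
    the simple module [D(A eps)]. *)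
Lemma simple_inj_at (I : rmodule A) eps (g : 'AHom(A, K^o)) :
  simple_rmodule I -> eps * eps = eps -> riso I (inj_at eps) -> g eps = 1 ->
  (forall a, a * eps = (g a : K) *: eps) /\ @iso (rmod A) (char_mod (char_mor g)) I.
Proof.
move=> simI ee [phi [Hphi [psi phiK psiK]]] ge.
have Hpsi x a : psi (rm_act x a) = rm_act (psi x) a.
  by rewrite -{1}[x]psiK -Hphi phiK.
pose U := subvs_of (limg (amulr eps)).
have L : linear (fun x : U => g (vsval x)) by move=> c x y; rewrite !linearP.
pose gU : inj_at eps := mklin L : 'Hom(_, K^o).
have gUa a : rm_act gU a = (g a : K) *: gU.
  apply/lfunP => x; rewrite /= comp_lfunE scale_lfunE !mklinE vsval_Ae_lmul.
  by rewrite rmorphM.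
have [|h hE] := @char_mod_map_exists _ _ (char_mor g) I (psi gU).
  by move=> a; rewrite -Hpsi gUa; apply: (can_inj phiK); rewrite linearZ /= !psiK.
have memE a : a * eps \in limg (amulr eps).
  by apply/memv_imgP; exists a; rewrite ?memvf // lfunE.
have gUE a : gU (vsproj _ (a * eps)) = g a.
  by rewrite mklinE vsprojK // rmorphM /= ge mulr1.
have h0 : h <> 0.
  move=> /morP/(_ 1); rewrite hE scale1r zero_lfunE => /(congr1 phi).
  rewrite psiK linear0 => /lfunP/(_ (vsproj _ (1 * eps))).
  by rewrite gUE zero_lfunE rmorph1 => /eqP; rewrite oner_eq0.
have hS := simple_epi simI h0.
split; last exact: iso_of_bij (char_mod_mono h0) hS.
move=> a; pose z : U := vsproj _ ((a - (g a : K)%:A) * eps).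
have z0 (u : 'Hom(U, K^o)) : u z = 0.
  have [t ht] := iffLR (limg_fullP _) hS (psi (u : inj_at eps)).
  have -> : u = (t : K) *: gU :> inj_at eps by rewrite -[LHS]psiK -ht hE linearZ /= psiK.
  rewrite scale_lfunE gUE linearB linearZ /= rmorph1 -[X in _ - X]/(_ * _).
  by rewrite mulr1 subrr scaler0.
have : z = 0.
  rewrite (coord_vbasis (memvf z)) big1 // => i _.
  by have := z0 (linfun (coord (vbasis {:U}) i : U -> K^o)); rewrite lfunE /= => ->; rewrite scale0r.
move=> /(congr1 vsval); rewrite vsprojK // linear0 mulrBl => /eqP.
by rewrite subr_eq0 -scalerAl mul1r => /eqP.
Qed.

End SimpleAt.

Section Assembly.
Variables (K : fieldType) (n : nat) (L : falgType K) (pi : 'AHom(KA K n.+1, L)).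
Hypothesis L_def : is_Lambda 2 pi.
Hypothesis n_gt0 : (0 < n)%N.
Let eL i := pi (path_elt K i i).

(** Arrow relations of one factor lift to the gluing when the other component of
    the arrow vanishes. *)
Lemma arrow_glue (G C : falgType K) (phi : algmor G L) (psi : algmor G C)
    c c' a E E' al :
  (forall x y, phi x = phi y -> psi x = psi y -> x = y) ->
  is_arrow c c' a (phi E) (phi E') (phi al) -> psi al = 0 ->
  (forall x, psi E * psi x = (c (phi x) : K) *: psi E) ->
  (forall x, psi x * psi E' = (c' (phi x) : K) *: psi E') ->
  is_arrow (acomp c phi) (acomp c' phi) (a \o phi) E E' al.
Proof.
move=> jinj arr al0 El Er; split => /=.
- by move=> k x y; rewrite /= afun_linear (arrow_linear arr).
- by move=> x y; rewrite /= afunM (arrowM arr).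
- exact: arrow_EE arr.
- exact: arrow_al arr.
- move=> x; apply: jinj; rewrite afunD !afunZ afunM; first exact: (arrow_E_l arr).
  by rewrite al0 scaler0 addr0.
- move=> x; apply: jinj; rewrite afunZ afunM; first exact: (arrow_al_l arr).
  by rewrite al0 scaler0 mul0r.
- move=> x; apply: jinj; rewrite afunD !afunZ afunM; first exact: (arrow_E_r arr).
  by rewrite al0 scaler0 addr0.
- move=> x; apply: jinj; rewrite afunZ afunM; first exact: (arrow_al_r arr).
  by rewrite al0 scaler0 mulr0.
Qed.

(** The character at the source is determined by its value there, because the
    left ideal of the source is spanned by the idempotent. *)
Lemma char_source (g : 'AHom(L, K^o)) : g (eL ord0) = 1 ->
  forall l, g l = L_char L_def ord0 l.
Proof.
move=> g0 l; have := congr1 g (L_source L_def l (erefl : ord0 = 0%N :> nat)).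
by rewrite rmorphM linearZ /= -/(eL _) g0 mulr1 -[_ *: _]/(_ * _) mulr1.
Qed.

Lemma char_sink (f : 'AHom(L, K^o)) : f (eL ord_max) = 1 ->
  forall l, f l = L_char L_def ord_max l.
Proof.
move=> f0 l; have := congr1 f (L_sink L_def l (erefl : ord_max = n :> nat)).
by rewrite rmorphM linearZ /= -/(eL _) f0 mul1r -[_ *: _]/(_ * _) mulr1.
Qed.

End Assembly.

(** * The two gluings *)
Section Main.
Variables (K : fieldType) (n : nat) (L : falgType K) (pi : 'AHom(KA K n.+1, L)).
Hypothesis L_def : is_Lambda 2 pi.
Hypothesis n_gt0 : (0 < n)%N.
Let eL i := pi (path_elt K i i).
Let vtx j : 'I_n.+1 := inord j.

Let vtxK j : (j <= n)%N -> vtx j = j :> nat.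
Proof. by move=> jn; rewrite inordK. Qed.

Let eL_idem i : eL i * eL i = eL i.
Proof. by rewrite (L_orth L_def) eqxx scale1r. Qed.

Let chi_idem i j : (L_char L_def i (eL j) : K) = (i == j)%:R.
Proof. exact: L_chiE. Qed.

Section OutOfSink.
Variables (A : falgType K) (f : 'AHom(A, K^o)) (g : 'AHom(L, K^o)) (e : A) (d : nat).
Hypotheses (ee : e * e = e) (fe : f e = 1) (g0 : g (eL ord0) = 1).
Hypothesis e_char : forall a, e * a = (f a : K) *: e.
Local Notation G := (glue f g).

Let gE l : g l = L_char L_def ord0 l. Proof. exact: char_source. Qed.

(* Completing by 0 requires [g l = 0]; subtracting the scalar makes the map total
   and changes nothing in that case. *)
Fact embed_snd_subproof l : f 0 = g (l - (g l : K)%:A).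
Proof.
by rewrite linear0 linearB linearZ /= rmorph1 -[_ *: _]/(_ * _) mulr1 subrr.
Qed.
Let embed l : G := gpair (embed_snd_subproof l).

Let embedE l : g l = 0 -> gsnd (embed l) = l.
Proof. by move=> gl; rewrite gsndE gl scale0r subr0. Qed.

Fact shared_out_subproof : f e = g (eL ord0).
Proof. by rewrite fe g0. Qed.

Let E j : G := if j is 0 then gpair shared_out_subproof else embed (eL (vtx j)).
Let al j : G := embed (pi (path_elt K (vtx j) (vtx j.+1))).
Let chi j := acomp (L_char L_def (vtx j)) (rho2 f g).

Let EE j : (j <= n)%N -> gfst (E j) = (if j is 0 then e else 0) /\ gsnd (E j) = eL (vtx j).
Proof.
case: j => [|j] jn; first by split=> //; congr eL; apply: val_inj; rewrite /= vtxK.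
split; rewrite //= embedE // gE chi_idem -val_eqE /= vtxK //.
Qed.

Let gfstE0 j : (0 < j)%N -> gfst (E j) = 0. Proof. by case: j. Qed.

Let alE j : (j < n)%N -> gsnd (al j) = pi (path_elt K (vtx j) (vtx j.+1)).
Proof.
move=> jn; rewrite embedE // gE /= L_entryE // entry_path_elt ?vtxK ?(ltnW jn) //.
by rewrite -!val_eqE /= !vtxK ?(ltnW jn) //= andbF.
Qed.

Let vtx0 : vtx 0 = ord0. Proof. by apply: val_inj; rewrite /= vtxK. Qed.

Theorem glue_out : strongly_representation_directed A n d ->
  injdim (char_mod (char_mor f)) d ->
  strongly_representation_directed G n (d + n) /\
  exists P' : rmodule G,
    [/\ simple_rmodule P', projective_rmodule P' & injdim P' (d + n)].
Proof.
move=> [bA /directedP dA /gldimP[gA _] [cA /ctP ctA]] /injdimP lA.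
have kappa_ok : f 1 = g (eL ord0) by rewrite rmorph1 g0.
pose kappa : G := gpair kappa_ok.
have arr i : (i < n)%N -> is_arrow (chi i) (chi i.+1) (L_entry pi (vtx i) (vtx i.+1) \o rho2 f g)
    (E i) (E i.+1) (al i).
  move=> i_n; have [E1 E2] := EE (ltnW i_n); have [E1' E2'] := EE i_n.
  apply: (arrow_glue (psi := rho1 f g)).
  - by move=> x y e2 e1; apply: glue_inj.
  - rewrite /= E2 E2' (alE i_n); apply: L_arrow; rewrite ?vtxK // ltnW //.
  - by [].
  - move=> x; rewrite /= E1; case: {i_n E1 E2 E1' E2'} i => [|i]; last by rewrite mul0r scaler0.
    by rewrite e_char glueP gE vtx0.
  - by move=> x; rewrite /= E1' mulr0 scaler0.
have sink b : E n * b = (chi n b : K) *: E n.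
  have [E1 E2] := EE (leqnn n); apply: glue_inj.
    by rewrite gfstZ gfstM (gfstE0 n_gt0) mul0r scaler0.
  by rewrite gsndZ gsndM E2 (L_sink L_def) // vtxK.
have Echi i j : (i <= n)%N -> (j <= n)%N -> (chi i (E j) : K) = (i == j)%:R.
  move=> i_n jn; rewrite -[LHS]/(L_char L_def (vtx i) (gsnd (E j)) : K).
  by rewrite (EE jn).2 chi_idem -val_eqE /= !vtxK.
have Eid j : (j <= n)%N -> E j * E j = E j.
  move=> jn; have [E1 E2] := EE jn; apply: glue_inj; rewrite ?gfstM ?gsndM ?E1 ?E2.
    by case: (j) => [|m]; rewrite ?ee ?mul0r.
  exact: eL_idem.
have rhoE j : (0 < j <= n)%N -> rho1 f g (E j) = 0.
  by case: j.
have sumE : 1 - kappa = \sum_(1 <= j < n.+1) E j.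
  apply: glue_inj.
    by rewrite gfstB gfst1 gfstE subrr gfst_sum big_nat big1 //; case.
  rewrite gsndB gsnd1 gsndE gsnd_sum -(L_sum pi) big_ord_recl /= -/(eL _) addrC addKr.
  rewrite big_add1 big_mkord; apply: eq_bigr => i _; rewrite (EE (ltn_ord i : (i.+1 <= n)%N)).2.
  by congr eL; apply: val_inj; rewrite /= vtxK.
have [||||||dG gG [cG ctG] lG] := @attach_out K A G (rho1 f g) (sect1 f g) kappa _ _ _ n chi
  (fun i => L_entry pi (vtx i) (vtx i.+1) \o rho2 f g) E al n_gt0 Echi Eid rhoE sumE
  (char_mor f) _ d _ arr sink _ dA gA lA (ex_intro _ cA ctA).
- by [].
- by [].
- move=> a; apply: glue_inj; rewrite ?gfstM ?gsndM ?mulr1 ?mul1r //= !gsndE.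
  by rewrite -scalerAl mul1r -scalerAr mulr1.
- by move=> b; rewrite /= glueP gE vtx0.
- move=> b; apply: glue_inj; first by rewrite !gfstM.
  rewrite !gsndM /= !gsndE (L_source L_def) // -scalerAl mul1r.
  by rewrite glueP gE.
- by apply: (char_mod_proj (E := e)).
split; first split.
- exact: glue_basic bA (L_basic L_def).
- exact/directedP.
- exact/gldimP.
- by exists cG; apply/ctP.
exists (char_mod (chi n)); split.
- exact: char_mod_simple.
- by apply/projP/(char_mod_proj _ sink); apply: etrans (Echi _ _ (leqnn n) (leqnn n)) _; rewrite eqxx.
- exact/injdimP.
Qed.
End OutOfSink.

Section IntoSource.
Variables (B : falgType K) (f : 'AHom(L, K^o)) (g : 'AHom(B, K^o)) (eps : B) (d : nat).
Hypotheses (ee : eps * eps = eps) (ge : g eps = 1) (f0 : f (eL ord_max) = 1).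
Hypothesis eps_char : forall b, b * eps = (g b : K) *: eps.
Local Notation G := (glue f g).

Let fE l : f l = L_char L_def ord_max l. Proof. exact: char_sink. Qed.

Fact embed_fst_subproof l : f (l - (f l : K)%:A) = g 0.
Proof.
by rewrite linear0 linearB linearZ /= rmorph1 -[_ *: _]/(_ * _) mulr1 subrr.
Qed.
Let embed l : G := gpair (embed_fst_subproof l).

Let embedE l : f l = 0 -> gfst (embed l) = l.
Proof. by move=> fl; rewrite gfstE fl scale0r subr0. Qed.

Fact shared_in_subproof : f (eL ord_max) = g eps.
Proof. by rewrite f0 ge. Qed.

(* The vertices are numbered from the shared sink backwards. *)
Let w j := vtx (n - j)%N.

Let wK j : (j <= n)%N -> w j = (n - j)%N :> nat.
Proof. by move=> jn; rewrite vtxK // leq_subr. Qed.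

Let E j : G := if j is 0 then gpair shared_in_subproof else embed (eL (w j)).
Let al j : G := embed (pi (path_elt K (w j.+1) (w j))).
Let chi j := acomp (L_char L_def (w j)) (rho1 f g).

Let gsndE0 j : (0 < j)%N -> gsnd (E j) = 0. Proof. by case: j. Qed.

Let w0 : w 0 = ord_max. Proof. by apply: val_inj; rewrite /= wK ?subn0. Qed.

Let EE j : (j <= n)%N -> gsnd (E j) = (if j is 0 then eps else 0) /\ gfst (E j) = eL (w j).
Proof.
case: j => [|j] jn; first by rewrite w0.
split; rewrite //= embedE // fE chi_idem -val_eqE /= wK //.
by have -> : (n == n - j.+1)%N = false by apply/eqP; lia.
Qed.

Let alE j : (j < n)%N -> gfst (al j) = pi (path_elt K (w j.+1) (w j)).
Proof.
move=> jn; rewrite embedE // fE /= L_entryE // entry_path_elt ?wK ?(ltnW jn) ?leq_sub //.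
rewrite -!val_eqE /= !wK ?(ltnW jn) //.
by have -> : (n == n - j.+1)%N = false by apply/eqP; lia.
Qed.

Theorem glue_in : strongly_representation_directed B n d ->
  projdim (char_mod (char_mor g)) d ->
  strongly_representation_directed G n (d + n) /\
  exists I' : rmodule G,
    [/\ simple_rmodule I', injective_rmodule I' & projdim I' (d + n)].
Proof.
move=> [bA /directedP dA /gldimP[gA _] [cA /ctP ctA]] /projdimP lA.
have kappa_ok : f (eL ord_max) = g 1 by rewrite rmorph1 f0.
pose kappa : G := gpair kappa_ok.
have arr i : (i < n)%N -> is_arrow (chi i.+1) (chi i) (L_entry pi (w i.+1) (w i) \o rho1 f g)
    (E i.+1) (E i) (al i).
  move=> i_n; have [E1 E2] := EE (ltnW i_n); have [E1' E2'] := EE i_n.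
  apply: (arrow_glue (psi := rho2 f g)).
  - by move=> x y e2 e1; apply: glue_inj.
  - rewrite /= E2 E2' (alE i_n); apply: L_arrow.
    by rewrite !wK ?(ltnW i_n) //; lia.
  - by [].
  - by move=> x; rewrite /= E1' mul0r scaler0.
  - move=> x; rewrite /= E1; case: {i_n E1 E2 E1' E2'} i => [|i]; last by rewrite mulr0 scaler0.
    by rewrite eps_char -glueP fE w0.
have source b : b * E n = (chi n b : K) *: E n.
  have [E1 E2] := EE (leqnn n); apply: glue_inj; last first.
    by rewrite gsndZ gsndM (gsndE0 n_gt0) mulr0 scaler0.
  by rewrite gfstZ gfstM E2 (L_source L_def) // wK // subnn.
have Echi i j : (i <= n)%N -> (j <= n)%N -> (chi i (E j) : K) = (i == j)%:R.
  move=> i_n jn; rewrite -[LHS]/(L_char L_def (w i) (gfst (E j)) : K).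
  rewrite (EE jn).2 chi_idem -val_eqE /= !wK //.
  by congr (nat_of_bool _)%:R; apply/eqP/eqP; lia.
have Eid j : (j <= n)%N -> E j * E j = E j.
  move=> jn; have [E1 E2] := EE jn; apply: glue_inj; rewrite ?gfstM ?gsndM ?E1 ?E2.
    exact: eL_idem.
  by case: (j) => [|m]; rewrite ?ee ?mul0r.
have rhoE j : (0 < j <= n)%N -> rho2 f g (E j) = 0.
  by case: j.
have sumE : 1 - kappa = \sum_(1 <= j < n.+1) E j.
  apply: glue_inj; last by rewrite gsndB gsnd1 gsndE subrr gsnd_sum big_nat big1 //; case.
  rewrite gfstB gfst1 gfstE gfst_sum -(L_sum pi) (reindex_inj rev_ord_inj) /=.
  rewrite big_ord_recl /= -/(eL _).
  have -> : rev_ord ord0 = ord_max :> 'I_n.+1 by apply: val_inj; rewrite /= subn1.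
  rewrite addrAC subrr add0r big_add1 big_mkord; apply: eq_bigr => i _.
  rewrite (EE (ltn_ord i : (i.+1 <= n)%N)).2.
  by congr eL; apply: val_inj; rewrite /= wK.
have [||||||dG gG [cG ctG] lG] := @attach_in K B G (rho2 f g) (sect2 f g) kappa _ _ _ n chi
  (fun i => L_entry pi (w i.+1) (w i) \o rho1 f g) E al n_gt0 Echi Eid rhoE sumE
  (char_mor g) _ d _ arr source _ dA gA lA (ex_intro _ cA ctA).
- by [].
- by [].
- move=> a; apply: glue_inj; rewrite ?gfstM ?gsndM ?mulr1 ?mul1r //= !gfstE.
  by rewrite -scalerAl mul1r -scalerAr mulr1.
- by move=> b; rewrite /= -glueP fE w0.
- move=> b; apply: glue_inj; last by rewrite !gsndM.
  rewrite !gfstM /= !gfstE (L_sink L_def) // -scalerAr mulr1.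
  by rewrite -glueP fE.
- by apply: (char_mod_inj (E := eps)).
split; first split.
- exact: glue_basic (L_basic L_def) bA.
- exact/directedP.
- exact/gldimP.
- by exists cG; apply/ctP.
exists (char_mod (chi n)); split.
- exact: char_mod_simple.
- by apply/injP/(char_mod_inj _ source); apply: etrans (Echi _ _ (leqnn n) (leqnn n)) _; rewrite eqxx.
- exact/projdimP.
Qed.
End IntoSource.
End Main.

Lemma injdim_iso (K : fieldType) (A : falgType K) (M N : rmodule A) d :
  @iso (rmod A) M N -> injdim M d -> injdim N d.
Proof.
move=> MN /injdimP[H1 H2]; apply/injdimP; split=> [Y|m H]; first exact: vext_isor MN _.
by apply: H2 => Y; apply: vext_isor (iso_sym MN) _.
Qed.

Lemma projdim_iso (K : fieldType) (A : falgType K) (M N : rmodule A) d :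
  @iso (rmod A) M N -> projdim M d -> projdim N d.
Proof.
move=> MN /projdimP[H1 H2]; apply/projdimP; split=> [Y|m H]; first exact: vext_isol MN _.
by apply: H2 => Y; apply: vext_isol (iso_sym MN) _.
Qed.

Theorem theorem4p5 (K : closedFieldType) (n : nat) (n_ge1 : (1 <= n)%N)
    (L : falgType K) (pi : 'AHom(KA K n.+1, L)) (L_def : is_Lambda 2 pi) :
  (forall (d : nat) (A : falgType K) (P : rmodule A) (e : A)
      (f : 'AHom(A, K^o)) (g : 'AHom(L, K^o)),
    strongly_representation_directed A n d ->
    simple_rmodule P -> projective_rmodule P -> injdim P d ->
    primitive_idempotent e -> riso P (proj_at e) ->
    is_character_at e f ->
    is_character_at (pi (KA_vertex K ord0)) g ->
    strongly_representation_directed (glue f g) n (d + n) /\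
    exists P' : rmodule (glue f g),
      [/\ simple_rmodule P', projective_rmodule P' & injdim P' (d + n)]) /\
  (forall (d : nat) (B : falgType K) (I : rmodule B) (eps : B)
      (f : 'AHom(L, K^o)) (g : 'AHom(B, K^o)),
    strongly_representation_directed B n d ->
    simple_rmodule I -> injective_rmodule I -> projdim I d ->
    primitive_idempotent eps -> riso I (inj_at eps) ->
    is_character_at (pi (KA_vertex K ord_max)) f ->
    is_character_at eps g ->
    strongly_representation_directed (glue f g) n (d + n) /\
    exists I' : rmodule (glue f g),
      [/\ simple_rmodule I', injective_rmodule I' & projdim I' (d + n)]).
Proof.
split=> [d A P e f g sA simP _ idP [_ ee _] Pe [fe _] [g0 _]
        |d B I eps f g sB simI _ pdI [_ ee _] Ie [f0 _] [ge _]].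
  have [e_char PT] := simple_proj_at simP ee Pe fe.
  exact: (glue_out L_def n_ge1 ee fe g0 e_char sA (injdim_iso PT idP)).
have [eps_char TI] := simple_inj_at simI ee Ie ge.
exact: (glue_in L_def n_ge1 ee ge f0 eps_char sB (projdim_iso (iso_sym TI) pdI)).
Qed.
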